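(* Let $\mathfrak q$ be a finite-dimensional Lie algebra over $\mathbb K$ with $[\mathfrak q,\mathfrak q]\ne0$, and let $n\ge2$. Suppose that $\mathcal S(\mathfrak q)^{\mathfrak q}=\mathbb K[F_1,\dots,F_m]$ is a graded polynomial ring (with $F_i$ homogeneous and algebraically independent), where $m=\mathrm{ind}\,\mathfrak q$, that the set $\Omega_{\mathfrak q^*}=\{\xi\in\mathfrak q^*: d_\xi F_1\wedge\dots\wedge d_\xi F_m\neq0\}$ is big, and that $\mathfrak q$ has the codim-2 property. Let $p\in\mathbb K[t]$ be a monic polynomial of degree $n$ and $l\in\mathbb K[t]$ a nonzero polynomial with $\deg l\le1$. Then $\mathcal Z(p,p+l)$ is a polynomial ring with $\boldsymbol b(\mathfrak q,n)$ generators.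
   Context: $\mathbb K$ is an algebraically closed field of characteristic $0$. $\mathcal S(\mathfrak q)=\mathbb K[\mathfrak q^*]$ is the symmetric algebra with its Lie–Poisson bracket, and $\mathcal S(\mathfrak q)^{\mathfrak q}=\{H:\{H,x\}=0\ \forall x\in\mathfrak q\}$. An open subset of $\mathfrak q^*$ is big if its complement contains no divisors (i.e. has codimension at least $2$). For $\gamma\in\mathfrak q^*$, $\mathfrak q_\gamma=\{x\in\mathfrak q:\gamma([x,\mathfrak q])=0\}$; $\mathrm{ind}\,\mathfrak q=\min_{\gamma}\dim\mathfrak q_\gamma$; $\mathfrak q^*_{\sf sing}=\{\gamma\in\mathfrak q^*:\dim\mathfrak q_\gamma>\mathrm{ind}\,\mathfrak q\}$. The codim-$k$ property means $\dim\mathfrak q^*_{\sf sing}\le\dim\mathfrak q-k$. Put $\boldsymbol b(\mathfrak q)=\frac12(\dim\mathfrak q+\mathrm{ind}\,\mathfrak q)$ and $\boldsymbol b(\mathfrak q,n)=(n-1)\boldsymbol b(\mathfrak q)+\mathrm{ind}\,\mathfrak q$. For a monic $p\in\mathbb K[t]$ of degree $n$, the Lie algebra $\mathfrak q[t]/(p)=\mathfrak q\otimes(\mathbb K[t]/(p))$ is identified, as a vector space, with $\mathbb W=\mathfrak q\cdot 1\oplus\mathfrak q\bar t\oplus\dots\oplus\mathfrak q\bar t^{\,n-1}$, $\bar t=t+(p)$. The resulting bracket on $\mathbb W$ is $[\,,]_p$, the corresponding Lie–Poisson bracket on $\mathcal S(\mathbb W)$ is $\{\,,\}_p$, and $\mathcal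 Z_p\subset\mathcal S(\mathbb W)$ is the Poisson centre of $(\mathcal S(\mathbb W),\{\,,\}_p)$. If $p_1\ne p_2$ are monic of degree $n$ with $\deg(p_1-p_2)\le 1$, then $\mathcal Z(p_1,p_2)\subset\mathcal S(\mathbb W)$ denotes the subalgebra generated by all $\mathcal Z_{ap_1+(1-a)p_2}$, $a\in\mathbb K$. *)

(* Defs.v *)
From HB Require Import structures.
From mathcomp Require Import all_boot all_order all_algebra.
From mathcomp Require Export mpoly.

Set Implicit Arguments.
Unset Strict Implicit.
Unset Printing Implicit Defensive.

Import GRing.Theory.
Local Open Scope ring_scope.

Section LiePoisson.
Variables (K : fieldType) (V : vectType K).
Implicit Types (br : V -> V -> V) (g : 'Hom(V, K^o)).

Record lie_bracket br : Prop := LieBracket {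
  lie_linl : forall y, linear (br^~ y);
  lie_linr : forall x, linear (br x);
  lie_alt : forall x, br x x = 0;
  lie_jacobi : forall x y z,
    br x (br y z) + br y (br z x) + br z (br x y) = 0 }.

(* S(V) = K[V^*] as the polynomial ring on the basis [vbasis fullv] of V. *)
Definition Sym := {mpoly K[\dim {:V}]}.

Definition bvec (i : 'I_(\dim {:V})) : V := tnth (vbasis {:V}) i.

Definition sym_lin (x : V) : Sym :=
  \sum_i coord (vbasis {:V}) i x *: 'X_i.

Definition sym_eval g (F : Sym) : K := F.@[fun i => g (bvec i)].

Definition lie_poisson br (F G : Sym) : Sym :=
  \sum_i \sum_j F^`M(i) * G^`M(j) * sym_lin (br (bvec i) (bvec j)).

Definition sym_inv br (H : Sym) : Prop :=
  forall x, lie_poisson br H (sym_lin x) = 0.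

Definition poisson_centre br (H : Sym) : Prop :=
  forall G, lie_poisson br H G = 0.

(* [linfun] is only meaningful on linear functions, hence the hypothesis
   of [mem_stab]. *)
Definition stab br g : {vspace V} :=
  lker (linfun (fun x : V => linfun (fun y => g (br x y)) : 'Hom(V, K^o))).

Lemma mem_stab br g x : lie_bracket br ->
  x \in stab br g <-> forall y, g (br x y) = 0.
Proof.
move=> brL.
have linI u : linear (fun y => g (br u y) : K^o).
  by move=> a y z; rewrite (lie_linr brL) linearP.
have lin1E u y : linfun (fun y => g (br u y) : K^o) y = g (br u y).
  pose h := GRing.isLinear.Build _ _ _ _ (fun y => g (br u y) : K^o) (linI u).
  pose f : {linear V -> K^o} := HB.pack (fun y => g (br u y) : K^o) h.
  exact: (lfunE f y).
pose ad u := linfun (fun y => g (br u y)) : 'Hom(V, K^o).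
have linO : linear ad.
  move=> a u v; apply/lfunP => y.
  by rewrite add_lfunE scale_lfunE /ad !lin1E (lie_linl brL y) linearP.
pose h := GRing.isLinear.Build _ _ _ _ ad linO.
pose f : {linear V -> 'Hom(V, K^o)} := HB.pack ad h.
have -> : (x \in stab br g) = (ad x == 0).
  by rewrite memv_ker (lfunE f x).
split=> [/eqP adx0 y | gx0]; first by rewrite -lin1E -/(ad x) adx0 lfunE.
by apply/eqP/lfunP => y; rewrite lin1E gx0 lfunE.
Qed.

Definition is_index br (r : nat) : Prop :=
  (exists g, \dim (stab br g) = r) /\ (forall g, r <= \dim (stab br g))%N.

Definition sing br g : Prop :=
  exists2 r, is_index br r & (r < \dim (stab br g))%N.

(* The dimension of a closed subset Z of V^* is the maximal number of
   algebraically independent elements of its coordinate ring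
   K[Z] = S(V)/I(Z); no tuple is independent on Z = set0. *)
Definition indep_on (Z : 'Hom(V, K^o) -> Prop) r (f : r.-tuple Sym) : Prop :=
  forall P : {mpoly K[r]},
    (forall g, Z g -> sym_eval g (P \mPo f) = 0) -> P = 0.

(* dim Z <= dim V - k; the empty set has every codimension. *)
Definition codim_ge (k : nat) (Z : 'Hom(V, K^o) -> Prop) : Prop :=
  forall r (f : r.-tuple Sym), indep_on Z f -> (r + k <= \dim {:V})%N.

Definition codim_property (k : nat) br : Prop := codim_ge k (sing br).

Definition big (U : 'Hom(V, K^o) -> Prop) : Prop :=
  codim_ge 2 (fun g => ~ U g).

(* d_g F_1 /\ ... /\ d_g F_m <> 0: the coordinates of the wedge product in
   the standard basis of the m-th exterior power of V are the m x m minors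
   of the Jacobian matrix. *)
Definition jacobian g m (F : m.-tuple Sym) : 'M[K]_(m, \dim {:V}) :=
  \matrix_(i, j) sym_eval g (tnth F i)^`M(j).

Definition wedge_neq0 m (F : m.-tuple Sym) g : Prop :=
  exists c : 'I_m -> 'I_(\dim {:V}), \det (colsub c (jacobian g F)) != 0.

Definition b_lie (ind : nat) : nat := (\dim {:V} + ind)./2.

Definition b_lie_n (ind n : nat) : nat := ((n - 1) * b_lie ind + ind)%N.

End LiePoisson.

Section Subalgebras.
Variables (K : fieldType) (d : nat).
Implicit Types (A : {mpoly K[d]} -> Prop).

Definition generated A (H : {mpoly K[d]}) : Prop :=
  exists (k : nat) (G : k.-tuple {mpoly K[d]}) (P : {mpoly K[k]}),
    (forall i, A (tnth G i)) /\ H = P \mPo G.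

Definition alg_indep m (F : m.-tuple {mpoly K[d]}) : Prop :=
  forall P : {mpoly K[m]}, P \mPo F = 0 -> P = 0.

(* A = K[F_1, ..., F_m] *)
Definition generated_by A m (F : m.-tuple {mpoly K[d]}) : Prop :=
  forall H, A H <-> exists P : {mpoly K[m]}, H = P \mPo F.

Definition polynomial_ring A (m : nat) : Prop :=
  exists F : m.-tuple {mpoly K[d]}, alg_indep F /\ generated_by A F.

End Subalgebras.

Section QuotientCurrent.
Variables (K : fieldType) (q : vectType K) (br : q -> q -> q) (n : nat).

(* w : W n stands for \sum_(i < n) w i \bar t^i. *)
Definition W : vectType K := {ffun 'I_n -> q}.

(* [x \bar t^i, y \bar t^j]_p = [x, y] \bar t^(i+j), reduced modulo p. *)
Definition bracket_mod (p : {poly K}) (u v : W) : W :=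
  [ffun k : 'I_n =>
    \sum_(i < n) \sum_(j < n) (('X^(i + j) %% p)`_k *: br (u i) (v j))].

Definition Zcentre (p : {poly K}) : Sym W -> Prop :=
  poisson_centre (bracket_mod p).

Definition Zpair (p1 p2 : {poly K}) : Sym W -> Prop :=
  generated (fun H => exists a : K, Zcentre (a *: p1 + (1 - a) *: p2) H).

End QuotientCurrent.

(* Main.v *)
Require Import Defs.
From HB Require Import structures.
From mathcomp Require Import all_boot all_order all_algebra.
From mathcomp Require Import zify ring.
From Stdlib Require Import Classical.

(** Let Pi be the matrix of the Lie-Poisson tensor of q in a basis and let J be
    the Jacobian matrix of F_1, ..., F_m. For x in q and a polynomial f(t) of
    degree below n, write x f for the element of W whose coefficient in degree
    k is f_k x. A polynomial g(s, t) then defines a map theta g from S(q) to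
    S(W)[s] which replaces every x in q by x g(s, t). All the elements of S(W)
    below are coefficients in s of polynomials theta g F_i.

    Invariants of q. As J Pi = 0, the determinants of Pi + X Y, with X and Y of
    width and height m, are proportional to det (J X) det (Y J^T). Because Omega
    is big, the factor of proportionality is a polynomial; it vanishes only at
    singular points, so by the codim-2 property it is a nonzero constant
    (kostant). Comparing the behaviour of both sides under scaling gives
    2 (deg F_1 + ... + deg F_m) = dim q + m (sum_degrees), and Cramer's rule
    shows that J spans the kernel of Pi, also after an extension of scalars or
    modulo a polynomial in s (kernel_lie). On a line x + s y in general position
    the coefficients of s^e, e < deg F_i, in the differentials dF_i(x + s y) are
    linearly independent: this is the argument shift method
    (argument_shift_free).

    The centre for one modulus p. Let B_p(s, t) = (p(s) - p(t)) / (s - t).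
    Since f(t) B_p and f(s) B_p agree modulo p(s) and p(t), the coefficients of
    the remainders of theta B_p F_i modulo p(s) are central. Conversely, the
    differential of a central element is in the kernel of Pi modulo p(s), hence
    is a combination of the differentials of these coefficients; their
    independence makes the coefficients of the combination central again, and
    Euler's formula gives an induction on the degree (Zcentre_generated).

    The pencil p_c = p + c l. If l is coprime to p, let l_1 be the coefficient
    of t in l and T = l(s) B_p(s, t) - l_1 p(s). Replacing p by p_c does not
    change T, so theta T F_i is congruent to l(s)^(deg F_i) theta B_(p_c) F_i
    modulo p_c(s), where l(s) is invertible: the coefficients of theta T F_i
    generate all the centres. If p = (t - tau) p_0 and l = nu (t - tau), then
    B_(p_c) = (t - tau) B_(p_0)(s, t) + p_0(s) + c nu. Here the coefficients of
    V_i = theta ((t - tau) B_(p_0)(s + tau, t)) F_i and of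
    U_i = theta ((t - tau) B_(p_0)(tau, t) + s) F_i, with V_i(0) = U_i(0),
    generate all the centres. In both cases the values of the polynomials at
    sufficiently many z are, up to scalars, values of theta B_(p_c) F_i at roots
    of p_c, with c depending on z, so that the coefficients are in Z(p, p + l)
    by interpolation.

    In both cases there are m + (n - 1) (deg F_1 + ... + deg F_m) coefficients,
    which is b(q, n). They are independent because of their Jacobian matrix at a
    single point of W^*, chosen so that the curves become x + s^k y: there the
    matrix is block triangular, with one block dF_1(x), ..., dF_m(x) and n - 1
    blocks given by the argument shift method (block_free). *)

Set Implicit Arguments.
Unset Strict Implicit.
Unset Printing Implicit Defensive.

Import GRing.Theory.
Local Open Scope ring_scope.

(** * Polynomial morphisms, derivations and restriction to lines *)

Section Generic.
Variables (A : comNzRingType) (n : nat).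

(** The polynomial ring is generated by constants and variables; every
    extension argument below goes through this induction. *)
Lemma mpoly_ring_ind (P : {mpoly A[n]} -> Prop) :
  (forall c, P c%:MP) -> (forall i, P 'X_i) ->
  (forall p q, P p -> P q -> P (p + q)) ->
  (forall p q, P p -> P q -> P (p * q)) -> forall p, P p.
Proof.
move=> PC PX PD PM; elim/mpolyind=> [|c m p _ _ Pp]; first by rewrite -mpolyC0.
apply: PD => //; rewrite -mul_mpolyC; apply: (PM) => //.
rewrite mpolyXE_id; elim/big_ind: _ => [|q r|i _]; first by rewrite -mpolyC1.
  exact: PM.
elim: (m i) => [|k IHk]; first by rewrite expr0 -mpolyC1.
by rewrite exprS; apply: PM.
Qed.

Lemma mpoly_morph_ext (S : nzRingType) (f g : {rmorphism {mpoly A[n]} -> S}) :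
  (forall c, f c%:MP = g c%:MP) -> (forall i, f 'X_i = g 'X_i) -> f =1 g.
Proof.
move=> fgC fgX; apply: mpoly_ring_ind => // p q fgp fgq.
  by rewrite !rmorphD fgp fgq.
by rewrite !rmorphM fgp fgq.
Qed.

Lemma mmapXU (S : comNzRingType) (f : {rmorphism A -> S}) (h : 'I_n -> S) i :
  mmap f h 'X_i = h i.
Proof. by rewrite mmapX mmap1U. Qed.

Lemma mmap_rmorph (S T : comNzRingType) (f : {rmorphism A -> S})
    (h : 'I_n -> S) (g : {rmorphism S -> T}) (f' : {rmorphism A -> T}) h' :
  (forall c, g (f c) = f' c) -> (forall i, g (h i) = h' i) ->
  forall p, g (mmap f h p) = mmap f' h' p.
Proof.
move=> gf gh; apply: (mpoly_morph_ext (f := g \o mmap f h) (g := mmap f' h')).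
  by move=> c /=; rewrite !mmapC gf.
by move=> i /=; rewrite !mmapXU gh.
Qed.

Lemma eq_mmap (S : comNzRingType) (f : {rmorphism A -> S}) (h h' : 'I_n -> S) :
  h =1 h' -> mmap f h =1 mmap f h'.
Proof. by move=> hh' p; apply: (mmap_rmorph (g := idfun)). Qed.

Definition derivation (S : comNzRingType) (D : S -> S) :=
  {morph D : a b / a + b} /\ (forall a b, D (a * b) = D a * b + a * D b).

Lemma mderivXU i j : ('X_i : {mpoly A[n]})^`M(j) = (i == j)%:R.
Proof.
rewrite mderivX mnm1E; case: eqP => [->|_]; last by rewrite scale0r.
by rewrite -[X in (X - _)%MM]add0m addmK mpolyX0 scale1r.
Qed.

(** The chain rule for a substitution: D composed with the substitution is a
    derivation along it, so it is determined by its values on the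
    variables. *)
Lemma mmap_chain (S : comNzRingType) (f : {rmorphism A -> S}) (h : 'I_n -> S)
    (D : S -> S) :
  derivation D -> (forall c, D (f c) = 0) -> forall p : {mpoly A[n]},
  D (mmap f h p) = \sum_i mmap f h p^`M(i) * D (h i).
Proof.
move=> [DD DM] Df; apply: mpoly_ring_ind => [c|i|p q IHp IHq|p q IHp IHq].
- by rewrite mmapC Df big1 // => i _; rewrite mderivC mmap0 mul0r.
- rewrite mmapXU (bigD1 i) //= big1 ?addr0 => [|j ij].
    by rewrite mderivXU eqxx rmorph1 mul1r.
  by rewrite mderivXU eq_sym (negPf ij) mmap0 mul0r.
- rewrite rmorphD DD IHp IHq -big_split; apply: eq_bigr => i _ /=.
  by rewrite mderivD rmorphD mulrDl.
- rewrite rmorphM DM IHp IHq mulr_suml mulr_sumr -big_split.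
  apply: eq_bigr => i _ /=.
  by rewrite mderivM rmorphD !rmorphM mulrDl mulrAC -!mulrA.
Qed.

End Generic.

Section Top.
Variables (A : comNzRingType).

(** Keeps a degree bound together with the coefficient at that degree, which
    may vanish; both are multiplicative. *)
Definition top (d : nat) (a : {poly A}) (c : A) :=
  (size a <= d.+1)%N /\ a`_d = c.

Lemma topC c : top 0 c%:P c.
Proof. by split; rewrite ?size_polyC ?coefC; case: (c != 0). Qed.

Lemma topM d e a b x y : top d a x -> top e b y -> top (d + e) (a * b) (x * y).
Proof.
move=> [sa <-] [sb <-]; split.
  apply: leq_trans (size_polyMleq _ _) _.
  by move: (leq_add sa sb); lia.
rewrite coefM (bigD1 (inord d)) //= inordK ?leq_addr ?ltnS ?leq_addr //.
rewrite addKn big1 ?addr0 // => i; rewrite -val_eqE /= inordK ?ltnS ?leq_addr //.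
case: ltngtP => // id _; last by rewrite nth_default ?mul0r // (leq_trans sa).
rewrite [b`__]nth_default ?mulr0 // (leq_trans sb) //.
by move: id; lia.
Qed.

Lemma topX d a x k : top d a x -> top (d * k) (a ^+ k) (x ^+ k).
Proof.
move=> ax; elim: k => [|k IHk]; first by rewrite muln0 !expr0; exact: topC.
by rewrite mulnS !exprS; apply: topM.
Qed.

Lemma topD d a b x y : top d a x -> top d b y -> top d (a + b) (x + y).
Proof.
move=> [sa <-] [sb <-]; split; last by rewrite coefD.
by rewrite (leq_trans (size_polyD _ _)) // geq_max sa sb.
Qed.

Lemma top0 d : top d 0 0.
Proof. by split; rewrite ?size_poly0 ?coef0. Qed.

Lemma topW d e a x : top d a x -> (d < e)%N -> top e a 0.
Proof.
move=> [sa _] de; split; first by rewrite (leq_trans sa) // ltnW.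
by rewrite nth_default // (leq_trans sa).
Qed.

Lemma top_prod (I : Type) (r : seq I) (d : I -> nat) a x :
  (forall i, top (d i) (a i) (x i)) ->
  top (\sum_(i <- r) d i) (\prod_(i <- r) a i) (\prod_(i <- r) x i).
Proof.
move=> ax; elim: r => [|i r IHr]; first by rewrite !big_nil; exact: topC.
by rewrite !big_cons; apply: topM.
Qed.

End Top.

Section Line.
Variables (K : comNzRingType) (A : comNzRingType) (f : {rmorphism K -> A}) (n : nat).

(** The restriction of a polynomial to the line x + s y, as a polynomial in
    s. *)
Definition line (x y : 'I_n -> A) : {mpoly K[n]} -> {poly A} :=
  mmap (polyC \o f) (fun i => (x i)%:P + (y i)%:P * 'X).

HB.instance Definition _ x y := GRing.RMorphism.copy (line x y)
  (mmap (polyC \o f) (fun i => (x i)%:P + (y i)%:P * 'X)).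

Lemma lineC x y c : line x y c%:MP = (f c)%:P.
Proof. by rewrite /line mmapC. Qed.

Lemma lineX x y i : line x y 'X_i = (x i)%:P + (y i)%:P * 'X.
Proof. by rewrite /line mmapXU. Qed.

(** Only the component of degree d of h can contribute to the coefficient of
    s^d. *)
Lemma top_line x y d (h : {mpoly K[n]}) : (msize h <= d.+1)%N ->
  top d (line x y h) (mmap f y (pihomog mdeg d h)).
Proof.
move=> sh; rewrite /pihomog raddf_sum /line /= {1}/mmap.
have: forall m, m \in msupp h -> (mdeg m <= d)%N.
  by move=> m /msize_mdeg_lt mh; rewrite -ltnS (leq_trans mh).
elim: (msupp h) => [|m r IHr] hr; first by rewrite !big_nil; exact: top0.
have {}IHr := IHr (fun m' m'r => hr m' (mem_behead (s := m :: r) m'r)).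
have mr: (mdeg m <= d)%N by apply: hr; rewrite inE eqxx.
have tm: top (mdeg m) ((polyC \o f) h@_m *
     mmap1 (fun i => (x i)%:P + (y i)%:P * 'X) m) (f h@_m * mmap1 y m).
  rewrite -[mdeg m]add0n; apply: topM; first exact: topC.
  rewrite mdegE; apply: top_prod => i; rewrite -{1}[m i]mul1n; apply: topX.
  split; last by rewrite coefD coefC coefMX add0r coefC.
  rewrite (leq_trans (size_polyD _ _)) // geq_max size_polyC.
  rewrite (leq_trans (leq_b1 _)) //= (leq_trans (size_polyMleq _ _)) //.
  by rewrite size_polyX addn2 /= ltnS size_polyC leq_b1.
rewrite !big_cons; case: eqP => [md|/eqP md].
  by apply: topD => //; rewrite mmapZ mmapX -md.
rewrite -[X in top _ _ X]add0r; apply: topD => //.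
by apply: topW tm _; rewrite ltn_neqAle md.
Qed.

End Line.

(** * Subsets of codimension two *)

Section CharZero.
Variables (K : fieldType) (charK0 : [pchar K] =i pred0).

Lemma natK_eq0 k : (k%:R == 0 :> K) = (k == 0)%N.
Proof. exact: (pcharf0P _).1. Qed.

(** In characteristic zero the factor of a monomial that a partial derivative
    brings down is invertible. *)
Lemma mderiv_const n (P : {mpoly K[n]}) :
  (forall i, P^`M(i) = 0) -> P = (P@_0)%:MP.
Proof.
move=> dP; apply/mpolyP => m; rewrite mcoeffC.
have [->|m0] := eqVneq m 0%MM; first by rewrite mulr1.
rewrite mulr0; have [i mi] : exists i, m i != 0%N.
  apply/existsP; apply: contraNT m0; rewrite negb_exists => /forallP m0.
  by apply/eqP/mnmP => i; rewrite mnm0E; apply/eqP; rewrite -[_ == _]negbK.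
have le1 : (U_(i) <= m)%MM.
  by apply/mnm_lepP => j; rewrite mnm1E; case: eqP => // <-; rewrite lt0n.
have := mcoeff_mderiv i P (m - U_(i))%MM; rewrite dP mcoeff0 submK //.
by move/esym/eqP; rewrite -mulr_natr mulf_eq0 natK_eq0 orbF => /eqP.
Qed.

Lemma msize_mderiv n (P : {mpoly K[n]}) i : (msize P^`M(i) <= (msize P).-1)%N.
Proof.
rewrite msizeE; apply/bigmax_leqP_seq => m mP _.
have : (m + U_(i))%MM \in msupp P.
  move: mP; rewrite !mcoeff_msupp mcoeff_mderiv.
  by apply: contraNneq => ->; rewrite mul0rn.
by move/msize_mdeg_lt; rewrite mdegD mdeg1; lia.
Qed.

Lemma mcoeff_pihomog n d (h : {mpoly K[n]}) m :
  (pihomog mdeg d h)@_m = if mdeg m == d then h@_m else 0.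
Proof.
rewrite [X in pihomog _ _ X]mpolyE (raddf_sum (pihomog mdeg d)) /= raddf_sum /=.
have -> : (if mdeg m == d then h@_m else 0) =
  \sum_(m' <- msupp h) if mdeg m == d then (h@_m' *: 'X_[m'])@_m else 0.
  case: ifP => md; last by rewrite big1_eq.
  by rewrite {1}[h]mpolyE raddf_sum.
apply: eq_bigr => m' _; rewrite linearZ /= pihomogX mcoeffZ mcoeffZ.
have [<-|mm'] := eqVneq m' m; first by case: ifP; rewrite ?mcoeff0 ?mulr0.
rewrite mcoeffX (negPf mm') mulr0 if_same; case: ifP; rewrite ?mcoeff0 ?mulr0 //.
by rewrite mcoeffX (negPf mm') mulr0.
Qed.

Lemma pihomog_top_neq0 n (h : {mpoly K[n]}) :
  h != 0 -> pihomog mdeg (msize h).-1 h != 0.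
Proof.
move=> h0; apply/eqP => /mpolyP/(_ (mlead h)).
rewrite mcoeff_pihomog mcoeff0 -(mlead_deg h0) eqxx => /eqP.
by rewrite mleadc_eq0 (negPf h0).
Qed.

End CharZero.

Section ClosedField.
Variables (K : closedFieldType) (charK0 : [pchar K] =i pred0).

Lemma poly_fun0 (P : {poly K}) : (forall s, P.[s] = 0) -> P = 0.
Proof.
move=> P0; apply/eqP; case: eqP => // /eqP/closed_nonrootP[s].
by rewrite /root P0 eqxx.
Qed.

Lemma line_horner n (x y : 'I_n -> K) h s :
  (line idfun x y h).[s] = h.@[fun i => x i + s * y i].
Proof.
rewrite -horner_evalE; apply: mmap_rmorph => [c|i] /=.
  by rewrite horner_evalE hornerC.
by rewrite horner_evalE !hornerE mulrC.
Qed.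

(** Induction on the size: a polynomial that vanishes identically has
    vanishing derivatives, so it is constant. *)
Lemma mpoly_fun0 n (P : {mpoly K[n]}) : (forall v, P.@[v] = 0) -> P = 0.
Proof.
have [b] := ubnP (msize P); elim: b P => // b IHb P sP P0.
suff dP i : P^`M(i) = 0.
  have PC := mderiv_const charK0 dP; have := P0 (fun=> 0).
  by rewrite PC mevalC => ->; rewrite mpolyC0.
have [->|P_neq0] := eqVneq P 0; first by rewrite mderiv0.
apply: IHb => [|v].
  apply: leq_ltn_trans (msize_mderiv P i) _; move: sP.
  by rewrite mpolySpred.
have L0 : line idfun v (fun j => (j == i)%:R) P = 0.
  by apply: poly_fun0 => s; rewrite line_horner.
have der : derivation (@deriv K) by split; [exact: derivD | exact: derivM].
have := mmap_chain (fun j => (v j)%:P + ((j == i)%:R)%:P * 'X) der (f := polyC \o idfun)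
  (fun c => derivC c) P.
rewrite -/(line _ _ _ P) L0 linear0 (bigD1 i) //= big1 => [|j ji]; last first.
  by rewrite derivD derivC derivM derivC derivX mul0r !add0r (negPf ji) polyC0 mul0r mulr0.
rewrite derivD derivC derivM derivC derivX eqxx mul0r !add0r !mulr1 addr0.
move/(congr1 (horner_eval 0)); rewrite /horner_eval horner0 -/(line _ _ _ _).
rewrite line_horner => /esym H; rewrite -[RHS]H.
by apply: meval_eq => j; rewrite mul0r addr0.
Qed.

Lemma mpoly_point n (P : {mpoly K[n]}) : P != 0 -> exists v, P.@[v] != 0.
Proof.
move=> P0; apply: NNPP => H; case/eqP: P0; apply: mpoly_fun0 => v.
by apply/eqP; apply: contraT => Pv; case: H; exists v.
Qed.

(** A set of dimension at most d - k, in coordinates: codim_ge with points of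
    affine space instead of linear forms. *)
Definition thin d (k : nat) (Z : ('I_d -> K) -> Prop) : Prop :=
  forall r (f : r.-tuple {mpoly K[d]}),
    (forall P : {mpoly K[r]}, (forall v, Z v -> (P \mPo f).@[v] = 0) -> P = 0) ->
  (r + k <= d)%N.

(** If every line of direction y through a point where e does not vanish met
    Z, then every polynomial constant along that direction would be determined
    by its restriction to Z. There are at least d - 1 independent linear ones,
    which is too many for a set of codimension two. *)
Lemma good_line N d (phi : 'I_d -> {mpoly K[N]}) Z (y : 'I_N -> K) e :
  thin 2 Z -> (forall v, exists x, forall i, (phi i).@[x] = v i) -> e != 0 ->
  exists x, e.@[x] != 0 /\
    forall s, ~ Z (fun i => (phi i).@[x] + s * (phi i).@[y]).
Proof.
move=> thinZ surj e0; apply: NNPP => H.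
have {}H x : e.@[x] != 0 -> exists s, Z (fun i => (phi i).@[x] + s * (phi i).@[y]).
  move=> ex; apply: NNPP => H'; case: H; exists x; split=> // s Zs.
  by case: H'; exists s.
(* Polynomials in functions f constant along the direction of y that vanish
   on Z vanish at every point, since a general line reaches Z. *)
have key r (f : r.-tuple {mpoly K[d]}) P :
    (forall v, Z v -> (P \mPo f).@[v] = 0) ->
    (forall v s i, (tnth f i).@[fun i => v i + s * (phi i).@[y]] = (tnth f i).@[v]) ->
    forall v, (P \mPo f).@[v] = 0.
  move=> PZ finv v; have [x xv] := surj v.
  pose Q := (P \mPo f) \mPo [tuple phi i | i < d].
  have QE z : Q.@[z] = (P \mPo f).@[fun i => (phi i).@[z]].
    by rewrite comp_mpoly_meval; apply: meval_eq => i; rewrite tnth_mktuple.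
  suff : Q = 0.
    move=> Q0; have := QE x; rewrite Q0 meval0 => /esym <-.
    by apply: meval_eq => i; rewrite xv.
  suff : Q * e = 0 by move/eqP; rewrite mulf_eq0 (negPf e0) orbF => /eqP.
  apply: mpoly_fun0 => z; rewrite mevalM.
  have [->|ez] := eqVneq e.@[z] 0; first by rewrite mulr0.
  have [s Zs] := H _ ez; have := PZ _ Zs.
  rewrite QE comp_mpoly_meval => P0; rewrite comp_mpoly_meval.
  by rewrite (meval_eq _ (fun i => esym (finv _ s i))) P0 mul0r.
case: (pickP (fun i => (phi i).@[y] != 0)) => [i0 yi0|y0]; last first.
  suff: (d + 2 <= d)%N by lia.
  apply: (thinZ d [tuple 'X_i | i < d]) => P PZ.
  have PX Q : Q \mPo [tuple 'X_i | i < d] = Q by exact: comp_mpoly_id.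
  rewrite -[P]PX; apply: mpoly_fun0; apply: key => // v s i.
  rewrite tnth_mktuple !mevalXU (eqP (negbFE (y0 i))) mulr0 addr0 //.
case: d => [|d] in phi Z thinZ surj H key i0 yi0 *; first by case: (i0) => [].
(* A basis of the linear forms that vanish on phi y. *)
pose f := [tuple (phi i0).@[y] *: 'X_(lift i0 j) - (phi (lift i0 j)).@[y] *: 'X_i0
             | j < d] : d.-tuple {mpoly K[d.+1]}.
suff: (d + 2 <= d.+1)%N by lia.
apply: (thinZ d f) => P PZ; apply: mpoly_fun0 => u.
have fv : forall v s i, (tnth f i).@[fun i => v i + s * (phi i).@[y]] = (tnth f i).@[v].
  move=> v s i; rewrite tnth_mktuple !mevalB !mevalZ !mevalXU.
  by ring.
pose v i := if unlift i0 i is Some j then u j / (phi i0).@[y] else 0.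
have := key _ _ _ PZ fv v; rewrite comp_mpoly_meval => <-.
apply: meval_eq => j; rewrite tnth_mktuple mevalB !mevalZ !mevalXU /v liftK unlift_none.
by rewrite mulr0 subr0 mulrC divfK.
Qed.

(** One variable version of the Hartogs argument: after removing the gcd of h
    and a, a root of h would be a common root of the polynomials m c. *)
Lemma dvdp_family (I : Type) (h a : {poly K}) (m : I -> {poly K}) :
  h != 0 -> (forall c, h %| a * m c) -> (forall s, ~ forall c, root (m c) s) ->
  h %| a.
Proof.
move=> h0 hm nroot; set g := gcdp h a.
have g0 : g != 0 by rewrite gcdp_eq0 negb_and h0.
have hE : h = (h %/ g) * g by rewrite divpK // dvdp_gcdl.
have aE : a = (a %/ g) * g by rewrite divpK // dvdp_gcdr.
have cop : coprimep (h %/ g) (a %/ g) by rewrite coprimep_div_gcd // h0.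
have hg c : h %/ g %| m c.
  rewrite -(Gauss_dvdpr _ cop) -(dvdp_mul2r _ _ g0) -hE mulrAC -aE; exact: hm.
have [s1|/closed_rootP[s rs]] := eqVneq (size (h %/ g)) 1%N.
  apply: dvdp_trans (dvdp_gcdr h a); rewrite -/g hE.
  by rewrite -[X in _ %| X]mul1r dvdp_mul2r // dvdp1 s1.
by case: (nroot s) => c; apply: root_dvdp (hg c) _.
Qed.

(** A quotient a / h with poles only on a set of codimension two is a
    polynomial. In a direction y where the leading form of h does not vanish
    one divides a by h along the lines x + s y. A nonzero remainder survives
    for general x, and for such x the line avoids the common zeros of the M c,
    contradicting the divisibility in one variable. *)
Lemma hartogs N d (phi : 'I_d -> {mpoly K[N]}) (I : Type)
    (M : I -> {mpoly K[d]}) (h a : {mpoly K[N]}) :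
  thin 2 (fun v => forall c, (M c).@[v] = 0) ->
  (forall v, exists x, forall i, (phi i).@[x] = v i) ->
  (forall x s y i, (phi i).@[fun j => x j + s * y j] =
                   (phi i).@[x] + s * (phi i).@[y]) ->
  h != 0 ->
  (forall c, exists u, h * u = a * (M c \mPo [tuple phi i | i < d])) ->
  exists q, a = h * q.
Proof.
move=> thinZ surj lin h0 hM.
have [y ytop] := mpoly_point (pihomog_top_neq0 h0).
pose L := line (@mpolyC N K) (fun i => 'X_i) (fun i => (y i)%:MP).
have L0 g : (L g).[0] = g.
  have := mpoly_morph_ext (f := horner_eval 0 \o L) (g := idfun).
  apply=> [c|i] /=; rewrite /horner_eval /L ?lineC ?lineX ?hornerC //.
  by rewrite !hornerE.
have LE x g : map_poly (meval x) (L g) = line idfun x y g.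
  apply: mmap_rmorph => [c|i] /=; first by rewrite map_polyC /= mevalC.
  by rewrite rmorphD rmorphM /= !map_polyC map_polyX /= mevalC mevalXU.
have sh : (msize h <= (msize h).-1.+1)%N by exact: leqSpred.
have [sL lcL] := top_line (@mpolyC N K) (fun i => 'X_i) (fun i => (y i)%:MP) sh.
pose k := (msize h).-1; set c := (pihomog mdeg k h).@[y] in ytop.
have {}lcL : (L h)`_k = c%:MP.
  by rewrite lcL; symmetry; apply: (mmap_rmorph (g := @mpolyC N K)).
pose H := (c^-1)%:MP *: L h.
have Hk : H`_k = 1 by rewrite coefZ lcL -rmorphM mulVf.
have sH : size H = k.+1.
  apply/eqP; rewrite eqn_leq (leq_trans (size_scale_leq _ _) sL) /= ltnNge.
  apply/negP => sHk; move: Hk; rewrite nth_default // => /eqP.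
  by rewrite eq_sym oner_eq0.
(* H is monic in s, so that division by it needs no denominators. *)
have Hmon : H \is monic by rewrite monicE lead_coefE sH Hk.
have aE := Pdiv.RingMonic.rdivp_eq Hmon (L a).
set q := Pdiv.Ring.rdivp _ _ in aE; set r := Pdiv.Ring.rmodp _ _ in aE.
have [r0|r_neq0] := eqVneq r 0.
  exists (q.[0] * (c^-1)%:MP).
  rewrite -{1}(L0 a) aE r0 addr0 hornerM hornerZ L0; ring.
have lr : lead_coef r != 0 by rewrite lead_coef_eq0.
have [x [xr xZ]] := good_line y thinZ surj lr.
have hx_dvd : line idfun x y h %| line idfun x y a.
  pose m i := line idfun (fun i => (phi i).@[x]) (fun i => (phi i).@[y]) (M i).
  have hE : (L h)`_k != 0 by rewrite lcL mpolyC_eq0.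
  apply: (@dvdp_family I _ _ m).
  - apply: contraNneq ytop => hx0.
    by rewrite -[c](mevalC x) -lcL -coef_map LE hx0 coef0.
  - move=> i; have [u hu] := hM i.
    suff -> : m i = line idfun x y (M i \mPo [tuple phi i | i < d]).
      by rewrite -rmorphM -hu rmorphM dvdp_mulr.
    apply/eqP; rewrite -subr_eq0; apply/eqP/poly_fun0 => s.
    rewrite hornerD hornerN !line_horner comp_mpoly_meval; apply/eqP.
    rewrite subr_eq0; apply/eqP/meval_eq => j; rewrite tnth_mktuple.
    by rewrite lin.
  - move=> s rm; apply: (xZ s) => i; have := rm i.
    by rewrite /root line_horner => /eqP.
have rxE : line idfun x y a = map_poly (meval x) q * (c^-1 *: line idfun x y h)
                              + map_poly (meval x) r.
  rewrite -!LE aE rmorphD rmorphM; congr (_ * _ + _).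
  by rewrite /H -!mul_polyC rmorphM /= map_polyC /= mevalC.
have : line idfun x y h %| map_poly (meval x) r.
  move: hx_dvd; rewrite rxE dvdp_addr //.
  by rewrite dvdp_mull // dvdpZr ?invr_eq0.
move/dvdp_leq => le; have rx0 : map_poly (meval x) r != 0.
  apply: contraNneq xr => rx0.
  by rewrite lead_coefE -coef_map rx0 coef0.
have := le rx0; rewrite leqNgt => /negP[].
apply: leq_ltn_trans (size_poly _ _) _.
have := Pdiv.Ring.ltn_rmodpN0 (L a) (monic_neq0 Hmon); rewrite -/r sH => sr.
apply: leq_trans sr _; rewrite ltnNge; apply/negP => sx; move: ytop.
by rewrite -[c](mevalC x) -lcL -coef_map LE nth_default ?eqxx.
Qed.

End ClosedField.

(** * Bordered determinants *)

(** Compute the determinant of the block matrix with rows (a, -A) and (B, 1)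
    in two ways; the powers of a allow to avoid any division. *)
Lemma det_sylvester (R : comNzRingType) d m (a : R) (A : 'M[R]_(d, m)) (B : 'M[R]_(m, d)) :
  a ^+ m * \det (a%:M + A *m B) = a ^+ d * \det (a%:M + B *m A).
Proof.
pose T := block_mx a%:M (- A) B 1%:M.
have <- : \det T = \det (a%:M + A *m B).
  have -> : \det T = \det (block_mx 1%:M A 0 1%:M *m T).
    by rewrite det_mulmx det_ublock !det1 !mul1r.
  rewrite mulmx_block !mul1mx !mul0mx !mulmx1 !add0r addNr.
  by rewrite det_lblock det1 mulr1.
have <- : \det T * a ^+ m = a ^+ d * \det (a%:M + B *m A).
  have -> : a ^+ m = \det (block_mx 1%:M A 0 (a%:M : 'M_m)).
    by rewrite det_ublock det1 mul1r det_scalar.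
  rewrite -det_mulmx mulmx_block !mulmx1 !mulmx0 !addr0 mul1mx.
  rewrite mul_scalar_mx mul_mx_scalar scalerN subrr.
  by rewrite det_lblock det_scalar addrC.
by rewrite mulrC.
Qed.

Definition selmx (R : nzRingType) d m (c : 'I_m -> 'I_d) : 'M[R]_(d, m) :=
  \matrix_(i, j) (i == c j)%:R.

Lemma mul_selmx (R : comNzRingType) d m k (B : 'M[R]_(k, d)) (c : 'I_m -> 'I_d) :
  B *m selmx R c = colsub c B.
Proof.
apply/matrixP => i j; rewrite !mxE (bigD1 (c j)) //= mxE eqxx mulr1.
by rewrite big1 ?addr0 // => l lj; rewrite mxE (negPf lj) mulr0.
Qed.

Lemma map_selmx (R S : nzRingType) (f : {rmorphism R -> S}) d m (c : 'I_m -> 'I_d) :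
  map_mx f (selmx R c) = selmx S c.
Proof. by apply/matrixP => i j; rewrite !mxE rmorph_nat. Qed.

Definition border_det (R : comNzRingType) d m (Pi : 'M[R]_d) (X : 'M[R]_(d, m)) (Y : 'M[R]_(m, d)) : R :=
  \det (Pi + X *m Y).

Lemma map_border_det (R S : comNzRingType) (f : {rmorphism R -> S}) d m
    (Pi : 'M[R]_d) (X : 'M[R]_(d, m)) (Y : 'M[R]_(m, d)) :
  f (border_det Pi X Y) = border_det (map_mx f Pi) (map_mx f X) (map_mx f Y).
Proof. by rewrite /border_det -map_mxM -map_mxD det_map_mx. Qed.

Lemma map_border_det_eq (R S : comNzRingType) (f : {rmorphism R -> S}) d m
    (Pi : 'M[R]_d) (J : 'M[R]_(m, d)) (X : 'M[R]_(d, m)) (Y : 'M[R]_(m, d)) k :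
  border_det Pi X Y = k * (\det (J *m X) * \det (Y *m J^T)) ->
  border_det (map_mx f Pi) (map_mx f X) (map_mx f Y) =
  f k * (\det (map_mx f J *m map_mx f X) * \det (map_mx f Y *m (map_mx f J)^T)).
Proof.
by move=> E; rewrite -map_border_det E !rmorphM /= map_trmx -!map_mxM !det_map_mx.
Qed.

Section Exchange.
Variables (R : idomainType) (d m : nat).
Implicit Types (Pi : 'M[R]_d) (J Y : 'M[R]_(m, d)) (X : 'M[R]_(d, m)).

(** Since Pi kills J^T, multiplying Pi + X Y' on the right by t + J^T Z
    changes only the second summand, and Z can be chosen to turn t Y' into t Y
    there. *)
Lemma det_exchange Pi J X Y Y' :
  Pi *m J^T = 0 -> \det (Y' *m J^T) != 0 ->
  \det (Pi + X *m Y) * \det (Y' *m J^T) = \det (Pi + X *m Y') * \det (Y *m J^T).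
Proof.
move=> PiJ; set C' := Y' *m J^T; set C := Y *m J^T; set t := \det C' => t0.
pose Z := \adj C' *m (Y - Y').
have prodE : (Pi + X *m Y') *m (t%:M + J^T *m Z) = t *: (Pi + X *m Y).
  rewrite mulmxDr mul_mx_scalar mulmxDl !mulmxA PiJ !mul0mx add0r.
  rewrite -[X *m Y' *m J^T]mulmxA -/C' -[X *m C' *m _]mulmxA mul_mx_adj mul_mx_scalar.
  by rewrite -scalemxAl -scalerDr -addrA -mulmxDr subrKC.
have ZJ : t%:M + Z *m J^T = \adj C' *m C.
  by rewrite -mulmxA mulmxBl mulmxBr mul_adj_mx addrC subrK.
have := congr1 determinant prodE; rewrite det_mulmx detZ.
move/(congr1 ( *%R (t ^+ m * t))).
have -> : t ^+ m * t * (\det (Pi + X *m Y') * \det (t%:M + J^T *m Z)) =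
    t ^+ d * t ^+ m * \det (Pi + X *m Y') * \det C.
  rewrite -!mulrA [\det (Pi + _) * _]mulrC !mulrA -[_ * t * _]mulrA [t * _]mulrC mulrA.
  rewrite det_sylvester ZJ det_mulmx.
  have -> : t ^+ m = \det (\adj C') * t.
    by rewrite -det_mulmx mul_adj_mx det_scalar.
  ring.
move=> E; apply: (mulfI (x := t ^+ m * t ^+ d)); first by rewrite mulf_neq0 ?expf_neq0.
have -> : t ^+ m * t ^+ d * (\det (Pi + X *m Y) * t) =
          t ^+ m * t * (t ^+ d * \det (Pi + X *m Y)) by ring.
by rewrite -E; ring.
Qed.

Lemma det_exchange2 Pi J X X' Y Y' :
  Pi *m J^T = 0 -> J *m Pi = 0 ->
  \det (J *m X') != 0 -> \det (Y' *m J^T) != 0 ->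
  \det (Pi + X *m Y) * (\det (J *m X') * \det (Y' *m J^T)) =
  \det (Pi + X' *m Y') * (\det (J *m X) * \det (Y *m J^T)).
Proof.
move=> PiJ JPi JX' Y'J.
have H : \det (Pi + X *m Y') * \det (J *m X') = \det (Pi + X' *m Y') * \det (J *m X).
  rewrite -!(det_tr (Pi + _)) -!(det_tr (J *m _)) !linearD /= !trmx_mul.
  apply: det_exchange; last by rewrite -trmx_mul det_tr.
  by rewrite -trmx_mul JPi trmx0.
have E := det_exchange X Y PiJ Y'J.
transitivity (\det (Pi + X *m Y) * \det (Y' *m J^T) * \det (J *m X')); first by ring.
by rewrite E mulrAC H; ring.
Qed.

Lemma exchange_sel Pi J (c0 : 'I_m -> 'I_d) X Y :
  Pi *m J^T = 0 -> J *m Pi = 0 -> \det (colsub c0 J) != 0 ->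
  border_det Pi X Y * (\det (colsub c0 J) * \det (colsub c0 J)) =
  border_det Pi (selmx R c0) (selmx R c0)^T * (\det (J *m X) * \det (Y *m J^T)).
Proof.
move=> PiJ JPi M0; rewrite /border_det -(det_exchange2 (X' := selmx R c0) X Y PiJ JPi).
- by rewrite -trmx_mul det_tr mul_selmx.
- by rewrite mul_selmx.
- by rewrite -trmx_mul det_tr mul_selmx.
Qed.

(** The divisibility that feeds the Hartogs argument: the denominator is the
    square of one minor, while the other minors have no common zeros off a set
    of codimension two. *)
Lemma exchange_sel2 Pi J (c0 c c' : 'I_m -> 'I_d) :
  Pi *m J^T = 0 -> J *m Pi = 0 -> \det (colsub c0 J) != 0 ->
  exists D, D * (\det (colsub c0 J) * \det (colsub c0 J)) =
  border_det Pi (selmx R c0) (selmx R c0)^T * (\det (colsub c J) * \det (colsub c' J)).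
Proof.
move=> PiJ JPi M0; have := exchange_sel (selmx R c) (selmx R c')^T PiJ JPi M0.
by rewrite -trmx_mul det_tr !mul_selmx => E; eexists; exact: E.
Qed.

(** Proportionality of the two sides reduces the computation of their ratio to
    a single choice of X and Y. *)
Lemma exchange_factor Pi J (c0 : 'I_m -> 'I_d) g :
  Pi *m J^T = 0 -> J *m Pi = 0 -> \det (colsub c0 J) != 0 ->
  border_det Pi (selmx R c0) (selmx R c0)^T =
    \det (colsub c0 J) * \det (colsub c0 J) * g ->
  forall X Y, border_det Pi X Y = g * (\det (J *m X) * \det (Y *m J^T)).
Proof.
move=> PiJ JPi M0 gE X Y; apply: (mulIf (mulf_neq0 M0 M0)).
by rewrite (exchange_sel X Y PiJ JPi M0) gE; ring.
Qed.

(** Decomposes a multiple of the identity into a part through Pi and a part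
    through J: a row vector killed by Pi becomes, up to a scalar, a
    combination of the rows of J. *)
Lemma cramer_kernel Pi J X Y : J *m Pi = 0 ->
  (\det (J *m X) * \det (Pi + X *m Y))%:M =
  \det (J *m X) *: (Pi *m \adj (Pi + X *m Y)) +
  \det (Pi + X *m Y) *: (X *m \adj (J *m X) *m J).
Proof.
move=> JPi; set D := Pi + X *m Y; set C := J *m X.
have CY : C *m Y *m \adj D = \det D *: J.
  have -> : C *m Y = J *m D by rewrite mulmxDr JPi add0r mulmxA.
  by rewrite -mulmxA mul_mx_adj mul_mx_scalar.
have CYa : \det C *: (Y *m \adj D) = \det D *: (\adj C *m J).
  by rewrite [RHS]scalemxAr -CY -mulmxA [RHS]mulmxA mul_adj_mx mul_scalar_mx.
rewrite -[X *m _ *m J]mulmxA [X in _ + X]scalemxAr -CYa -scalemxAr -scalerDr mulmxA -mulmxDl.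
by rewrite mul_mx_adj scale_scalar_mx.
Qed.

End Exchange.

(** * The Poisson tensor of a Lie algebra *)

Section Homog.
Variables (K : fieldType) (n : nat).

Lemma mmap_homog (S : comNzRingType) (f : {rmorphism K -> S}) (t : S)
    (h : 'I_n -> S) e (p : {mpoly K[n]}) : p \is e.-homog ->
  mmap f (fun i => t * h i) p = t ^+ e * mmap f h p.
Proof.
move/dhomogP => hp; rewrite /mmap mulr_sumr; apply: eq_big_seq => m mp.
rewrite mulrCA; congr (_ * _); rewrite /mmap1.
under eq_bigr do rewrite exprMn.
by rewrite big_split /= prodrXr -mdegE (hp m mp).
Qed.

Lemma dhomog_mderiv e (p : {mpoly K[n]}) i :
  p \is e.-homog -> p^`M(i) \is e.-1.-homog.
Proof.
move/dhomogP => hp; apply/dhomogP => m; rewrite mcoeff_msupp mcoeff_mderiv => mp.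
have /hp : (m + U_(i))%MM \in msupp p.
  by rewrite mcoeff_msupp; apply: contraNneq mp => ->; rewrite mul0rn.
by move=> /= <-; rewrite mdegD mdeg1 addn1.
Qed.

End Homog.

Section Sym.
Variables (K : fieldType) (V : vectType K).
Local Notation d := (\dim {:V}).
Implicit Types (br : V -> V -> V).

Lemma sym_lin_is_linear : linear (@sym_lin K V).
Proof.
move=> a x y; rewrite /sym_lin scaler_sumr -big_split.
by apply: eq_bigr => i _; rewrite linearP scalerDl scalerA.
Qed.

HB.instance Definition _ := GRing.isLinear.Build K V {mpoly K[d]} _ (@sym_lin K V)
  sym_lin_is_linear.

Lemma sym_linZ a x : sym_lin (a *: x : V) = a *: (sym_lin x : {mpoly K[d]}).
Proof. exact: linearZ. Qed.

Lemma sym_lin_sum (I : Type) (r : seq I) (x : I -> V) :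
  sym_lin (\sum_(j <- r) x j) = \sum_(j <- r) (sym_lin (x j) : {mpoly K[d]}).
Proof. exact: linear_sum. Qed.

Lemma coord_bvec (i j : 'I_d) : coord (vbasis {:V}) i (bvec j) = (i == j)%:R.
Proof.
by rewrite /bvec (tnth_nth 0) coord_free ?(basis_free (vbasisP _)) // eq_sym.
Qed.

Lemma coordZ k (X : k.-tuple V) i a x : coord X i (a *: x) = a * coord X i x.
Proof. exact: linearZ. Qed.

Lemma coord_sumE k (X : k.-tuple V) i (I : Type) (r : seq I) (x : I -> V) :
  coord X i (\sum_(j <- r) x j) = \sum_(j <- r) coord X i (x j).
Proof. exact: linear_sum. Qed.

Lemma bvec_sum (x : V) : x = \sum_i coord (vbasis {:V}) i x *: bvec i.
Proof.
rewrite {1}(coord_vbasis (memvf x)); apply: eq_bigr => i _.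
by rewrite /bvec (tnth_nth 0).
Qed.

Lemma sym_lin_eval v x : (sym_lin x : Sym V).@[v] = \sum_i coord (vbasis {:V}) i x * v i.
Proof.
rewrite /sym_lin rmorph_sum; apply: eq_bigr => i _ /=.
by rewrite mevalZ mevalXU.
Qed.

Lemma sym_lin_evalg (g : 'Hom(V, K^o)) x :
  (sym_lin x : Sym V).@[fun i => g (bvec i)] = g x.
Proof.
rewrite sym_lin_eval {2}[x]bvec_sum linear_sum.
by apply: eq_bigr => i _; rewrite linearZ.
Qed.

Lemma mderiv_sym_lin x j : (sym_lin x : Sym V)^`M(j) = (coord (vbasis {:V}) j x)%:MP.
Proof.
rewrite /sym_lin linear_sum (bigD1 j) //= mderivZ mderivXU eqxx.
rewrite big1 ?addr0 => [|i ij]; first by rewrite -mul_mpolyC mulr1.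
by rewrite mderivZ mderivXU (negPf ij) scaler0.
Qed.

Lemma lie_poisson_lin br (H : Sym V) x : (forall y, linear (br y)) ->
  lie_poisson br H (sym_lin x) = \sum_i H^`M(i) * sym_lin (br (bvec i) x).
Proof.
move=> brl; apply: eq_bigr => i _.
pose h := GRing.isLinear.Build _ _ _ _ (br (bvec i)) (brl (bvec i)).
pose f : {linear V -> V} := HB.pack (br (bvec i)) h.
rewrite -[br (bvec i) x]/(f x) {2}[x]bvec_sum !linear_sum mulr_sumr.
apply: eq_bigr => j _; rewrite mderiv_sym_lin !linearZ /= -mulrA.
by rewrite mul_mpolyC.
Qed.

(** The bracket is a derivation in each argument, so linear forms suffice to
    test centrality. *)
Lemma poisson_centreE br (H : Sym V) : (forall y, linear (br y)) ->
  poisson_centre br H <-> forall x, lie_poisson br H (sym_lin x) = 0.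
Proof.
move=> brl; split=> [H0 x|H0 G]; first exact: H0.
rewrite /lie_poisson exchange_big /= big1 // => j _.
under eq_bigr do rewrite mulrAC.
by rewrite -mulr_suml -lie_poisson_lin // H0 mul0r.
Qed.

Lemma hom_point (v : 'I_d -> K) : exists g : 'Hom(V, K^o), forall i, g (bvec i) = v i.
Proof.
have lin : linear (fun x => \sum_i coord (vbasis {:V}) i x * v i : K^o).
  move=> a x y; rewrite scaler_sumr -big_split; apply: eq_bigr => i _ /=.
  by rewrite linearP /= mulrDl -mulrA.
pose h := GRing.isLinear.Build _ _ _ _ _ lin.
pose f : {linear V -> K^o} := HB.pack (fun x => \sum_i coord (vbasis {:V}) i x * v i : K^o) h.
exists (linfun f) => i; rewrite lfunE /= (bigD1 i) //= coord_bvec eqxx mul1r.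
by rewrite big1 ?addr0 // => j ji; rewrite coord_bvec (negPf ji) mul0r.
Qed.

End Sym.

Section Index.
Variables (K : closedFieldType) (V : vectType K).
Local Notation d := (\dim {:V}).

Lemma thin_codim k (Zh : 'Hom(V, K^o) -> Prop) (Z : ('I_d -> K) -> Prop) :
  codim_ge k Zh ->
  (forall v, Z v -> exists2 g, Zh g & forall i, g (bvec i) = v i) -> thin k Z.
Proof.
move=> cod ZZh r f indep; apply: (cod r f) => P P0; apply: indep => v.
move=> /ZZh[g /P0 Pg gv]; rewrite -[RHS]Pg /sym_eval.
by apply: meval_eq => i; rewrite gv.
Qed.

Definition poisson_mx (br : V -> V -> V) : 'M[{mpoly K[d]}]_d :=
  \matrix_(i, j) sym_lin (br (bvec i) (bvec j)).

(** Gaussian elimination reduces the matrix to a partial identity, which is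
    completed by the remaining unit vectors; m may exceed the corank. *)
Lemma complement_rank m (A : 'M[K]_d) : (d <= \rank A + m)%N ->
  exists (X : 'M[K]_(d, m)) (Y : 'M[K]_(m, d)), \det (A + X *m Y) != 0.
Proof.
move=> rA; set r : nat := \rank A.
pose T : 'M[K]_(d, m) := \matrix_(i, j) (i == (r + j)%N :> nat)%:R.
have TT : T *m T^T = copid_mx r.
  apply/matrixP => i k; rewrite !mxE.
  have [ri|ir] := ltnP i r.
    rewrite andbT subrr big1 // => j _; rewrite !mxE.
    by rewrite ltn_eqF ?mul0r // (leq_trans ri) ?leq_addr.
  rewrite andbF subr0; have ijm : (i - r < m)%N by have := ltn_ord i; move: rA; rewrite -/r; lia.
  rewrite (bigD1 (Ordinal ijm)) //= !mxE /= subnKC // eqxx mul1r.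
  rewrite big1 ?addr0 => [|j]; first by rewrite eq_sym.
  rewrite -val_eqE /= => ji; rewrite !mxE; case: eqP => [E|_]; rewrite ?mul0r //.
  by move: ji; rewrite E addKn eqxx.
exists (col_ebase A *m T), (T^T *m row_ebase A).
rewrite mulmxA -[_ *m T *m _]mulmxA TT -{1}[A]mulmx_ebase -mulmxDl -mulmxDr.
rewrite /copid_mx addrC subrK mulmx1 det_mulmx mulf_neq0 //.
  by rewrite -unitfE -unitmxE col_ebase_unit.
by rewrite -unitfE -unitmxE row_ebase_unit.
Qed.

(** At a regular point the corank of Pi is the dimension of the stabiliser,
    which is the index m. *)
Lemma regular_complement br m g : lie_bracket br -> is_index br m -> ~ sing br g ->
  exists (X : 'M[K]_(d, m)) (Y : 'M[K]_(m, d)),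
    \det (map_mx (meval (fun i => g (bvec i))) (poisson_mx br) + X *m Y) != 0.
Proof.
move=> brL ind nsing; set A := map_mx _ _; apply: complement_rank.
have dimm : (\dim (stab br g) <= m)%N.
  by rewrite leqNgt; apply/negP => lt; apply: nsing; exists m.
suff : (d - \rank A <= \dim (stab br g))%N.
  by move/leq_trans/(_ dimm); rewrite leq_subLR.
pose B := row_base (kermx A); rewrite -mxrank_ker.
pose u (i : 'I_(\rank (kermx A))) : V := \sum_j B i j *: bvec j.
have freeu : free [tuple u i | i < \rank (kermx A)].
  apply/freeP => k; rewrite (eq_bigr (fun i => k i *: u i)) => [ku|i _]; last first.
    by rewrite -tnth_nth tnth_mktuple.
  have kB : (\row_i k i) *m B = 0.
    apply/rowP => j; rewrite mxE [RHS]mxE.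
    have := congr1 (coord (vbasis {:V}) j) ku; rewrite linear0 coord_sumE => E; rewrite -[RHS]E.
    apply: eq_bigr => i _; rewrite coordZ [(\row_i _) _ _]mxE; congr (_ * _).
    rewrite /u coord_sumE [RHS](bigD1 j) //= coordZ coord_bvec eqxx mulr1.
    by rewrite big1 ?addr0 // => l lj; rewrite coordZ coord_bvec eq_sym (negPf lj) mulr0.
  move=> i; have /row_freeP[C BC] := row_base_free (kermx A).
  have : (\row_i k i) *m B *m C = 0 by rewrite kB mul0mx.
  by rewrite -mulmxA BC mulmx1 => /rowP/(_ i); rewrite mxE [RHS]mxE.
rewrite -[X in (X <= _)%N](size_tuple [tuple u i | i < _]) -(eqP freeu).
apply/dimvS/span_subvP => x /tnthP[i ->]; rewrite tnth_mktuple.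
apply/(mem_stab g _ brL) => y.
have Bker : B *m A = 0.
  by apply/sub_kermxP; rewrite eq_row_base.
have linl z : linear (br^~ z) by exact: lie_linl.
have brs z : br (u i) z = \sum_j B i j *: br (bvec j) z.
  pose h := GRing.isLinear.Build _ _ _ _ (br^~ z) (linl z).
  pose f : {linear V -> V} := HB.pack (br^~ z) h.
  rewrite -[br _ z]/(f _) linear_sum; apply: eq_bigr => j _.
  by rewrite linearZ.
have gb k : g (br (u i) (bvec k)) = 0.
  have := congr1 (fun M : 'M_(_, _) => M i k) Bker; rewrite /= mxE [RHS]mxE => E; rewrite -[RHS]E.
  rewrite brs linear_sum; apply: eq_bigr => j _.
  by rewrite linearZ /= [A _ _]mxE [poisson_mx _ _ _]mxE sym_lin_evalg.
pose h := GRing.isLinear.Build _ _ _ _ (br (u i)) (lie_linr brL (u i)).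
pose f : {linear V -> V} := HB.pack (br (u i)) h.
rewrite -[br _ y]/(f y) [y]bvec_sum !linear_sum big1 // => k _.
by rewrite !linearZ /= gb scaler0.
Qed.
End Index.

(** * Kostant's identity *)

Section Thin.
Variables (K : closedFieldType) (charK0 : [pchar K] =i pred0) (d : nat).
Variables (Z : ('I_d -> K) -> Prop) (thinZ : thin 2 Z).

Lemma surj_id (v : 'I_d -> K) : exists x, forall i, ('X_i : {mpoly K[d]}).@[x] = v i.
Proof. by exists v => i; rewrite mevalXU. Qed.

Lemma thin_avoid : exists v, ~ Z v.
Proof.
have [x [_ xZ]] := good_line charK0 (fun=> 0) thinZ surj_id (oner_neq0 _).
by exists (fun i => ('X_i : {mpoly K[d]}).@[x] + 0 * ('X_i : {mpoly K[d]}).@[fun=> 0]).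
Qed.

(** A nonconstant polynomial has a zero on a line that avoids Z. *)
Lemma thin_const (g : {mpoly K[d]}) :
  (forall v, g.@[v] = 0 -> Z v) -> exists c, g = c%:MP.
Proof.
move=> gZ; have [s1|s1] := leqP (msize g) 1.
  by exists g@_0; apply: msize1_polyC.
have g0 : g != 0 by rewrite -msize_poly_eq0; lia.
have [y ytop] := mpoly_point charK0 (pihomog_top_neq0 g0).
have [x [_ xZ]] := good_line charK0 y thinZ surj_id (oner_neq0 _).
have sg : (msize g <= (msize g).-1.+1)%N by exact: leqSpred.
have [_ lcL] := top_line idfun x y sg.
have [|s /eqP] := closed_rootP (line idfun x y g) _.
  apply/eqP => sL; move: lcL; rewrite nth_default => [E|]; last by rewrite sL; lia.
  by move: ytop; rewrite /meval -E eqxx.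
rewrite line_horner => gs; case: (xZ s); apply: gZ; rewrite -[RHS]gs.
by apply: meval_eq => i; rewrite !mevalXU.
Qed.

End Thin.

Section Kostant.
Variables (K : closedFieldType) (charK0 : [pchar K] =i pred0).
Variables (q : vectType K) (br : q -> q -> q) (brL : lie_bracket br).
Variables (m : nat) (m_ind : is_index br m) (F : m.-tuple (Sym q)).
Local Notation d := (\dim {:q}).
Variables (deg : 'I_m -> nat) (F_homog : forall i, tnth F i \is (deg i).-homog).
Hypothesis (F_inv : forall i, sym_inv br (tnth F i)).
Hypothesis (Omega_big : big (wedge_neq0 F)) (codim2 : codim_property 2 br).

Definition jac : 'M[{mpoly K[d]}]_(m, d) := \matrix_(i, j) (tnth F i)^`M(j).
Local Notation Pi := (poisson_mx br).
Local Notation J := jac.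
Local Notation "A ^^" := (map_mx (@mpolyC d K) A) (at level 2).

Definition jac_minor (c : 'I_m -> 'I_d) : {mpoly K[d]} := \det (colsub c J).
(** The complement of Omega. *)
Definition bad (v : 'I_d -> K) := forall c, (jac_minor c).@[v] = 0.

Lemma thin_bad : thin 2 bad.
Proof.
apply: thin_codim Omega_big _ => v vbad; have [g gv] := hom_point v.
exists g => // -[c]; suff -> : colsub c (jacobian g F) = map_mx (meval v) (colsub c J).
  by rewrite det_map_mx /=; move: (vbad c); rewrite /jac_minor => ->; rewrite eqxx.
by apply/matrixP => i j; rewrite !mxE; apply: meval_eq => k.
Qed.

(** This matrix identity is the invariance of the F_i. *)
Lemma jac_poisson : J *m Pi = 0.
Proof.
apply/matrixP => i k; rewrite mxE [RHS]mxE.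
have := F_inv i (bvec k); rewrite (lie_poisson_lin _ _ (lie_linr brL)) => H.
by rewrite -[RHS]H; apply: eq_bigr => j _; rewrite !mxE.
Qed.

Lemma poisson_skew : Pi^T = - Pi.
Proof.
apply/matrixP => i j; rewrite !mxE -linearN; congr sym_lin.
have linD : forall x y z, br (x + y) z = br x z + br y z.
  by move=> x y z; have := lie_linl brL z 1 x y; rewrite /= !scale1r.
have linDr : forall x y z, br z (x + y) = br z x + br z y.
  by move=> x y z; have := lie_linr brL z 1 x y; rewrite !scale1r.
have := lie_alt brL (bvec i + bvec j); rewrite linD !linDr !(lie_alt brL) add0r addr0.
by move/eqP; rewrite addr_eq0 => /eqP ->; rewrite opprK.
Qed.

Lemma poisson_jac : Pi *m J^T = 0.
Proof.
by apply: trmx_inj; rewrite trmx_mul trmxK poisson_skew mulmxN jac_poisson oppr0 trmx0.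
Qed.

Lemma minor_exists : exists c, jac_minor c != 0.
Proof.
have [v vbad] := thin_avoid charK0 thin_bad; apply: NNPP => H; apply: vbad => c.
have [->|mc] := eqVneq (jac_minor c) 0; first by rewrite meval0.
by case: H; exists c.
Qed.

(** The ratio g of both sides is a polynomial by two applications of the
    Hartogs argument, one for each minor in the denominator. At a regular
    point the left-hand side is nonzero for some X and Y, so g vanishes only
    on the singular set and is constant. *)
Lemma kostant : exists2 kappa : K, kappa != 0 &
  forall (X : 'M[K]_(d, m)) (Y : 'M[K]_(m, d)),
  border_det Pi X^^ Y^^ = kappa%:MP * (\det (J *m X^^) * \det (Y^^ *m J^T)).
Proof.
have [c0 M0] := minor_exists.
set D0 := border_det Pi (selmx _ c0) (selmx _ c0)^T.
have linX : forall (x : 'I_d -> K) s y i, ('X_i : {mpoly K[d]}).@[fun j => x j + s * y j] =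
                   ('X_i : {mpoly K[d]}).@[x] + s * ('X_i : {mpoly K[d]}).@[y].
  by move=> x s y i; rewrite !mevalXU.
have har a := hartogs (a := a) charK0 thin_bad (@surj_id K d) linX (mulf_neq0 M0 M0).
have [g D0E] : exists g, D0 = jac_minor c0 * jac_minor c0 * g.
  apply: (har) => c; rewrite comp_mpoly_id.
  suff [u E] : exists u, D0 * jac_minor c = jac_minor c0 * jac_minor c0 * u by exists u.
  apply: (har) => c'; rewrite comp_mpoly_id.
  have [u E] := exchange_sel2 c c' poisson_jac jac_poisson M0.
  exists u; rewrite -[RHS]mulrA; move: E; rewrite -/D0 -/(jac_minor _) => <-; exact: mulrC.
have DE := exchange_factor poisson_jac jac_poisson M0 D0E.
pose Zs v := exists2 h : 'Hom(q, K^o), sing br h & forall i, h (bvec i) = v i.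
have thinZ : thin 2 Zs by apply: thin_codim codim2 _ => v.
have nZs v : ~ Zs v -> g.@[v] != 0.
  move=> nZ; have [h hv] := hom_point v.
  have ns : ~ sing br h by move=> sh; apply: nZ; exists h.
  have [X [Y XY]] := regular_complement brL m_ind ns.
  apply: contraNneq XY => gv.
  have CE a b (A : 'M[K]_(a, b)) : map_mx (meval v) A^^ = A.
    by apply/matrixP => i j; rewrite !mxE mevalC.
  have -> : map_mx (meval (fun i => h (bvec i))) Pi = map_mx (meval v) Pi.
    by apply/matrixP => i j; rewrite !mxE; apply: meval_eq.
  rewrite -/(border_det _ _ _) -(CE _ _ X) -(CE _ _ Y) -map_border_det DE.
  by rewrite rmorphM /= gv mul0r.
have [kappa gE] : exists kappa, g = kappa%:MP.
  apply: (thin_const charK0 thinZ) => v gv; apply: NNPP => /nZs.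
  by rewrite gv eqxx.
exists kappa; last by move=> X Y; rewrite DE gE.
have [v /nZs] := thin_avoid charK0 thinZ; by rewrite gE mevalC.
Qed.

(** An invariant of degree zero would make all the minors of J vanish. *)
Lemma deg_gt0 i : (0 < deg i)%N.
Proof.
have [c0 M0] := minor_exists; rewrite lt0n; apply: contraNneq M0 => d0.
have Fi : tnth F i = ((tnth F i)@_0)%:MP.
  apply: msize1_polyC; rewrite msizeE; apply/bigmax_leqP_seq => u uF _.
  by have /dhomogP := F_homog i; rewrite d0 => /(_ u uF) /= ->.
rewrite /jac_minor (expand_det_row _ i) big1 // => j _.
by rewrite !mxE Fi mderivC mul0r.
Qed.

(** Both sides of Kostant's identity have to scale in the same way when the
    point is doubled. *)
Lemma sum_degrees : (d + m = 2 * \sum_i deg i)%N.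
Proof.
have [kappa k0 kos] := kostant.
pose Zs v := exists2 h : 'Hom(q, K^o), sing br h & forall i, h (bvec i) = v i.
have thinZ : thin 2 Zs by apply: thin_codim codim2 _ => v.
have [v vZ] := thin_avoid charK0 thinZ; have [h hv] := hom_point v.
have ns : ~ sing br h by move=> sh; apply: vZ; exists h.
have [X [Y XY]] := regular_complement brL m_ind ns.
pose ev v := map_mx (meval v) : 'M[{mpoly K[d]}]_d -> 'M[K]_d.
have evE u (X' : 'M[K]_(d, m)) (Y' : 'M[K]_(m, d)) :
   border_det (map_mx (meval u) Pi) X' Y' =
   kappa * (\det (map_mx (meval u) J *m X') * \det (Y' *m (map_mx (meval u) J)^T)).
  have CE a b (A : 'M[K]_(a, b)) : map_mx (meval u) A^^ = A.
    by apply/matrixP => i j; rewrite !mxE mevalC.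
  have := map_border_det_eq (meval u) (kos X' Y').
  by rewrite !CE /= mevalC.
(* Doubling the point multiplies Pi by 2 and the i-th row of J by a power. *)
set w := fun i => h (bvec i) in XY.
pose w2 i := 2%:R * w i.
have Pi2 : map_mx (meval w2) Pi = 2%:R *: map_mx (meval w) Pi.
  apply/matrixP => i j; rewrite !mxE !sym_lin_eval mulr_sumr.
  by apply: eq_bigr => k _; rewrite mulrCA.
have J2 : map_mx (meval w2) J =
    diag_mx (\row_i 2%:R ^+ (deg i).-1) *m map_mx (meval w) J.
  apply/matrixP => i j; rewrite mul_diag_mx !mxE.
  by rewrite /meval (mmap_homog _ _ _ (dhomog_mderiv j (F_homog i))).
pose e := (\sum_i (deg i).-1)%N.
have detD : \det (diag_mx (\row_i 2%:R ^+ (deg i).-1) : 'M[K]_m) = 2%:R ^+ e.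
  by rewrite det_diag /e -prodrXr; apply: eq_bigr => i _; rewrite mxE.
have two0 : 2%:R != 0 :> K by rewrite natK_eq0.
have e1 := evE w2 X Y; have e2 := evE w X (2%:R^-1 *: Y).
have e3 := evE w X Y.
have L1 : border_det (map_mx (meval w2) Pi) X Y =
    2%:R ^+ d * border_det (map_mx (meval w) Pi) X (2%:R^-1 *: Y).
  by rewrite /border_det -detZ scalerDr Pi2 -scalemxAr scalerA mulfV // scale1r.
rewrite J2 -!mulmxA det_mulmx detD trmx_mul tr_diag_mx mulmxA det_mulmx detD in e1.
rewrite L1 e2 -scalemxAl detZ in e1.
have nz : \det (map_mx (meval w) J *m X) * \det (Y *m (map_mx (meval w) J)^T) != 0.
  by apply: contraNneq XY => E; rewrite -/(border_det _ _ _) e3 E mulr0.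
set M := _ * _ in nz.
have E : 2%:R ^+ d = 2%:R ^+ (e + e + m) :> K.
  apply: (mulfI nz); apply: (mulfI k0); apply: (mulIf (expf_neq0 m (invr_neq0 two0))).
  rewrite !exprD -!mulrA -exprMn_comm; last exact: mulrC.
  rewrite mulfV // expr1n mulr1.
  transitivity (2%:R ^+ d * (kappa * (\det (map_mx (meval w) J *m X) *
      (2%:R^-1 ^+ m * \det (Y *m (map_mx (meval w) J)^T))))); first by rewrite /M; ring.
  rewrite e1 /M; ring.
have {}E : d = (e + e + m)%N.
  move: E; rewrite -!natrX => /eqP.
  have inj a b : a%:R == b%:R :> K -> a = b.
    wlog ab : a b / (a <= b)%N.
      by move=> W; case: (leqP a b) => [|/ltnW] /W // H /[1!eq_sym] /H.
    by rewrite eq_sym -subr_eq0 -natrB // natK_eq0 // subn_eq0 => ba; apply/eqP; rewrite eqn_leq ab.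
  by move/inj/eqP; rewrite eqn_exp2l // => /eqP.
have dE : (\sum_i deg i = e + m)%N.
  rewrite /e -[X in (_ + X)%N](card_ord m) -sum1_card -big_split /=.
  by apply: eq_bigr => i _; rewrite addn1 prednK ?deg_gt0.
rewrite dE {1}E; lia.
Qed.

End Kostant.

(** * The kernel of the Poisson tensor and the shift of argument *)

(** By Cramer's rule the coordinates of v with respect to the rows of J are
    fractions, with any of the minors of J as denominator. The two conditions
    on psi, cancellation and the Hartogs property modulo P, make them
    regular. *)
Lemma kernel_span (R : idomainType) (S : comNzRingType) (psi : {rmorphism R -> S})
    d m (Pi : 'M[R]_d) (J : 'M[R]_(m, d)) (P : S) (c0 : 'I_m -> 'I_d) k k' :
  J *m Pi = 0 -> k' * k = 1 ->
  border_det Pi (selmx R c0) (selmx R c0)^T =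
    k * (\det (colsub c0 J) * \det (colsub c0 J)) ->
  (forall a b, psi (\det (colsub c0 J)) * a = P * b -> exists b', a = P * b') ->
  (forall a, (forall c, exists u b,
       psi (\det (colsub c0 J)) * u = psi (\det (colsub c J)) * a + P * b) ->
     exists r b, a = psi (\det (colsub c0 J)) * r + P * b) ->
  forall (v B : 'rV[S]_d), v *m map_mx psi Pi = P *: B ->
  exists (r : 'rV[S]_m) (B' : 'rV[S]_d), v = r *m map_mx psi J + P *: B'.
Proof.
move=> JPi k'k detD; set h := psi (\det _) => cancel har v B vPi.
set J' := map_mx psi J; pose X0 := selmx R c0.
have cancel_mx (A C : 'rV[S]_d) : h *: A = P *: C -> exists C', A = P *: C'.
  move=> AC; have /fin_all_exists[C' AC'] : forall j, exists b, A 0 j = P * b.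
    move=> j; apply: cancel (C 0 j) _.
    by have /rowP/(_ j) := AC; rewrite !mxE.
  by exists (\row_j C' j); apply/rowP => j; rewrite !mxE AC'.
(* The coordinates of h v in terms of J, by Cramer's rule. *)
pose u0 := v *m map_mx psi X0 *m \adj (J' *m map_mx psi X0).
have JX c : J' *m map_mx psi (selmx R c) = map_mx psi (colsub c J).
  by rewrite -map_mxM mul_selmx.
have dJX c : \det (J' *m map_mx psi (selmx R c)) = psi (\det (colsub c J)).
  by rewrite JX det_map_mx.
have [B1 E1] : exists B1, h *: v - u0 *m J' = P *: B1.
  pose Ad := map_mx psi (\adj (Pi + X0 *m X0^T)).
  have E : (psi k * (h * h)) *: (h *: v) =
           P *: (h *: (B *m Ad)) + (psi k * (h * h)) *: (u0 *m J').
    have := congr1 (fun M => v *m map_mx psi M) (cramer_kernel X0 X0^T JPi).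
    rewrite /= map_scalar_mx map_mxD !map_mxZ !map_mxM -/Ad -/J'.
    rewrite [map_mx psi (\adj (J *m X0))]map_mx_adj map_mxM -/J'.
    rewrite mulmxDr mul_mx_scalar -!scalemxAr !mulmxA vPi -!scalemxAl -/u0.
    rewrite mul_selmx -/(border_det _ _ _) detD !rmorphM /= -/h => E.
    by rewrite scalerA mulrC E !scalerA [h * P]mulrC.
  have kk : psi k' * psi k = 1 by rewrite -rmorphM k'k rmorph1.
  have [] := cancel_mx (h *: (h *: v - u0 *m J')) (psi k' *: (h *: (B *m Ad))).
    have -> : h *: (h *: (h *: v - u0 *m J')) =
       psi k' *: ((psi k * (h * h)) *: (h *: v) - (psi k * (h * h)) *: (u0 *m J')).
      by rewrite -scalerBr [RHS]scalerA mulrA kk mul1r scalerA.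
    by rewrite E addrK scalerA mulrC -scalerA.
  by move=> C /cancel_mx.
(* The same coordinates with another minor as denominator. *)
have comp c : exists (U : 'rV_m) (C : 'rV_m), h *: U = psi (\det (colsub c J)) *: u0 + P *: C.
  pose Xc := map_mx psi (selmx R c).
  exists (v *m Xc *m \adj (J' *m Xc)), (B1 *m Xc *m \adj (J' *m Xc)).
  move/eqP: E1; rewrite subr_eq addrC => /eqP E1.
  rewrite !scalemxAl E1 !mulmxDl -!scalemxAl; congr (_ + _).
  by rewrite -(mulmxA u0) -(mulmxA u0) mul_mx_adj dJX mul_mx_scalar.
have /fin_all_exists[r] : forall i, exists r b, u0 0 i = h * r + P * b.
  move=> i; apply: har => c; have [U [C E]] := comp c.
  by exists (U 0 i), (C 0 i); have /rowP/(_ i) := E; rewrite !mxE.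
case/fin_all_exists => b rb; pose r' := \row_i r i.
have u0E : u0 = h *: r' + P *: \row_i b i.
  by apply/rowP => i; rewrite rb !mxE.
have [] := cancel_mx (v - r' *m J') (B1 + (\row_i b i) *m J').
  rewrite scalerBr scalerDr -E1 u0E mulmxDl -!scalemxAl.
  by rewrite opprD addrA subrK.
by move=> B' E; exists r', B'; rewrite -E addrC subrK.
Qed.

Section Kernel.
Variables (K : closedFieldType) (charK0 : [pchar K] =i pred0).
Variables (q : vectType K) (br : q -> q -> q) (brL : lie_bracket br).
Variables (m : nat) (m_ind : is_index br m) (F : m.-tuple (Sym q)).
Local Notation d := (\dim {:q}).
Variables (deg : 'I_m -> nat) (F_homog : forall i, tnth F i \is (deg i).-homog).
Hypothesis (F_inv : forall i, sym_inv br (tnth F i)).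
Hypothesis (Omega_big : big (wedge_neq0 F)) (codim2 : codim_property 2 br).
Local Notation Pi := (poisson_mx br).
Local Notation J := (jac F).
Local Notation minor := (jac_minor F).

(** Used for two maps psi: the restriction to a line, with P = 0, and the
    substitution of a curve, with P the modulus. *)
Lemma kernel_lie (S : comNzRingType) (psi : {rmorphism {mpoly K[d]} -> S}) (P : S) c0 :
  (forall a b, psi (minor c0) * a = P * b -> exists b', a = P * b') ->
  (forall a, (forall c, exists u b, psi (minor c0) * u = psi (minor c) * a + P * b) ->
     exists r b, a = psi (minor c0) * r + P * b) ->
  forall (v B : 'rV[S]_d), v *m map_mx psi Pi = P *: B ->
  exists (r : 'rV[S]_m) (B' : 'rV[S]_d), v = r *m map_mx psi J + P *: B'.
Proof.
have [kappa k0 kos] := kostant charK0 brL m_ind F_inv Omega_big codim2.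
have detD : border_det Pi (selmx _ c0) (selmx _ c0)^T = kappa%:MP * (minor c0 * minor c0).
  by have := kos (selmx K c0) (selmx K c0)^T;
    rewrite -map_trmx !map_selmx mul_selmx -trmx_mul det_tr mul_selmx.
have kk : (kappa^-1)%:MP * kappa%:MP = 1 :> {mpoly K[d]} by rewrite -mpolyCM mulVf.
exact: kernel_span (jac_poisson brL F_inv) kk detD.
Qed.

(** The line x + s y avoids the complement of Omega, also at infinity. *)
Definition generic_line (x y : 'I_d -> K) :=
  (forall s, ~ bad F (fun i => x i + s * y i)) /\ ~ bad F y.

Lemma generic_line_exists : exists x y, generic_line x y.
Proof.
have thinb := thin_bad Omega_big.
have [y yb] := thin_avoid charK0 thinb.
have [x [_ xb]] := good_line charK0 y thinb (@surj_id K d) (oner_neq0 _).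
exists x, y; split=> // s sb; apply: (xb s) => c; rewrite -[RHS](sb c).
by apply: meval_eq => i; rewrite !mevalXU.
Qed.

Section OnLine.
Variables (x y : 'I_d -> K) (xy : generic_line x y).
Local Notation psi := (line idfun x y).

Lemma line_kernel (v : 'rV[{poly K}]_d) : v *m map_mx psi Pi = 0 ->
  exists r : 'rV_m, v = r *m map_mx psi J.
Proof.
move=> vPi; have [gl _] := xy.
have [c0 M0] : exists c, psi (minor c) != 0.
  apply: NNPP => H; apply: (gl 0) => c; rewrite -line_horner.
  have [->|mc] := eqVneq (psi (minor c)) 0; first by rewrite horner0.
  by case: H; exists c.
have [] := @kernel_lie {poly K} psi 0 c0 _ _ v 0.
- move=> a b /eqP; rewrite mul0r mulf_eq0 (negPf M0) => /eqP ->.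
  by exists 0; rewrite mul0r.
- move=> a Ha; have /dvdpP[r aE] : psi (minor c0) %| a.
    apply: (dvdp_family (m := fun c => psi (minor c))) => // [c|s rs].
      have [u [b E]] := Ha c; rewrite mulrC.
      by move: E; rewrite mul0r addr0 => <-; rewrite dvdp_mulr.
    apply: (gl s) => c; rewrite -line_horner; exact/eqP/rs.
  by exists r, 0; rewrite mul0r addr0 mulrC.
- by rewrite scaler0.
- by move=> r [B']; rewrite scale0r addr0; exists r.
Qed.

Lemma nbad_inj v (r : 'rV[K]_m) : ~ bad F v -> r *m map_mx (meval v) J = 0 -> r = 0.
Proof.
move=> vb r0; apply: NNPP => rn0; apply: vb => c.
rewrite /jac_minor -mul_selmx -det_map_mx map_mxM; apply/eqP/det0P.
by exists r; [exact/eqP | rewrite mulmxA r0 mul0mx].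
Qed.

Lemma top_jac i j : top (deg i).-1 (psi (J i j)) (J i j).@[y].
Proof.
rewrite mxE; set f := _^`M(j); have hf : f \is (deg i).-1.-homog by exact: dhomog_mderiv.
rewrite -{2}(pihomog_dE hf); apply: top_line.
rewrite msizeE; apply/bigmax_leqP_seq => u uf _.
by have /dhomogP/(_ u uf) /= -> := hf.
Qed.

Lemma size_line_lin z : (size (psi (sym_lin z)) <= 2)%N.
Proof.
rewrite /sym_lin rmorph_sum (leq_trans (size_sum _ _ _)) //; apply/bigmax_leqP => i _.
rewrite /= -mul_mpolyC rmorphM /= lineC lineX /= mul_polyC.
rewrite (leq_trans (size_scale_leq _ _)) // (leq_trans (size_polyD _ _)) //.
rewrite geq_max size_polyC (leq_trans (leq_b1 _)) //= mul_polyC.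
by rewrite (leq_trans (size_scale_leq _ _)) // size_polyX.
Qed.

(** From a relation with coefficients c i e form the polynomials c_i(s) with
    coefficient c i e at s^(D - e), where D bounds all degrees. Then E = c_1
    dF_1 + ... + c_m dF_m has no term in s^D, so E = B + s^(D+1) A with deg B
    < D. As Pi is linear in s and E Pi = 0, a comparison of degrees gives B Pi
    = 0, and thus B = b_1 dF_1 + ... + b_m dF_m. Independence at y bounds the
    degree of b_i by D - deg F_i, independence at x gives b_i = c_i, and c_i
    only has terms of degree above D - deg F_i. *)
Lemma argument_shift_free (c : 'I_m -> nat -> K) :
  (forall j, \sum_i \sum_(e < deg i) c i e * (psi (J i j))`_e = 0) ->
  forall i e, (e < deg i)%N -> c i e = 0.
Proof.
move=> cJ; have [gl yb] := xy.
have [D degD] : exists D, forall i, (deg i <= D)%N.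
  by exists (\max_i deg i) => i; exact: leq_bigmax.
have deg0 := deg_gt0 charK0 F_homog Omega_big.
pose ct := \row_i \sum_(e < deg i) c i e *: 'X^(D - e) : 'rV[{poly K}]_m.
set J' := map_mx psi J; pose E := ct *m J'.
have ctcoef i e : (e < deg i)%N -> (ct 0 i)`_(D - e) = c i e.
  move=> ei; rewrite mxE coef_sum (bigD1 (Ordinal ei)) //= coefZ coefXn eqxx mulr1.
  rewrite big1 ?addr0 // => e'; rewrite -val_eqE /= => ee'.
  rewrite coefZ coefXn; case: eqP => [H|]; last by rewrite mulr0.
  have := degD i; have := ltn_ord e'; move/eqP: ee'; move: H ei; lia.
have sct i : (size (ct 0%R i) <= D.+1)%N.
  rewrite mxE (leq_trans (size_sum _ _ _)) //; apply/bigmax_leqP => e _.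
  by rewrite (leq_trans (size_scale_leq _ _)) // size_polyXn ltnS leq_subr.
have ED j : (E 0 j)`_D = 0.
  rewrite -[RHS](cJ j) mxE coef_sum; apply: eq_bigr => i _.
  rewrite mxE mulr_suml coef_sum; apply: eq_bigr => e _.
  rewrite -scalerAl coefZ coefXnM ltnNge leq_subr /= subKn ?[J' _ _]mxE //.
  by rewrite ltnW // (leq_trans (ltn_ord e)).
pose A := \row_j drop_poly D.+1 (E 0 j); pose B := \row_j take_poly D.+1 (E 0 j).
have EAB : E = B + 'X^(D.+1) *: A.
  by apply/rowP => j; rewrite !mxE -[LHS](poly_take_drop D.+1) mulrC.
have sB j : (size (B 0%R j) <= D)%N.
  apply/leq_sizeP => k; rewrite leq_eqVlt mxE coef_take_poly => /orP[/eqP<-|Dk].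
    by rewrite ltnSn ED.
  by rewrite ltnNge Dk.
have BPi : B *m map_mx psi Pi = 0.
  have E0 : E *m map_mx psi Pi = 0.
    by rewrite -mulmxA -map_mxM (jac_poisson brL F_inv) map_mx0 mulmx0.
  apply/rowP => j; rewrite [RHS]mxE; set g := LHS.
  have sg : (size g <= D.+1)%N.
    rewrite /g mxE (leq_trans (size_sum _ _ _)) //; apply/bigmax_leqP => k _.
    rewrite (leq_trans (size_polyMleq _ _)) //.
    have := sB k; have := size_line_lin (br (bvec k) (bvec j)).
    rewrite [map_mx _ _ _ _]mxE [poisson_mx _ _ _]mxE.
    move=> s1 s2; apply: leq_trans (_ : (D + 2).-1 <= _)%N; last by rewrite addn2.
    by rewrite -!subn1 leq_sub2r ?leq_add.
  have : g = - 'X^(D.+1) * (A *m map_mx psi Pi) 0 j.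
    apply/eqP; rewrite mulNr -addr_eq0; apply/eqP.
    have /rowP/(_ j) := E0; rewrite EAB mulmxDl -scalemxAl mxE [X in _ = X]mxE => H.
    by rewrite -[RHS]H; congr (_ + _); rewrite [RHS]mxE.
  set a := (_ *m _) 0 j => gE.
  have [a0|a0] := eqVneq a 0; first by rewrite gE a0 mulr0.
  move: sg; rewrite gE mulNr size_polyN mulrC size_mulXn //.
  by rewrite -[X in (_ <= X)%N]addn0 leq_add2l leqn0 size_poly_eq0 (negPf a0).
have [b BE] := line_kernel BPi.
(* Descending induction on delta: all higher coefficients vanish, so these
   are the coefficients of s^delta in a relation between the dF_i(y). *)
have btop delta : (D <= delta)%N -> forall i, (b 0 i)`_(delta.+1 - deg i) = 0.
  have [sz szP] : exists sz, forall i, (size (b 0%R i) <= sz)%N.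
    by exists (\max_i size (b 0%R i)) => i; exact: (leq_bigmax i).
  have [k] := ubnP (D + sz - delta)%N; elim: k delta => // k IHk delta dk Dd.
  have sbd i : top (delta.+1 - deg i) (b 0 i) (b 0 i)`_(delta.+1 - deg i).
    split=> //; apply/leq_sizeP => l lb; have dl := degD i.
    have -> : l = ((l + deg i).-1.+1 - deg i)%N by have := deg0 i; lia.
    have [sl|sl] := leqP (D + sz) (l + deg i).-1.
      rewrite nth_default // (leq_trans (szP i)) //.
      by move: sl lb; have := deg0 i; lia.
    by apply: IHk; move: dk Dd sl lb; have := deg0 i; lia.
  suff : \row_i (b 0 i)`_(delta.+1 - deg i) = 0.
    by move/rowP => H i; have := H i; rewrite !mxE.
  apply: nbad_inj yb _; apply/rowP => j; rewrite mxE [RHS]mxE.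
  have : top delta (B 0 j) (\sum_i (b 0 i)`_(delta.+1 - deg i) * (J i j).@[y]).
    rewrite BE mxE; elim/big_rec2: _ => [|i u w _ IH]; first exact: top0.
    apply: topD => //; have -> : delta = (delta.+1 - deg i + (deg i).-1)%N.
      by have := degD i; have := deg0 i; lia.
    rewrite [map_mx _ _ _ _]mxE; apply: topM; last exact: top_jac.
    by have -> : (delta.+1 - deg i + (deg i).-1)%N = delta;
      [have := degD i; have := deg0 i; lia | exact: sbd].
  case=> _; rewrite nth_default ?(leq_trans (sB _)) // => H.
  by rewrite [RHS]H; apply: eq_bigr => i _; rewrite !mxE.
have sb i : (size (b 0%R i) <= D.+1 - deg i)%N.
  apply/leq_sizeP => k kD; have -> : k = ((k + deg i).-1.+1 - deg i)%N.
    by have := deg0 i; lia.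
  by apply: btop; have := deg0 i; move: kD; lia.
have ctb i : ct 0 i = b 0 i.
  have x0 : x =1 (fun i => x i + 0 * y i) by move=> k; rewrite mul0r addr0.
  have [c1 M1] : exists c, (minor c).@[x] != 0.
    apply: NNPP => H; apply: (gl 0) => c2; apply: NNPP => /eqP Hc; apply: H.
    by exists c2; rewrite (meval_eq _ x0).
  have : (ct - b) *m J' = 'X^(D.+1) *: A.
    by rewrite mulmxBl -/E EAB -BE addrC addKr.
  pose X1 := map_mx psi (selmx {mpoly K[d]} c1).
  move/(congr1 (fun M => M *m X1 *m \adj (J' *m X1))).
  rewrite -!mulmxA [J' *m (X1 *m _)]mulmxA mul_mx_adj mul_mx_scalar -scalemxAl.
  rewrite -map_mxM mul_selmx det_map_mx -/(minor c1) => /rowP/(_ i).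
  rewrite mxE [RHS]mxE => E1.
  have dv : 'X^(D.+1) %| ct 0 i - b 0 i.
    have cop : coprimep ('X^(D.+1)) (psi (minor c1)).
      apply: coprimep_expl; rewrite coprimep_sym coprimepX /root line_horner.
      by rewrite -(meval_eq _ x0).
    rewrite -(Gauss_dvdpr _ cop); move: E1; rewrite mxE [(- b) _ _]mxE => ->.
    exact: dvdp_mulr.
  apply/eqP; rewrite -subr_eq0; apply: contraTT dv => nz.
  apply/negP => /dvdp_leq => /(_ nz); rewrite size_polyXn ltnNge.
  rewrite (leq_trans (size_polyD _ _)) // geq_max sct size_polyN.
  by rewrite (leq_trans (sb i)) ?leq_subr.
move=> i e ei; rewrite -(ctcoef i e ei) ctb nth_default // (leq_trans (sb i)) //.
by have := degD i; move: ei; lia.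
Qed.

End OnLine.
End Kernel.

(** * Generated subalgebras, independence, and linear forms on a current space *)

Section Gen.
Variables (K : fieldType) (N : nat).
Local Notation S := {mpoly K[N]}.

(** An inductive form of the subalgebra generated by A, equivalent to
    generated. *)
Inductive gen (A : S -> Prop) : S -> Prop :=
| gen_const c : gen A c%:MP
| gen_base H : A H -> gen A H
| gen_add H1 H2 : gen A H1 -> gen A H2 -> gen A (H1 + H2)
| gen_mul H1 H2 : gen A H1 -> gen A H2 -> gen A (H1 * H2).

Lemma gen_trans A B H : (forall x, A x -> gen B x) -> gen A H -> gen B H.
Proof.
move=> AB; elim=> [c|x /AB //|x y _ IHx _ IHy|x y _ IHx _ IHy].
- exact: gen_const.
- exact: gen_add.
- exact: gen_mul.
Qed.

Lemma gen_scale A c H : gen A H -> gen A (c *: H).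
Proof. by move=> AH; rewrite -mul_mpolyC; apply: gen_mul => //; apply: gen_const. Qed.

Lemma gen0 A : gen A 0.
Proof. by rewrite -mpolyC0; apply: gen_const. Qed.

Lemma gen_sum A (I : Type) (r : seq I) (P : pred I) (H : I -> S) :
  (forall i, P i -> gen A (H i)) -> gen A (\sum_(i <- r | P i) H i).
Proof.
by move=> AH; elim/big_ind: _ => //; [exact: gen0 | exact: gen_add].
Qed.

Lemma comp_gen A k (G : k.-tuple S) (P : {mpoly K[k]}) :
  (forall i, gen A (tnth G i)) -> gen A (P \mPo G).
Proof.
move=> AG; elim/mpoly_ring_ind: P => [c|i|P Q|P Q].
- by rewrite comp_mpolyC; apply: gen_const.
- by rewrite comp_mpolyXU -tnth_nth.
- by rewrite rmorphD; apply: gen_add.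
- by rewrite rmorphM; apply: gen_mul.
Qed.

Lemma gen_tuple k (G : k.-tuple S) H :
  gen (fun x => exists i, x = tnth G i) H <-> exists P : {mpoly K[k]}, H = P \mPo G.
Proof.
split=> [|[P ->]]; last by apply: comp_gen => i; apply: gen_base; exists i.
elim=> [c|_ [i ->]|H1 H2 _ [P1 ->] _ [P2 ->]|H1 H2 _ [P1 ->] _ [P2 ->]].
- by exists c%:MP; rewrite comp_mpolyC.
- by exists 'X_i; rewrite comp_mpolyXU -tnth_nth.
- by exists (P1 + P2); rewrite rmorphD.
- by exists (P1 * P2); rewrite rmorphM.
Qed.

(** Two polynomial expressions in different tuples can be rewritten over the
    concatenation of the tuples. *)
Lemma generatedE A H : generated A H <-> gen A H.
Proof.
split=> [[k [G [P [AG ->]]]]|].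
  by apply: comp_gen => i; apply: gen_base.
have merge k1 k2 (G1 : k1.-tuple S) (G2 : k2.-tuple S) (P1 : {mpoly K[k1]}) (P2 : {mpoly K[k2]}) :
    (forall i, A (tnth G1 i)) -> (forall i, A (tnth G2 i)) ->
    exists k (G : k.-tuple S) (Q1 Q2 : {mpoly K[k]}), [/\ forall i, A (tnth G i),
      Q1 \mPo G = P1 \mPo G1 & Q2 \mPo G = P2 \mPo G2].
  move=> AG1 AG2; exists (k1 + k2)%N, [tuple of G1 ++ G2].
  exists (P1 \mPo [tuple 'X_(lshift k2 i) | i < k1]), (P2 \mPo [tuple 'X_(rshift k1 i) | i < k2]).
  have L i : tnth [tuple of G1 ++ G2] (lshift k2 i) = tnth G1 i by rewrite tnth_lshift.
  have Rr i : tnth [tuple of G1 ++ G2] (rshift k1 i) = tnth G2 i by rewrite tnth_rshift.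
  split.
  - by move=> i; case: (split_ordP i) => j ->; rewrite ?L ?Rr.
  - apply: (mmap_rmorph (g := comp_mpoly _)) => [c|i] /=; first by rewrite comp_mpolyC.
    by rewrite tnth_mktuple comp_mpolyXU -tnth_nth L.
  - apply: (mmap_rmorph (g := comp_mpoly _)) => [c|i] /=; first by rewrite comp_mpolyC.
    by rewrite tnth_mktuple comp_mpolyXU -tnth_nth Rr.
elim=> [c|x Ax|H1 H2 _ [k1 [G1 [P1 [AG1 ->]]]] _ [k2 [G2 [P2 [AG2 ->]]]]
             |H1 H2 _ [k1 [G1 [P1 [AG1 ->]]]] _ [k2 [G2 [P2 [AG2 ->]]]]].
- by exists 0%N, [tuple], c%:MP; split; [case | rewrite comp_mpolyC].
- exists 1%N, [tuple x], 'X_0; split; last by rewrite comp_mpolyXU.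
  by move=> i; rewrite ord1.
- have [k [G [Q1 [Q2 [AG E1 E2]]]]] := merge _ _ _ _ P1 P2 AG1 AG2.
  by exists k, G, (Q1 + Q2); rewrite rmorphD /= E1 E2.
- have [k [G [Q1 [Q2 [AG E1 E2]]]]] := merge _ _ _ _ P1 P2 AG1 AG2.
  by exists k, G, (Q1 * Q2); rewrite rmorphM /= E1 E2.
Qed.

End Gen.

Section Independence.
Variables (K : fieldType) (charK0 : [pchar K] =i pred0) (N k : nat).
Variable (G : k.-tuple {mpoly K[N]}).

(** A relation of minimal degree between polynomials with independent
    differentials has vanishing partial derivatives, hence is constant. *)
Lemma jacobian_indep :
  (forall r : 'I_k -> {mpoly K[N]},
     (forall J, \sum_t r t * (tnth G t)^`M(J) = 0) -> forall t, r t = 0) ->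
  alg_indep G.
Proof.
move=> free P; have [b] := ubnP (msize P); elim: b P => // b IHb P sP PG.
have dP t : P^`M(t) = 0.
  have [->|P0] := eqVneq P 0; first by rewrite mderiv0.
  apply: IHb.
    apply: leq_ltn_trans (msize_mderiv P t) _; move: sP.
    by rewrite mpolySpred.
  move: t; apply: free => J.
  have der : derivation (mderiv J : {mpoly K[N]} -> _).
    by split; [exact: mderivD | exact: mderivM].
  have := mmap_chain (tnth G) der (f := @mpolyC N K) (@mderivC _ _ J) P.
  by rewrite -/(comp_mpoly _ P) PG mderiv0.
have PC := mderiv_const charK0 dP.
move: PG; rewrite PC comp_mpolyC => /eqP; rewrite mpolyC_eq0 => /eqP ->.
by rewrite mpolyC0.
Qed.

End Independence.

Section CurrentSpace.
Variables (K : fieldType) (q : vectType K) (n : nat).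
Local Notation d := (\dim {:q}).
Local Notation Wn := (W q n).
Local Notation N := (\dim {:Wn}).
Local Notation S := {mpoly K[N]}.
Local Notation co := (coord (vbasis {:q})).

(** The element x f(t) of W. *)
Definition tens (x : q) (f : {poly K}) : Wn := [ffun k : 'I_n => f`_k *: x].

Lemma tens_linl f : linear (tens^~ f).
Proof.
move=> a x y; apply/ffunP => k.
by rewrite !ffunE scalerDr !scalerA mulrC.
Qed.

Lemma tens_linr x : linear (tens x).
Proof.
move=> a f g; apply/ffunP => k.
by rewrite !ffunE coefD coefZ scalerDl scalerA.
Qed.

Lemma W_sum (w : Wn) : w = \sum_(jk : 'I_d * 'I_n) co jk.1 (w jk.2) *: tens (bvec jk.1) 'X^(jk.2).
Proof.
apply/ffunP => k; rewrite sum_ffunE.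
rewrite -(pair_bigA _ (fun j l => (co j (w l) *: tens (bvec j) 'X^l) k)) /=.
rewrite [LHS]bvec_sum; apply: eq_bigr => j _; rewrite (bigD1 k) //= !ffunE coefXn eqxx scale1r.
rewrite big1 ?addr0 // => l lk; rewrite !ffunE coefXn eq_sym val_eqE (negPf lk).
by rewrite scale0r scaler0.
Qed.

(** The linear coordinate x f(t) on W^*, as a linear function of f. *)
Definition lam (x : q) (f : {poly K}) : S := sym_lin (tens x f).

Lemma lam_is_linear x : linear (lam x).
Proof. by move=> a f g; rewrite /lam tens_linr linearP. Qed.

HB.instance Definition _ x := GRing.isLinear.Build K {poly K} S _ (lam x) (lam_is_linear x).

Lemma lam_linl f : linear (lam^~ f).
Proof. by move=> a x y; rewrite /lam tens_linl linearP. Qed.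

(** Matrices parametrise the linear forms on W: the entry (j, k) is the value
    on bvec j t^k. *)
Definition linform (a : 'M[K]_(d, n)) (w : Wn) : K :=
  \sum_(jk : 'I_d * 'I_n) a jk.1 jk.2 * co jk.1 (w jk.2).

Definition pt (a : 'M[K]_(d, n)) : 'I_N -> K := fun J => linform a (bvec J).

Lemma linform_sum a (I : Type) (r : seq I) (c : I -> K) (w : I -> Wn) :
  linform a (\sum_(i <- r) c i *: w i) = \sum_(i <- r) c i * linform a (w i).
Proof.
rewrite /linform; under [RHS]eq_bigr do rewrite mulr_sumr.
rewrite exchange_big /=; apply: eq_bigr => jk _.
rewrite sum_ffunE linear_sum mulr_sumr; apply: eq_bigr => i _.
by rewrite /= ffunE linearZ /= mulrCA.
Qed.

Lemma linform_tens a j f : linform a (tens (bvec j) f) = \sum_(k < n) a j k * f`_k.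
Proof.
rewrite /linform -(pair_bigA _ (fun i k => a i k * co i (tens (bvec j) f k))) /=.
rewrite (bigD1 j) //= [X in _ + X]big1 ?addr0 => [|i ij].
  by apply: eq_bigr => k _; rewrite ffunE linearZ /= coord_bvec eqxx mulr1.
by rewrite big1 // => k _; rewrite ffunE linearZ /= coord_bvec (negPf ij) !mulr0.
Qed.

Lemma sym_lin_pt a w : (sym_lin w : S).@[pt a] = linform a w.
Proof. by rewrite sym_lin_eval {2}[w]bvec_sum linform_sum. Qed.

(** The constant vector field in the direction of a linear form on W. *)
Definition dir (a : 'M[K]_(d, n)) (H : S) : S := \sum_J linform a (bvec J) *: H^`M(J).

Lemma dir_derivation a : derivation (dir a).
Proof.
split=> H1 H2; rewrite /dir.
  by rewrite -big_split; apply: eq_bigr => J _; rewrite mderivD scalerDr.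
rewrite mulr_suml mulr_sumr -big_split; apply: eq_bigr => J _ /=.
by rewrite mderivM scalerDr -scalerAl -scalerAr.
Qed.

Lemma dirC a c : dir a c%:MP = 0.
Proof. by rewrite /dir big1 // => J _; rewrite mderivC scaler0. Qed.

Lemma dir_sym_lin a w : dir a (sym_lin w) = (linform a w)%:MP.
Proof.
rewrite /dir {2}[w]bvec_sum linform_sum rmorph_sum; apply: eq_bigr => J _ /=.
by rewrite mderiv_sym_lin -mul_mpolyC -rmorphM mulrC.
Qed.

(** The derivative along the coordinate bvec j t^k. *)
Definition partial j k := dir (delta_mx j k).

Lemma linform_delta j k w : linform (delta_mx j k) w = co j (w k).
Proof.
rewrite /linform (bigD1 (j, k)) //= mxE !eqxx mul1r big1 ?addr0 // => -[i l] /= neq.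
by rewrite mxE; move: neq; rewrite xpair_eqE => /negPf ->; rewrite mul0r.
Qed.

Lemma partialE j k H : partial j k H = \sum_J co j ((bvec J : Wn) k) *: H^`M(J).
Proof. by apply: eq_bigr => J _; rewrite linform_delta. Qed.

Lemma partial_lam j k i f : partial j k (lam (bvec i) f) = ((j == i)%:R * f`_k)%:MP.
Proof. by rewrite /partial /lam dir_sym_lin linform_delta ffunE coordZ coord_bvec mulrC. Qed.

Lemma dir_partial a H : dir a H = \sum_(jk : 'I_d * 'I_n) a jk.1 jk.2 *: partial jk.1 jk.2 H.
Proof.
under [RHS]eq_bigr do rewrite partialE scaler_sumr.
rewrite exchange_big /=; apply: eq_bigr => J _.
by rewrite scaler_suml; apply: eq_bigr => jk _; rewrite scalerA.
Qed.

Lemma mderivE J H :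
  H^`M(J) = dir (\matrix_(j, k) coord (vbasis {:Wn}) J (tens (bvec j) 'X^k)) H.
Proof.
have E J' : linform (\matrix_(j, k) coord (vbasis {:Wn}) J (tens (bvec j) 'X^k)) (bvec J') = (J == J')%:R.
  rewrite -coord_bvec [in RHS](W_sum (bvec J')) coord_sumE.
  by apply: eq_bigr => jk _; rewrite mxE coordZ mulrC.
rewrite /dir (bigD1 J) //= E eqxx scale1r big1 ?addr0 // => J' JJ'.
by rewrite E eq_sym (negPf JJ') scale0r.
Qed.

Lemma poisson_partial (b : Wn -> Wn -> Wn) H w :
  (forall y, linear (b y)) -> (forall y, linear (b^~ y)) ->
  lie_poisson b H (sym_lin w) =
  \sum_(jk : 'I_d * 'I_n) partial jk.1 jk.2 H * sym_lin (b (tens (bvec jk.1) 'X^(jk.2)) w).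
Proof.
move=> br bl; rewrite lie_poisson_lin //.
pose h := GRing.isLinear.Build _ _ _ _ (b^~ w) (bl w).
pose f : {linear Wn -> Wn} := HB.pack (b^~ w) h.
under [RHS]eq_bigr do rewrite partialE mulr_suml.
rewrite exchange_big /=; apply: eq_bigr => J _.
rewrite -[b (bvec J) w]/(f _) [X in f X]W_sum !linear_sum mulr_sumr.
apply: eq_bigr => jk _; rewrite !linearZ /=.
by rewrite -scalerAl scalerAr.
Qed.

End CurrentSpace.

(** * Invariants of linear vector fields *)

Section Graded.
Variables (K : fieldType) (N : nat).
Local Notation S := {mpoly K[N]}.
Local Notation ph := (pihomog mdeg).

Lemma pihomog_mul e k (a b : S) : b \is k.-homog -> (k <= e)%N ->
  ph e (a * b) = ph (e - k) a * b.
Proof.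
move=> hb ke; rewrite -(subnK ke) addnK; move: (e - k)%N => {}e {ke}.
set M := maxn (msize a) e.+1.
have aE : a = \sum_(i < M) ph i a by apply: pihomog_partitionE; rewrite leq_maxl.
have eM : (e < M)%N by rewrite leq_max leqnn orbT.
rewrite {1}aE mulr_suml (linear_sum (ph (e + k)%N)) (bigD1 (Ordinal eM)) //=.
rewrite pihomog_dE ?big1 ?addr0 // => [i ik|].
  apply: (pihomog_ne0 (d := (i + k)%N)); last exact: dhomogM (pihomogP _ _ _) hb.
  by rewrite eqn_add2r.
by apply: dhomogM hb; apply: pihomogP.
Qed.

Lemma pihomog_mul0 e k (a b : S) : b \is k.-homog -> (e < k)%N -> ph e (a * b) = 0.
Proof.
move=> hb ek; have aE : a = \sum_(i < msize a) ph i a by apply: pihomog_partitionE.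
rewrite {1}aE mulr_suml (linear_sum (ph e)) big1 //= => i _.
apply: (pihomog_ne0 (d := (i + k)%N)); last exact: dhomogM (pihomogP _ _ _) hb.
by apply/eqP => E; move: ek; rewrite -E ltnNge leq_addl.
Qed.

Lemma pihomog_mderiv e (H : S) J : ph e H^`M(J) = (ph e.+1 H)^`M(J).
Proof.
apply/mpolyP => m; rewrite mcoeff_pihomog !mcoeff_mderiv mcoeff_pihomog.
by rewrite mdegD mdeg1 addn1 eqSS; case: ifP => //; rewrite mul0rn.
Qed.

Lemma euler e (H : S) : H \is e.-homog -> \sum_J 'X_J * H^`M(J) = e%:R *: H.
Proof.
move=> /dhomogP hH.
have mono (m : 'X_{1..N}) : \sum_J 'X_J * ('X_[m])^`M(J) = (mdeg m)%:R *: 'X_[m] :> S.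
  rewrite mdegE natr_sum scaler_suml; apply: eq_bigr => J _.
  rewrite mderivX -scalerAr -mpolyXD.
  have [->|mJ] := eqVneq (m J) 0%N; first by rewrite !scale0r.
  rewrite addmC submK //; apply/mnm_lepP => i; rewrite mnm1E.
  by case: eqP => // <-; rewrite lt0n.
rewrite [in RHS](mpolyE H) scaler_sumr.
under eq_bigr do rewrite {1}(mpolyE H) linear_sum mulr_sumr.
rewrite exchange_big /=; apply: eq_big_seq => m mH.
rewrite scalerA mulrC -scalerA -(hH m mH) /= -mono scaler_sumr.
by apply: eq_bigr => J _; rewrite mderivZ -scalerAr.
Qed.

End Graded.

Section Closure.
Variables (K : fieldType) (charK0 : [pchar K] =i pred0) (N : nat).
Local Notation S := {mpoly K[N]}.
Variables (I : Type) (u : I -> 'I_N -> S) (u_lin : forall i J, u i J \is 1.-homog).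
Variables (T : finType) (G : T -> S) (dg : T -> nat).
Hypotheses (dg_gt0 : forall t, (0 < dg t)%N) (G_homog : forall t, G t \is (dg t).-homog).

(** The derivation of S(W) with value u i J on the variable J, for linear u i
    J: a linear vector field. *)
Definition flow i (H : S) := \sum_J H^`M(J) * u i J.

Hypothesis G_inv : forall i t, flow i (G t) = 0.
Hypothesis G_free : forall r : T -> S,
  (forall J, \sum_t r t * (G t)^`M(J) = 0) -> forall t, r t = 0.
Hypothesis G_span : forall H, (forall i, flow i H = 0) ->
  exists r : T -> S, forall J, H^`M(J) = \sum_t r t * (G t)^`M(J).

Lemma flowM i a b : flow i (a * b) = flow i a * b + a * flow i b.
Proof.
rewrite /flow mulr_suml mulr_sumr -big_split; apply: eq_bigr => J _ /=.
by rewrite mderivM mulrDl mulrAC mulrA.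
Qed.

Lemma flow_sum i (X : finType) (H : X -> S) : flow i (\sum_x H x) = \sum_x flow i (H x).
Proof.
rewrite /flow exchange_big /=; apply: eq_bigr => J _.
by rewrite linear_sum mulr_suml.
Qed.

Lemma mderiv_flow i H J :
  (flow i H)^`M(J) = flow i H^`M(J) + \sum_L H^`M(L) * (u i L)^`M(J).
Proof.
rewrite /flow linear_sum -big_split; apply: eq_bigr => L _ /=.
by rewrite mderivM mderiv_comm.
Qed.

(** Apply the flow to the relation between differentials. The terms in which
    it acts on differentials cancel by invariance, and what remains is a
    relation with coefficients flow i (r t). *)
Lemma flow_coef H (r : T -> S) i : flow i H = 0 ->
  (forall J, H^`M(J) = \sum_t r t * (G t)^`M(J)) -> forall t, flow i (r t) = 0.
Proof.
move=> H0 Hr; apply: G_free => J.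
have inv X : flow i X = 0 -> flow i X^`M(J) = - \sum_L X^`M(L) * (u i L)^`M(J).
  by move=> X0; apply/eqP; rewrite -addr_eq0 -mderiv_flow X0 mderiv0.
have := inv H H0; rewrite (Hr J) flow_sum.
under eq_bigr do rewrite flowM (inv _ (G_inv i _)).
rewrite big_split /=; set B := (X in _ + X); set C := - _; have -> : B = C.
  rewrite /B /C; under eq_bigr do rewrite mulrN mulr_sumr.
  rewrite sumrN; congr (- _); rewrite exchange_big /=.
  by apply: eq_bigr => L _; rewrite (Hr L) mulr_suml; apply: eq_bigr => t _; rewrite mulrA.
by move/eqP; rewrite -subr_eq0 addrK => /eqP.
Qed.

Lemma flow_pihomog e H : (forall i, flow i H = 0) -> forall i, flow i (pihomog mdeg e H) = 0.
Proof.
move=> H0 i; case: e => [|e].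
  rewrite /flow big1 // => J _.
  have -> : pihomog mdeg 0 H = ((pihomog mdeg 0 H)@_0)%:MP.
    apply: msize1_polyC; rewrite msizeE; apply/bigmax_leqP_seq => m mH _.
    by have /dhomogP/(_ m mH) /= -> := pihomogP mdeg 0 H.
  by rewrite mderivC mul0r.
have := congr1 (pihomog mdeg e.+1) (H0 i); rewrite linear0 /flow linear_sum => E.
rewrite -[RHS]E; apply: eq_bigr => J _ /=.
by rewrite (pihomog_mul _ (u_lin i J)) // subSS subn0 pihomog_mderiv.
Qed.

(** Euler's formula recovers H from its differential, so H is a combination of
    the G t with invariant coefficients of smaller degree. *)
Lemma invariants_gen_homog e H : H \is e.-homog -> (forall i, flow i H = 0) ->
  gen (fun x => exists t, x = G t) H.
Proof.
elim/ltn_ind: e H => -[|e] IHe H hH H0.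
  suff -> : H = (H@_0)%:MP by apply: gen_const.
  apply: msize1_polyC; rewrite msizeE; apply/bigmax_leqP_seq => m mH _.
  by have /dhomogP/(_ m mH) /= -> := hH.
have [r Hr] := G_span H0.
(* Only the components of the coefficients of the right degree matter. *)
pose r' t := if (dg t <= e.+1)%N then pihomog mdeg (e.+1 - dg t) (r t) else 0.
have Hr' J : H^`M(J) = \sum_t r' t * (G t)^`M(J).
  rewrite -(pihomog_dE (dhomog_mderiv J hH)) Hr linear_sum; apply: eq_bigr => t _ /=.
  have hG := dhomog_mderiv J (G_homog t); rewrite /r'; case: leqP => le.
    rewrite (pihomog_mul _ hG) ?leq_sub2r //=; last by rewrite -subn1 leq_subLR add1n.
    by congr (pihomog _ _ _ * _); have := dg_gt0 t; move: le; lia.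
  rewrite (pihomog_mul0 _ hG) ?mul0r //=.
  by have := dg_gt0 t; move: le; lia.
have r'0 i t : flow i (r' t) = 0 by exact: flow_coef (H0 i) Hr' t.
have gr t : gen (fun x => exists t, x = G t) (r' t).
  rewrite /r'; case: ifP => le; last exact: gen0.
  apply: (IHe (e.+1 - dg t)%N) => [||i]; last by have := r'0 i t; rewrite /r' le.
    by have := dg_gt0 t; lia.
  exact: pihomogP.
have e0 : (e.+1)%:R != 0 :> K by rewrite (natK_eq0 charK0).
have -> : H = (e.+1)%:R^-1 *: \sum_t r' t * ((dg t)%:R *: G t).
  apply: (scalerI e0); rewrite scalerA mulfV // scale1r -(euler hH).
  under eq_bigr do rewrite Hr' mulr_sumr.
  rewrite exchange_big /=; apply: eq_bigr => t _.
  rewrite -(euler (G_homog t)) mulr_sumr; apply: eq_bigr => J _.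
  by rewrite mulrCA.
apply: gen_scale; apply: gen_sum => t _; apply: gen_mul => //.
by apply: gen_scale; apply: gen_base; exists t.
Qed.

Lemma invariants_gen H : (forall i, flow i H = 0) ->
  gen (fun x => exists t, x = G t) H.
Proof.
move=> H0; rewrite (pihomog_partitionE (mf := mdeg) (leqnn (msize H))).
apply: gen_sum => e _; apply: invariants_gen_homog (pihomogP _ _ _) _.
exact: flow_pihomog.
Qed.

End Closure.

(** * Bezoutians and quotient current brackets *)

Lemma modp_sumE (K : fieldType) (p : {poly K}) (I : Type) (r : seq I) (F : I -> {poly K}) :
  (\sum_(i <- r) F i) %% p = \sum_(i <- r) (F i %% p).
Proof. exact: (big_morph (fun a => a %% p) (modpD p) (mod0p p)). Qed.

Section Bezout.
Variable K : fieldType.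
Implicit Types (p f : {poly K}).

(** The polynomial (p(s) - p(t)) / (s - t), with coefficients in K[t] for the
    powers of s: these are the Horner polynomials of p. *)
Definition bezoutian p : {poly {poly K}} := \poly_(k < (size p).-1) drop_poly k.+1 p.

Lemma coef_bezoutian p k : (bezoutian p)`_k = drop_poly k.+1 p.
Proof.
rewrite coef_poly; case: ltnP => // pk; apply/esym/eqP.
by rewrite -size_poly_eq0 size_drop_poly subn_eq0; move: pk; case: (size p).
Qed.

Lemma bezoutian_mul p : ('X - ('X : {poly K})%:P) * bezoutian p = map_poly polyC p - p%:P.
Proof.
apply/polyP => k; rewrite mulrBl coefB coefXM coefCM !coef_bezoutian coefB coef_map coefC /=.
have dropE j : drop_poly j p = (p`_j)%:P + 'X * drop_poly j.+1 p.
  apply/polyP => i; rewrite coefD coefC coefXM !coef_drop_poly.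
  by case: i => [|i] /=; rewrite ?addr0 ?add0r // addnS.
case: k => [|k] /=.
  have := dropE 0%N; rewrite drop_poly0l => pE.
  by rewrite sub0r [X in _ - X]pE opprD addrA subrr add0r.
by rewrite subr0 dropE addrK.
Qed.

(** Both sides are (f(s) - f(t)) (p(s) - p(t)) / (s - t). *)
Lemma bezoutian_comm f p :
  (map_poly polyC f - f%:P) * bezoutian p = bezoutian f * (map_poly polyC p - p%:P).
Proof. by rewrite -!bezoutian_mul; ring. Qed.

Lemma bezoutian_is_linear : forall (a : K) p f,
  bezoutian (a *: p + f) = map_poly polyC a%:P * bezoutian p + bezoutian f.
Proof.
move=> a p f; apply/polyP => k.
rewrite map_polyC /= coefD coefCM !coef_bezoutian.
by apply/polyP => i; rewrite !coef_drop_poly !coefD coefZ coefCM !coef_drop_poly.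
Qed.

End Bezout.

Section Curve.
Variables (K : fieldType) (N : nat).
Local Notation S := {mpoly K[N]}.
Local Notation hat := (map_poly (@mpolyC N K)).

Lemma map_poly_mulK (mu : {linear {poly K} -> S}) (a : {poly K}) g :
  map_poly mu (map_poly polyC a * g) = hat a * map_poly mu g.
Proof.
apply/polyP => k; rewrite coef_map /= !coefM linear_sum; apply: eq_bigr => i _.
by rewrite /= !coef_map /= mul_polyC linearZ /= mul_mpolyC.
Qed.

Lemma eq_map_poly_coef (mu nu : {linear {poly K} -> S}) (g : {poly {poly K}}) :
  (forall k, mu g`_k = nu g`_k) -> map_poly mu g = map_poly nu g.
Proof. by move=> E; apply/polyP => k; rewrite !coef_map /= E. Qed.

Lemma rmodp_eqP (P : {poly S}) a b : P \is monic ->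
  (exists c, a = b + P * c) -> Pdiv.Ring.rmodp a P = Pdiv.Ring.rmodp b P.
Proof.
move=> mP [c ->]; rewrite Pdiv.RingMonic.rmodpD // mulrC.
by rewrite Pdiv.RingMonic.rmodp_mull // addr0.
Qed.

Lemma rmodp_eq0P (P : {poly S}) a : P \is monic ->
  Pdiv.Ring.rmodp a P = 0 <-> exists c, a = P * c.
Proof.
move=> mP; split=> [a0|[c ->]]; last by rewrite mulrC Pdiv.RingMonic.rmodp_mull.
by exists (Pdiv.Ring.rdivp a P); rewrite {1}(Pdiv.RingMonic.rdivp_eq mP a) a0 addr0 mulrC.
Qed.

(** Derivations that kill the coefficients of the modulus commute with the
    division algorithm. *)
Lemma rmodp_derivation (D : S -> S) (p : {poly K}) (g : {poly S}) :
  derivation D -> (forall c, D c%:MP = 0) -> p \is monic ->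
  Pdiv.Ring.rmodp (map_poly D g) (hat p) = map_poly D (Pdiv.Ring.rmodp g (hat p)).
Proof.
move=> [DD DM] DC mp.
have D0 : D 0 = 0 by rewrite -mpolyC0 DC.
have cD a i : (map_poly D a)`_i = D a`_i by rewrite coef_map_id0.
have mP : hat p \is monic by rewrite map_monic.
set P := hat p in mP *; have E := Pdiv.RingMonic.rdivp_eq mP g.
set Q := Pdiv.Ring.rdivp _ _ in E; set r := Pdiv.Ring.rmodp _ _ in E *.
have DE : map_poly D g = map_poly D Q * P + map_poly D r.
  apply/polyP => k; rewrite cD {1}E !coefD DD cD; congr (_ + _).
  rewrite !coefM; elim/big_rec2: _ => [|i u v _ <-]; first by rewrite D0.
  by rewrite DD DM [P`_ _]coef_map DC mulr0 addr0 cD.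
rewrite DE Pdiv.RingMonic.rmodp_addl_mul_small //.
apply: leq_ltn_trans (size_poly _ _) _.
exact: Pdiv.Ring.ltn_rmodpN0 (monic_neq0 mP).
Qed.

Lemma map_poly_derivation (D : S -> S) : derivation D -> derivation (map_poly D).
Proof.
move=> [DD DM].
have D0 : D 0 = 0 by apply: (addrI (D 0)); rewrite -DD !addr0.
have cD a i : (map_poly D a)`_i = D a`_i by rewrite coef_map_id0.
split=> a b; apply/polyP => k; rewrite cD !coefD ?cD ?DD //.
rewrite !coefM -big_split /=; elim/big_rec2: _ => [|i u v _ <-]; first by rewrite D0.
by rewrite DD DM !cD.
Qed.

End Curve.

Section Bracket.
Variables (K : fieldType) (q : vectType K) (br : q -> q -> q) (brL : lie_bracket br).
Variable (n : nat).
Local Notation d := (\dim {:q}).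
Local Notation Wn := (W q n).
Local Notation N := (\dim {:Wn}).
Local Notation S := {mpoly K[N]}.

Let brl y : linear (br^~ y) := lie_linl brL y.
Let brr x : linear (br x) := lie_linr brL x.

Lemma bracket_linl p w : linear ((bracket_mod br p)^~ w : Wn -> Wn).
Proof.
move=> a u v; apply/ffunP => k; rewrite !ffunE scaler_sumr -big_split.
apply: eq_bigr => i _ /=; rewrite scaler_sumr -big_split; apply: eq_bigr => j _ /=.
by rewrite !ffunE brl scalerDr !scalerA mulrC.
Qed.

Lemma bracket_linr p w : linear (bracket_mod br p w : Wn -> Wn).
Proof.
move=> a u v; apply/ffunP => k; rewrite !ffunE scaler_sumr -big_split.
apply: eq_bigr => i _ /=; rewrite scaler_sumr -big_split; apply: eq_bigr => j _ /=.
by rewrite !ffunE brr scalerDr !scalerA mulrC.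
Qed.

Lemma br0l y : br 0 y = 0.
Proof. by have := brl y (-1) 0 0; rewrite /= scaler0 addr0 scaleN1r addNr. Qed.
Lemma br0r x : br x 0 = 0.
Proof. by have := brr x (-1) 0 0; rewrite /= scaler0 addr0 scaleN1r addNr. Qed.
Lemma brZl a x y : br (a *: x) y = a *: br x y.
Proof. by have := brl y a x 0; rewrite /= !addr0 br0l addr0. Qed.
Lemma brZr a x y : br x (a *: y) = a *: br x y.
Proof. by have := brr x a y 0; rewrite /= !addr0 br0r addr0. Qed.

Lemma poly_cut (f : {poly K}) : (size f <= n)%N -> f = \sum_(i < n) f`_i *: 'X^i.
Proof.
move=> sf; rewrite -poly_def; apply/polyP => k; rewrite coef_poly.
by case: ltnP => // nk; rewrite nth_default // (leq_trans sf).
Qed.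

(** The bilinear extension of the defining bracket of monomials, which
    presents W as a quotient of the current algebra. *)
Lemma bracket_tens p x y (f g : {poly K}) : (size f <= n)%N -> (size g <= n)%N ->
  bracket_mod br p (tens n x f) (tens n y g) = tens n (br x y) ((f * g) %% p).
Proof.
move=> sf sg; apply/ffunP => k; rewrite !ffunE.
rewrite [in RHS](poly_cut sf) [in RHS](poly_cut sg) mulr_suml modp_sumE coef_sum scaler_suml.
apply: eq_bigr => i _; rewrite mulr_sumr modp_sumE coef_sum scaler_suml.
apply: eq_bigr => j _; rewrite !ffunE brZl brZr !scalerA.
by rewrite -scalerAl -scalerAr scalerA -exprD modpZl coefZ; congr (_ *: _); ring.
Qed.
End Bracket.

(** * Division by a product of linear factors *)

Section RootsMod.
Variables (S : idomainType) (I : Type) (h : {poly S}) (M : I -> {poly S}).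

Lemma cancel_roots (rs : seq S) : (forall z, z \in rs -> h.[z] != 0) ->
  forall a b, h * a = (\prod_(z <- rs) ('X - z%:P)) * b ->
  exists b', a = (\prod_(z <- rs) ('X - z%:P)) * b'.
Proof.
elim: rs => [|z rs IHrs] hz a b; first by exists a; rewrite big_nil mul1r.
rewrite big_cons => E; have : a.[z] = 0.
  have := congr1 (fun g => g.[z]) E; rewrite !hornerM hornerXsubC subrr !mul0r.
  by move/eqP; rewrite mulf_eq0 (negPf (hz z (mem_head _ _))) => /eqP.
move/eqP/factor_theorem => [a' aE].
have [||b' b'E] := IHrs _ a' b.
- by move=> y yrs; apply: hz; rewrite inE yrs orbT.
- apply: (mulIf (x := 'X - z%:P)); first by rewrite polyXsubC_eq0.
  by rewrite -mulrA -aE E; ring.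
- by exists b'; rewrite aE b'E; ring.
Qed.

(** The Hartogs property holds modulo each linear factor by evaluation at its
    root, and lifts to the product one factor at a time. *)
Lemma hartogs_roots (rs : seq S) : (forall z, z \in rs -> h.[z] != 0) ->
  (forall z, z \in rs -> forall a : S,
     (forall c, exists u, h.[z] * u = (M c).[z] * a) -> exists r, a = h.[z] * r) ->
  forall a, (forall c, exists u b, h * u = M c * a + (\prod_(z <- rs) ('X - z%:P)) * b) ->
  exists r b, a = h * r + (\prod_(z <- rs) ('X - z%:P)) * b.
Proof.
elim: rs => [|z rs IHrs] hz har a Ha.
  by exists 0, a; rewrite big_nil mulr0 add0r mul1r.
have hz0 := hz z (mem_head _ _).
have [|r0 r0E] := har z (mem_head _ _) a.[z].
  move=> c; have [u [b E]] := Ha c; exists u.[z].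
  have := congr1 (fun g => g.[z]) E.
  by rewrite hornerD !hornerM big_cons hornerM hornerXsubC subrr !mul0r addr0.
have : (a - h * r0%:P).[z] = 0 by rewrite !hornerE r0E subrr.
move/eqP/factor_theorem => [a' aE].
have X0 : 'X - z%:P != 0 by rewrite polyXsubC_eq0.
have [||c|r' [b' rE]] := IHrs _ _ a'.
- by move=> y yrs; apply: hz; rewrite inE yrs orbT.
- by move=> y yrs; apply: har; rewrite inE yrs orbT.
- have [u [b E]] := Ha c; rewrite big_cons in E.
  have E2 : h * (u - M c * r0%:P) = (M c * a' + (\prod_(y <- rs) ('X - y%:P)) * b) * ('X - z%:P).
    transitivity (M c * (a' * ('X - z%:P)) + ('X - z%:P) * (\prod_(y <- rs) ('X - y%:P)) * b).
      by rewrite -aE mulrBr E; ring.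
    by ring.
  have : (u - M c * r0%:P).[z] = 0.
    have := congr1 (fun g => g.[z]) E2; rewrite !hornerM hornerXsubC subrr mulr0.
    by move/eqP; rewrite mulf_eq0 (negPf hz0) => /eqP.
  move/eqP/factor_theorem => [u' uE]; exists u', b; apply: (mulIf X0).
  by rewrite -E2 uE mulrA.
exists (r0%:P + ('X - z%:P) * r'), b'; rewrite big_cons.
have -> : a = h * r0%:P + a' * ('X - z%:P) by rewrite -aE addrC subrK.
by rewrite rE; ring.
Qed.

End RootsMod.

Section HomPoly.
Variables (K : fieldType) (N : nat).
Local Notation S := {mpoly K[N]}.

Definition hom_poly d (g : {poly S}) := forall k, g`_k \is d.-homog.

Lemma hom_polyC c : hom_poly 0 (c%:MP)%:P.
Proof.
move=> k; rewrite coefC; case: ifP => _; last exact: dhomog0.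
by apply/dhomogP => m; rewrite msuppC; case: ifP => // _; rewrite inE => /eqP -> /=; rewrite mdeg0.
Qed.

Lemma hom_polyM d e a b : hom_poly d a -> hom_poly e b -> hom_poly (d + e) (a * b).
Proof.
by move=> ha hb k; rewrite coefM; apply: rpred_sum => i _; apply: dhomogM.
Qed.

Lemma hom_polyX d a k : hom_poly d a -> hom_poly (d * k) (a ^+ k).
Proof.
move=> ha; elim: k => [|k IHk]; first by rewrite muln0 expr0; exact: hom_polyC.
by rewrite mulnS exprS; apply: hom_polyM.
Qed.

Lemma hom_poly_prod (I : Type) (r : seq I) (d : I -> nat) a :
  (forall i, hom_poly (d i) (a i)) ->
  hom_poly (\sum_(i <- r) d i) (\prod_(i <- r) a i).
Proof.
move=> ha; elim: r => [|i r IHr]; first by rewrite !big_nil; exact: hom_polyC.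
by rewrite !big_cons; apply: hom_polyM.
Qed.

Lemma hom_poly_mmap n (h : 'I_n -> {poly S}) d (F : {mpoly K[n]}) :
  (forall j, hom_poly 1 (h j)) -> F \is d.-homog ->
  hom_poly d (mmap (polyC \o @mpolyC N K) h F).
Proof.
move=> hh /dhomogP hF k; rewrite /mmap coef_sum big_seq; apply: rpred_sum => m mF.
have := hF m mF => /= <-; rewrite -[mdeg m]add0n; move: k.
apply: hom_polyM; first exact: hom_polyC.
rewrite mdegE; apply: hom_poly_prod => j; rewrite -{1}[m j]mul1n.
exact: hom_polyX.
Qed.

Lemma size_hat (p : {poly K}) : size (map_poly (@mpolyC N K) p) = size p.
Proof. by rewrite size_map_inj_poly ?mpolyC0 //; exact: can_inj (@mpolyCK _ _). Qed.

(** The remainder is computed by reducing the powers of s over K. *)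
Lemma rmodp_coef (p : {poly K}) (g : {poly S}) e : p \is monic ->
  (Pdiv.Ring.rmodp g (map_poly (@mpolyC N K) p))`_e =
  \sum_(k < size g) ('X^k %% p)`_e *: g`_k.
Proof.
move=> mp; have mP : map_poly (@mpolyC N K) p \is monic by rewrite map_monic.
have X k : Pdiv.Ring.rmodp 'X^k (map_poly (@mpolyC N K) p) =
           map_poly (@mpolyC N K) ('X^k %% p).
  have -> : 'X^k = map_poly (@mpolyC N K) ('X^k %/ p) * map_poly (@mpolyC N K) p +
                   map_poly (@mpolyC N K) ('X^k %% p).
    by rewrite -rmorphM -rmorphD /= -divp_eq map_polyXn.
  rewrite Pdiv.RingMonic.rmodp_addl_mul_small //.
  by rewrite !size_hat ltn_modp monic_neq0.
rewrite -{1}[g]coefK poly_def Pdiv.RingMonic.rmodp_sum // coef_sum.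
apply: eq_bigr => k _; rewrite Pdiv.RingMonic.rmodpZ // coefZ X coef_map /=.
by rewrite mulrC mul_mpolyC.
Qed.

End HomPoly.

(** * The Poisson centre of a quotient current algebra *)

Section Lamp.
Variables (K : fieldType) (q : vectType K) (n : nat).
Local Notation d := (\dim {:q}).
Local Notation Wn := (W q n).
Local Notation N := (\dim {:Wn}).
Local Notation S := {mpoly K[N]}.
Local Notation hat := (map_poly (@mpolyC N K)).

Definition lam_mod (p : {poly K}) (x : q) (f : {poly K}) : S := lam n x (f %% p).

Lemma lam_mod_is_linear p x : linear (lam_mod p x).
Proof. by move=> a f g; rewrite /lam_mod modpD modpZl linearP. Qed.

HB.instance Definition _ p x :=
  GRing.isLinear.Build K {poly K} S _ (lam_mod p x) (lam_mod_is_linear p x).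

(** Substitution of the curve s -> g(s, t) of elements of K[t] into a
    polynomial function on q^*. *)
Definition theta (g : {poly {poly K}}) : {mpoly K[d]} -> {poly S} :=
  mmap (polyC \o @mpolyC N K) (fun j => map_poly (lam n (bvec j)) g).

HB.instance Definition _ g := GRing.RMorphism.copy (theta g)
  (mmap (polyC \o @mpolyC N K) (fun j => map_poly (lam n (bvec j)) g)).

Lemma thetaC g c : theta g c%:MP = (c%:MP)%:P.
Proof. by rewrite /theta mmapC. Qed.

Lemma thetaX g i : theta g 'X_i = map_poly (lam n (bvec i)) g.
Proof. by rewrite /theta mmapXU. Qed.

Lemma lam_sum (x : q) f : lam n x f = \sum_j coord (vbasis {:q}) j x *: lam n (bvec j) f.
Proof.
pose h := GRing.isLinear.Build _ _ _ _ (fun x : q => lam n x f) (@lam_linl K q n f).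
pose l : {linear q -> S} := HB.pack (fun x : q => lam n x f) h.
rewrite -[lam n x f]/(l x) [X in l X]bvec_sum linear_sum.
by apply: eq_bigr => j _; rewrite linearZ.
Qed.

Lemma theta_lin g x : theta g (sym_lin x) = map_poly (lam n x) g.
Proof.
rewrite /sym_lin rmorph_sum; apply/polyP => k; rewrite coef_sum coef_map /= lam_sum.
apply: eq_bigr => j _; rewrite -mul_mpolyC rmorphM /= thetaC thetaX coefCM coef_map /=.
by rewrite mul_mpolyC.
Qed.

Lemma theta_hom g d' F : F \is d'.-homog -> hom_poly d' (theta g F).
Proof.
apply: hom_poly_mmap => j k; rewrite coef_map /= /lam /sym_lin.
apply: rpred_sum => J _; apply: dhomogZ; rewrite dhomogX /=.
by rewrite mdeg1.
Qed.

Lemma cur_horner (x : q) (g : {poly {poly K}}) (z : K) :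
  (map_poly (lam n x) g).[z%:MP] = lam n x (g.[z%:P]).
Proof.
have sg : (size (map_poly (lam n x) g) <= size g)%N by exact: size_poly.
rewrite (horner_coef_wide _ sg) horner_coef linear_sum; apply: eq_bigr => k _.
rewrite coef_map /= -!rmorphXn /= [g`_k * _]mulrC mul_polyC linearZ /=.
by rewrite mulrC mul_mpolyC.
Qed.

Lemma theta_horner (g : {poly {poly K}}) (z : K) F :
  (theta g F).[z%:MP] = F \mPo [tuple lam n (bvec j) (g.[z%:P]) | j < d].
Proof.
rewrite -horner_evalE; apply: mmap_rmorph => [c|j] /=.
  by rewrite horner_evalE hornerC.
by rewrite horner_evalE cur_horner tnth_mktuple.
Qed.

Lemma lam_surj (f : {poly K}) k : (k < n)%N -> f`_k != 0 -> forall v : 'I_d -> K,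
  exists x, forall j, (lam n (bvec j) f).@[x] = v j.
Proof.
move=> kn fk v; pose a := (\matrix_(j, l) ((l == Ordinal kn)%:R * (v j / f`_k))) : 'M[K]_(d, n).
exists (pt a) => j; rewrite /lam sym_lin_pt linform_tens (bigD1 (Ordinal kn)) //= mxE eqxx mul1r.
rewrite divfK // big1 ?addr0 // => l /negPf lk; by rewrite mxE lk !mul0r.
Qed.

Lemma lam_lin_pt (x : q) f (y z : 'I_N -> K) s :
  (lam n x f).@[fun J => y J + s * z J] = (lam n x f).@[y] + s * (lam n x f).@[z].
Proof.
rewrite /lam !sym_lin_eval mulr_sumr -big_split; apply: eq_bigr => J _ /=.
by rewrite mulrDr mulrCA.
Qed.

End Lamp.

Section Centre.
Variables (K : closedFieldType) (charK0 : [pchar K] =i pred0).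
Variables (q : vectType K) (br : q -> q -> q) (brL : lie_bracket br).
Variables (m : nat) (m_ind : is_index br m) (F : m.-tuple (Sym q)).
Local Notation d := (\dim {:q}).
Variables (deg : 'I_m -> nat) (F_homog : forall i, tnth F i \is (deg i).-homog).
Hypothesis (F_inv : forall i, sym_inv br (tnth F i)).
Hypothesis (Omega_big : big (wedge_neq0 F)) (codim2 : codim_property 2 br).
Variables (n : nat) (n_gt0 : (0 < n)%N).
Variables (p : {poly K}) (p_monic : p \is monic) (p_size : size p = n.+1).
Local Notation Pi := (poisson_mx br).
Local Notation J := (jac F).
Local Notation minor := (jac_minor F).
Local Notation Wn := (W q n).
Local Notation N := (\dim {:Wn}).
Local Notation S := {mpoly K[N]}.
Local Notation hat := (map_poly (@mpolyC N K)).
Local Notation lamn := (@lam K q n).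
Local Notation lamq := (@lam_mod K q n p).
Local Notation B := (bezoutian p).
Local Notation th := (@theta K q n B).
Local Notation pb := (lie_poisson (bracket_mod br p)).
Local Notation red := (fun g : {poly S} => Pdiv.Ring.rmodp g (hat p)).

Let P_monic : hat p \is monic. Proof. by rewrite map_monic. Qed.

Lemma size_bezoutian_coef k : (size ((bezoutian p)`_k)%R <= n)%N.
Proof. by rewrite coef_bezoutian size_drop_poly p_size subSS leq_subr. Qed.

Lemma lam_mod_bezoutian x : map_poly (lamq x) B = map_poly (lamn x) B.
Proof.
apply: eq_map_poly_coef => k; rewrite /= /lam_mod modp_small //.
by rewrite p_size ltnS size_bezoutian_coef.
Qed.

(** Modulo p(t), multiplication by f(t) acts on the Bezoutian as
    multiplication by f(s) up to multiples of p(s). *)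
Lemma lam_mod_eigen x f : map_poly (lamq x) (f%:P * B) =
  hat f * map_poly (lamn x) B - hat p * map_poly (lamq x) (bezoutian f).
Proof.
have -> : f%:P * B = map_poly polyC f * B - map_poly polyC p * bezoutian f + p%:P * bezoutian f.
  have := bezoutian_comm f p; rewrite mulrBl mulrBr => E.
  by rewrite -[LHS](subKr (map_poly polyC f * B)) E; ring.
rewrite raddfD raddfB /= !map_poly_mulK lam_mod_bezoutian.
have -> : map_poly (lamq x) (p%:P * bezoutian f) = 0.
  apply/polyP => k; rewrite coef_map coefCM coef0 /= /lam_mod.
  by rewrite mulrC modp_mull linear0.
by rewrite addr0.
Qed.

Lemma pb_lam (H : S) x (f : {poly K}) : (size f <= n)%N -> pb H (lamn x f) =
  \sum_(jk : 'I_d * 'I_n) partial jk.1 jk.2 H * lamq (br (bvec jk.1) x) ('X^(jk.2) * f).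
Proof.
move=> sf; rewrite /lam poisson_partial; first last.
- by move=> y; apply: bracket_linl.
- by move=> y; apply: bracket_linr.
apply: eq_bigr => jk _; rewrite (bracket_tens brL) // size_polyXn.
exact: ltn_ord.
Qed.

Lemma pb_linr (H : S) (w : Wn) : pb H (sym_lin w) =
  \sum_(jk : 'I_d * 'I_n) coord (vbasis {:q}) jk.1 (w jk.2) *: pb H (lamn (bvec jk.1) 'X^(jk.2)).
Proof.
have plin H' x := lie_poisson_lin (V := Wn) H' x (bracket_linr brL p).
rewrite plin; under [RHS]eq_bigr do rewrite /lam plin.
under [RHS]eq_bigr do rewrite scaler_sumr.
rewrite exchange_big /=; apply: eq_bigr => L _.
pose h := GRing.isLinear.Build _ _ _ _ (bracket_mod br p (bvec L)) (bracket_linr brL p (bvec L)).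
pose l : {linear Wn -> Wn} := HB.pack (bracket_mod br p (bvec L)) h.
rewrite -[bracket_mod br p (bvec L) w]/(l w) [X in l X]W_sum linear_sum sym_lin_sum mulr_sumr.
by apply: eq_bigr => jk _; rewrite linearZ sym_linZ scalerAr.
Qed.

Lemma Zcentre_lam (H : S) : (forall jk : 'I_d * 'I_n, pb H (lamn (bvec jk.1) 'X^(jk.2)) = 0) ->
  Zcentre br p H.
Proof.
move=> H0; apply/poisson_centreE => [y|w]; first exact: bracket_linr.
by rewrite pb_linr big1 // => jk _; rewrite H0 scaler0.
Qed.

(** The differential of H, read as a polynomial in s with values in q by
    sending t^k to s^k. *)
Definition grad (H : S) : 'rV[{poly S}]_d :=
  \row_j \poly_(k < n) (if insub k is Some k' then partial j (k' : 'I_n) H else 0).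

Lemma coef_grad H j (k : 'I_n) : (grad H 0 j)`_k = partial j k H.
Proof. by rewrite mxE coef_poly ltn_ord valK. Qed.

Lemma size_grad H j : (size (grad H 0%R j) <= n)%N.
Proof. by rewrite mxE size_poly. Qed.

Lemma gradE H j : grad H 0 j = \sum_(k < n) (partial j k H)%:P * 'X^k.
Proof.
rewrite -[LHS]coefK -/(\poly_(i < size _) _) poly_def; set a := grad H 0 j.
transitivity (\poly_(i < n) a`_i).
  by rewrite -poly_def; apply/polyP => k; rewrite coefK coef_poly;
    case: ltnP => // nk; rewrite nth_default // (leq_trans (size_grad H j)).
rewrite poly_def; apply: eq_bigr => k _.
by rewrite coef_grad mul_polyC.
Qed.

(** The coefficients of the Bezoutian span the polynomials in t of degree
    below n. Bracketing H with them and using that f(t) acts as f(s) turns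
    centrality into this single congruence. *)
Lemma grad_kernel (H : S) : Zcentre br p H ->
  exists C, grad H *m map_mx th Pi = hat p *: C.
Proof.
move=> HZ.
exists (\row_i \sum_j \sum_(k < n) (partial j k H)%:P *
     map_poly (lamq (br (bvec j) (bvec i))) (bezoutian 'X^k)).
apply/rowP => i; rewrite mxE [RHS]mxE [X in _ * X]mxE mulr_sumr.
have Z0 : \sum_j \sum_(k < n) (partial j k H)%:P *
     map_poly (lamq (br (bvec j) (bvec i))) (('X^k)%:P * B) = 0.
  apply/polyP => e; rewrite coef0 coef_sum.
  have := HZ (lamn (bvec i) B`_e); rewrite pb_lam ?size_bezoutian_coef // => E.
  rewrite -[RHS]E.
  rewrite -(pair_bigA _ (fun j k => partial j k H * lamq (br (bvec j) (bvec i)) ('X^k * B`_e))) /=.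
  apply: eq_bigr => j _; rewrite coef_sum; apply: eq_bigr => k _.
  by rewrite coefCM coef_map coefCM.
apply/eqP; rewrite -subr_eq0 -[X in _ == X]Z0 -sumrB; apply/eqP.
apply: eq_bigr => j _; rewrite gradE mulr_suml mulr_sumr -sumrB.
apply: eq_bigr => k _; rewrite lam_mod_eigen map_polyXn.
rewrite [map_mx _ _ _ _]mxE [Pi _ _]mxE theta_lin; ring.
Qed.

Lemma partialC j k c : partial j k (c%:MP : S) = 0.
Proof. exact: dirC. Qed.

Lemma partial0 j k : partial j k (0 : S) = 0.
Proof. by have := partialC j k 0; rewrite mpolyC0. Qed.

Lemma coef_map_partial j k (a : {poly S}) i : (map_poly (partial j k) a)`_i = partial j k a`_i.
Proof. exact: coef_map_id0 (partial0 j k). Qed.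

(** The derivative along bvec j t^k takes the coefficient of t^k in the
    Bezoutian, which by symmetry is its coefficient of s^k. *)
Lemma theta_partial j (k : 'I_n) G : map_poly (partial j k) (th G) =
  hat (drop_poly k.+1 p) * th G^`M(j).
Proof.
have der := map_poly_derivation (@dir_derivation K q n (delta_mx j k)).
have D0 c : map_poly (partial j k) ((polyC \o @mpolyC N K) c) = 0.
  rewrite /=; apply/polyP => i; rewrite coef0 coef_map_partial coefC.
  by case: ifP => _; rewrite ?partialC ?partial0.
rewrite /theta (mmap_chain _ der D0) (bigD1 j) //= big1 => [|i ij]; last first.
  have -> : map_poly (partial j k) (map_poly (lamn (bvec i)) B) = 0; last by rewrite mulr0.
  apply/polyP => e; rewrite coef0 coef_map_partial coef_map /=.
  by rewrite partial_lam eq_sym (negPf ij) mul0r mpolyC0.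
rewrite addr0 mulrC; congr (_ * _).
apply/polyP => e; rewrite coef_map_partial !coef_map /=.
rewrite partial_lam eqxx mul1r coef_bezoutian !coef_drop_poly; congr (_%:MP).
by congr (p`_ _); lia.
Qed.

(** The residue form of K[s]/(p), extended to S(W). *)
Definition residue (g : {poly S}) : S := (red g)`_n.-1.

Lemma residueD (a b : {poly S}) : residue (a + b) = residue a + residue b.
Proof. by rewrite /residue Pdiv.RingMonic.rmodpD // coefD. Qed.

Lemma residue0 : residue 0 = 0.
Proof. by rewrite /residue Pdiv.CommonRing.rmod0p coef0. Qed.

Lemma residue_sum (I : Type) (r : seq I) (a : I -> {poly S}) :
  residue (\sum_(i <- r) a i) = \sum_(i <- r) residue (a i).
Proof. exact: (big_morph residue residueD residue0). Qed.

Lemma residueZ c (a : {poly S}) : residue (c%:P * a) = c * residue a.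
Proof. by rewrite /residue mul_polyC Pdiv.RingMonic.rmodpZ // coefZ. Qed.

Lemma residue_cong (a c : {poly S}) : residue (a + hat p * c) = residue a.
Proof. by rewrite /residue (rmodp_eqP (b := a) P_monic) //; exists c. Qed.

Lemma residue_red (a b : {poly S}) : residue (a * red b) = residue (a * b).
Proof. by rewrite /residue Pdiv.RingMonic.rmodp_mulmr. Qed.

Lemma size_red (g : {poly S}) : (size (red g) <= n)%N.
Proof.
have := Pdiv.Ring.ltn_rmodpN0 g (monic_neq0 P_monic).
by rewrite size_hat p_size ltnS.
Qed.

Lemma red_small (g : {poly S}) : (size g <= n)%N -> red g = g.
Proof. by move=> sg; apply: Pdiv.CommonRing.rmodp_small; rewrite size_hat p_size ltnS. Qed.

(** The Horner polynomials of p and the powers of s are dual bases for the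
    residue form. *)
Lemma residue_dual (k : nat) (a : {poly S}) : (k < n)%N -> (size a <= n)%N ->
  residue (hat (drop_poly k.+1 p) * a) = a`_k.
Proof.
move=> kn sa; set h := drop_poly k.+1 p.
have pE : 'X^(k.+1) * hat h = hat p - hat (take_poly k.+1 p).
  have {1}<- : take_poly k.+1 p + h * 'X^(k.+1) = p by exact: poly_take_drop.
  by rewrite rmorphD rmorphM /= map_polyXn; ring.
have -> : hat h * a = hat h * take_poly k.+1 a - drop_poly k.+1 a * hat (take_poly k.+1 p)
                      + hat p * drop_poly k.+1 a.
  rewrite -{1}(poly_take_drop k.+1 a) mulrDr -!addrA; congr (_ + _).
  have -> : hat h * (drop_poly k.+1 a * 'X^(k.+1)) = drop_poly k.+1 a * ('X^(k.+1) * hat h) by ring.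
  by rewrite pE; ring.
rewrite residue_cong.
have t1 : top n.-1 (hat h * take_poly k.+1 a) (1 * a`_k).
  have -> : n.-1 = (n - k.+1 + k)%N by lia.
  apply: topM.
    split; first by rewrite size_hat size_drop_poly p_size; lia.
    rewrite coef_map /= coef_drop_poly subnK //.
    by move/monicP: p_monic; rewrite lead_coefE p_size /= => ->; rewrite mpolyC1.
  split; first exact: size_take_poly.
  by rewrite coef_take_poly ltnSn.
have s2 : (size (drop_poly k.+1 a * hat (take_poly k.+1 p))%R <= n.-1)%N.
  apply: leq_trans (size_polyMleq _ _) _; rewrite size_hat -!subn1 leq_sub2r //.
  apply: leq_trans (_ : (n - k.+1) + k.+1 <= _)%N; last by rewrite subnK.
  apply: leq_add; last exact: size_take_poly.
  by rewrite size_drop_poly leq_sub2r.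
have [st1 ct1] := t1; rewrite /residue red_small.
  by rewrite coefB ct1 mul1r [X in _ - X]nth_default // subr0.
apply: leq_trans (size_polyD _ _) _; rewrite size_polyN geq_max.
by rewrite (leq_trans st1) ?prednK // (leq_trans s2) // leq_pred.
Qed.

Definition centre_gen (ie : 'I_m * 'I_n) : S := (red (th (tnth F ie.1)))`_ie.2.

Lemma centre_gen_homog ie : centre_gen ie \is (deg ie.1).-homog.
Proof.
rewrite /centre_gen rmodp_coef //; apply: rpred_sum => k _; apply: dhomogZ.
exact: (@theta_hom K q n (bezoutian p) _ _ (F_homog ie.1) k).
Qed.

Lemma partial_centre_gen j (k : 'I_n) ie : partial j k (centre_gen ie) =
  (red (hat (drop_poly k.+1 p) * th (J ie.1 j)))`_ie.2.
Proof.
rewrite mxE -theta_partial (rmodp_derivation _ _ _ p_monic).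
- by rewrite coef_map_partial.
- exact: dir_derivation.
- exact: dirC.
Qed.

(** The derivatives of the generators are the remainders of Horner polynomials
    times theta J, so the bracket is the remainder of theta applied to J Pi =
    0. *)
Lemma centre_gen_central ie : Zcentre br p (centre_gen ie).
Proof.
apply: Zcentre_lam => -[l f] /=; rewrite pb_lam; last by rewrite size_polyXn ltn_ord.
have E : \sum_j th (J ie.1 j) * map_poly (lamn (br (bvec j) (bvec l))) B = 0.
  have := congr1 (fun M : 'M_(m, d) => M ie.1 l) (jac_poisson brL F_inv).
  rewrite /= mxE [RHS]mxE => /(congr1 th); rewrite rmorph_sum rmorph0 => E.
  rewrite -[RHS]E; apply: eq_bigr => j _.
  by rewrite rmorphM /= [Pi _ _]mxE theta_lin.
transitivity ((red (\sum_j th (J ie.1 j) *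
    map_poly (lamq (br (bvec j) (bvec l))) (('X^f)%:P * B)))`_ie.2).
  rewrite -(pair_bigA _ (fun j k => partial j k (centre_gen ie) *
    lamq (br (bvec j) (bvec l)) ('X^k * 'X^f))) /=.
  rewrite Pdiv.RingMonic.rmodp_sum // coef_sum; apply: eq_bigr => j _.
  set x := br _ _; set g := th _.
  have -> : map_poly (lamq x) (('X^f)%:P * B) =
      \sum_(k < n) (lamq x ('X^k * 'X^f))%:P * hat (drop_poly k.+1 p).
    apply/polyP => e; rewrite coef_map coefCM coef_sum /=.
    rewrite {1}(poly_cut (size_bezoutian_coef e)) mulr_sumr linear_sum; apply: eq_bigr => k _.
    rewrite coefCM coef_map /= -scalerAr linearZ /= [RHS]mulrC mul_mpolyC ['X^f * _]mulrC.
    by rewrite coef_bezoutian !coef_drop_poly; congr (p`_ _ *: _); lia.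
  rewrite mulr_sumr Pdiv.RingMonic.rmodp_sum // coef_sum; apply: eq_bigr => k _.
  rewrite mulrCA mul_polyC Pdiv.RingMonic.rmodpZ // coefZ partial_centre_gen mulrC.
  by rewrite [g * _]mulrC.
have -> : \sum_j th (J ie.1 j) * map_poly (lamq (br (bvec j) (bvec l))) (('X^f)%:P * B) =
  0 + hat p * - \sum_j th (J ie.1 j) * map_poly (lamq (br (bvec j) (bvec l))) (bezoutian 'X^f).
  under eq_bigr do rewrite lam_mod_eigen mulrBr mulrCA [X in _ - X]mulrCA.
  by rewrite sumrB -!mulr_sumr E mulr0 !sub0r add0r mulrN.
by rewrite (rmodp_eqP (b := 0) P_monic) ?Pdiv.CommonRing.rmod0p ?coef0 //; eexists.
Qed.

Lemma hat_roots : exists rs : seq S, hat p = \prod_(z <- rs) ('X - z%:P) /\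
  forall z, z \in rs -> exists z0 : K, z = z0%:MP.
Proof.
have [rs pE] := closed_field_poly_normal p.
exists (map (@mpolyC N K) rs); split; last by move=> _ /mapP[z _ ->]; exists z.
rewrite [in LHS]pE (monicP p_monic) scale1r rmorph_prod big_map.
by apply: eq_bigr => z _ /=; rewrite rmorphB /= map_polyX map_polyC.
Qed.

Lemma bezoutian_horner_lead (z : K) : (B.[z%:P])`_n.-1 = 1.
Proof.
rewrite /bezoutian horner_poly p_size coef_sum (bigD1 (Ordinal n_gt0)) //= expr0 mulr1.
rewrite coef_drop_poly addn1 prednK // big1 => [|k k0].
  by move/monicP: p_monic; rewrite lead_coefE p_size addr0.
rewrite -rmorphXn /= coefMC coef_drop_poly nth_default ?mul0r // p_size.
have : (0 < k)%N by rewrite lt0n.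
by lia.
Qed.

(** At a root of p the Bezoutian is a nonzero polynomial in t, so the
    substitution is surjective on points. *)
Lemma minor_at (c : 'I_m -> 'I_d) (z : K) : minor c != 0 -> (th (minor c)).[z%:MP] != 0.
Proof.
move=> Mc; have [v vM] := mpoly_point charK0 Mc.
have n1 : (n.-1 < n)%N by rewrite prednK.
have [|x xv] := @lam_surj K q n (B.[z%:P]) _ n1 _ v.
  by rewrite bezoutian_horner_lead oner_neq0.
apply: contraNneq vM => E; move: E; rewrite theta_horner => /(congr1 (meval x)).
rewrite meval0 comp_mpoly_meval => E; rewrite -[X in _ == X]E; apply/eqP.
by apply: meval_eq => j; rewrite tnth_mktuple xv.
Qed.

Lemma cancel_hat c0 : minor c0 != 0 -> forall a b, th (minor c0) * a = hat p * b ->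
  exists b', a = hat p * b'.
Proof.
move=> M0; have [rs [-> rsK]] := hat_roots; apply: cancel_roots => z /rsK[z0 ->].
exact: minor_at.
Qed.

(** At each root of p the Hartogs property comes from that of S(W), through a
    surjective linear substitution. *)
Lemma hartogs_hat c0 : minor c0 != 0 -> forall a,
  (forall c, exists u b, th (minor c0) * u = th (minor c) * a + hat p * b) ->
  exists r b, a = th (minor c0) * r + hat p * b.
Proof.
move=> M0; have [rs [-> rsK]] := hat_roots.
apply: (hartogs_roots (M := fun c => th (minor c))) => [z /rsK[z0 ->]|z /rsK[z0 ->] a Ha].
  exact: minor_at.
have n1 : (n.-1 < n)%N by rewrite prednK.
have f1 : (B.[z0%:P])`_n.-1 != 0 by rewrite bezoutian_horner_lead oner_neq0.
have h0 := minor_at z0 M0.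
have [||c|r ->] := @hartogs K charK0 N d (fun j => lamn (bvec j) (B.[z0%:P])) _ minor
  (th (minor c0)).[z0%:MP] a (thin_bad Omega_big) _ _ h0 _; last by exists r.
- exact: lam_surj n1 f1.
- by move=> x s y j; rewrite lam_lin_pt.
- by have [u E] := Ha c; exists u; rewrite E theta_horner mulrC.
Qed.

Lemma centre_span (H : S) : Zcentre br p H ->
  exists (r : 'rV[{poly S}]_m) C, grad H = r *m map_mx th J + hat p *: C.
Proof.
case/grad_kernel => C0 HC.
have [c0 M0] := minor_exists charK0 Omega_big.
have kl := @kernel_lie K charK0 q br brL m m_ind F F_inv Omega_big codim2 {poly S}.
have kl1 := kl th (hat p) c0.
have kl2 := kl1 (cancel_hat M0) (hartogs_hat M0).
exact: kl2 HC.
Qed.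

Lemma residue_expand (r g : {poly S}) : (size g <= n)%N ->
  residue (r * g) = \sum_(e < n) residue (r * 'X^e) * g`_e.
Proof.
move=> sg.
have -> : g = \sum_(e < n) (g`_e)%:P * 'X^e.
  under eq_bigr do rewrite mul_polyC.
  rewrite -poly_def; apply/polyP => k; rewrite coef_poly.
  by case: ltnP => // nk; rewrite nth_default // (leq_trans sg).
rewrite mulr_sumr residue_sum; apply: eq_bigr => e _.
rewrite mulrCA residueZ mulrC; congr (_ * _).
rewrite coef_sum (bigD1 e) //= coefCM coefXn eqxx mulr1 big1 ?addr0 // => k ke.
by rewrite coefCM coefXn eq_sym val_eqE (negPf ke) mulr0.
Qed.

Lemma mderiv_span (T : finType) (G : T -> S) (r : T -> S) (H : S) :
  (forall j (k : 'I_n), partial j k H = \sum_t r t * partial j k (G t)) ->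
  forall L, H^`M(L) = \sum_t r t * (G t)^`M(L).
Proof.
move=> Hr L.
have [a aE] : exists a, forall X : S, X^`M(L) = dir a X.
  by exists (\matrix_(j, k) coord (vbasis {:Wn}) L (tens n (bvec j) 'X^k)) => X; exact: mderivE.
rewrite aE dir_partial; under [RHS]eq_bigr do rewrite aE dir_partial mulr_sumr.
rewrite exchange_big /=; apply: eq_bigr => jk _; rewrite Hr scaler_sumr.
by apply: eq_bigr => t _; rewrite scalerAr.
Qed.

(** The dual basis for the residue form converts a relation between
    polynomials modulo p into one between their coefficients. *)
Lemma centre_gen_span (H : S) : Zcentre br p H ->
  exists r : 'I_m * 'I_n -> S, forall L, H^`M(L) = \sum_ie r ie * (centre_gen ie)^`M(L).
Proof.
move=> HZ; have [rho [C HE]] := centre_span HZ.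
exists (fun ie : 'I_m * 'I_n => residue (rho 0 ie.1 * 'X^(ie.2))); apply: mderiv_span => j k.
rewrite -coef_grad -(residue_dual (ltn_ord k) (size_grad H j)) HE.
rewrite mxE [X in _ * (_ + X)]mxE [(rho *m _) _ _]mxE mulrDr [X in _ + X]mulrCA residue_cong.
rewrite mulr_sumr residue_sum.
rewrite -(pair_bigA _ (fun (i : 'I_m) (e : 'I_n) =>
  residue (rho 0 i * 'X^e) * partial j k (centre_gen (i, e)))) /=.
apply: eq_bigr => i _; rewrite mulrCA -residue_red (residue_expand _ (size_red _)).
by apply: eq_bigr => e _; rewrite partial_centre_gen [map_mx _ _ _ _]mxE.
Qed.

Lemma partial_free_span (T : finType) (G r : T -> S) j k :
  (forall L, \sum_t r t * (G t)^`M(L) = 0) -> \sum_t r t * partial j k (G t) = 0.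
Proof.
move=> Hr; under eq_bigr do rewrite partialE mulr_sumr.
rewrite exchange_big big1 //= => L _; under eq_bigr do rewrite -scalerAr.
by rewrite -scaler_sumr Hr scaler0.
Qed.

(** The coefficients of a relation between differentials form, by duality, a
    row vector killed by J modulo p, and a minor of J is not a zero divisor
    modulo p. *)
Lemma centre_gen_free (a : 'I_m * 'I_n -> S) :
  (forall L, \sum_ie a ie * (centre_gen ie)^`M(L) = 0) -> forall ie, a ie = 0.
Proof.
move=> Ha; pose al i := \sum_(e < n) (a (i, e))%:P * hat (drop_poly e.+1 p).
have alE i (g : {poly S}) : (size g <= n)%N -> residue (al i * g) = \sum_(e < n) a (i, e) * g`_e.
  move=> sg; rewrite mulr_suml residue_sum; apply: eq_bigr => e _.
  by rewrite -mulrA residueZ residue_dual.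
pose w j := \sum_i al i * th (J i j).
have w0 j : red (w j) = 0.
  apply/polyP => k; rewrite coef0.
  have [nk|kn] := leqP n k; first by rewrite nth_default // (leq_trans (size_red _)).
  rewrite -(residue_dual kn (size_red _)) residue_red.
  have := partial_free_span j (Ordinal kn) Ha => E; rewrite -[RHS]E.
  rewrite (eq_bigr (fun ie => a (ie.1, ie.2) * partial j (Ordinal kn) (centre_gen (ie.1, ie.2)))) =>
    [|[] //].
  rewrite -(pair_bigA _ (fun i e => a (i, e) * partial j (Ordinal kn) (centre_gen (i, e)))) /=.
  rewrite mulr_sumr residue_sum; apply: eq_bigr => i _.
  rewrite mulrCA -residue_red (alE _ _ (size_red _)).
  by apply: eq_bigr => e _; rewrite partial_centre_gen.
have [C CE] : exists C : 'rV_d, (\row_i al i) *m map_mx th J = hat p *: C.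
  have /fin_all_exists[c cE] : forall j, exists c, w j = hat p * c.
    by move=> j; apply/(rmodp_eq0P _ P_monic).
  exists (\row_j c j); apply/rowP => j; rewrite mxE [RHS]mxE [X in _ * X]mxE -cE.
  by apply: eq_bigr => i _; rewrite mxE [map_mx _ _ _ _]mxE.
have [c0 M0] := minor_exists charK0 Omega_big.
have al0 i : al i = 0.
  pose X0 := map_mx th (selmx {mpoly K[d]} c0).
  have : th (minor c0) * al i = hat p * (C *m X0 *m \adj (map_mx th J *m X0)) 0 i.
    have := congr1 (fun M => (M *m X0 *m \adj (map_mx th J *m X0)) 0 i) CE.
    rewrite /= -[_ *m map_mx th J *m X0]mulmxA -[_ *m (map_mx th J *m X0) *m _]mulmxA.
    rewrite mul_mx_adj mul_mx_scalar -!scalemxAl -map_mxM mul_selmx det_map_mx.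
    by rewrite mxE [(\row_i _) _ _]mxE [RHS]mxE.
  case/(cancel_hat M0) => b alb.
  have s : (size (al i) <= n)%N.
    rewrite (leq_trans (size_sum _ _ _)) //; apply/bigmax_leqP => e _.
    rewrite mul_polyC (leq_trans (size_scale_leq _ _)) // size_hat size_drop_poly.
    by rewrite p_size subSS leq_subr.
  by rewrite -(red_small s); apply/(rmodp_eq0P _ P_monic); exists b.
case=> i e; have := alE i 'X^e; rewrite size_polyXn ltn_ord => /(_ isT).
rewrite al0 mul0r residue0 (bigD1 e) //= coefXn eqxx mulr1 big1 ?addr0 // => k ke.
by rewrite coefXn val_eqE (negPf ke) mulr0.
Qed.

Lemma Zcentre_generated (H : S) : Zcentre br p H -> gen (fun x => exists ie, x = centre_gen ie) H.
Proof.
move=> HZ.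
pose u (jk : 'I_d * 'I_n) (L : 'I_N) : S :=
  sym_lin (bracket_mod br p (bvec L) (tens n (bvec jk.1) 'X^(jk.2))).
have flowE jk X : flow u jk X = pb X (lamn (bvec jk.1) 'X^(jk.2)).
  by rewrite /lam (lie_poisson_lin _ _ (bracket_linr brL p)).
apply: (@invariants_gen K charK0 N _ u _ _ centre_gen (fun ie => deg ie.1) _
  centre_gen_homog _ centre_gen_free _ H _).
- move=> jk L; rewrite /u /sym_lin; apply: rpred_sum => I _; apply: dhomogZ.
  by rewrite dhomogX /= mdeg1.
- by move=> ie; exact: (deg_gt0 charK0 F_homog Omega_big).
- by move=> jk ie; rewrite flowE; apply: centre_gen_central.
- by move=> X X0; apply: centre_gen_span; apply: Zcentre_lam => jk; rewrite -flowE.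
- by move=> jk; rewrite flowE; apply: HZ.
Qed.

End Centre.

(** * Interpolation and congruence of curves *)

Section Tools.
Variables (K : closedFieldType) (N : nat).
Local Notation S := {mpoly K[N]}.
Local Notation hat := (map_poly (@mpolyC N K)).

(** Divide by s - z for a z with w(z) != 0: the quotient has smaller degree,
    and its values at the other points are combinations of the known ones. *)
Lemma gen_interpolation (A : S -> Prop) k (w : {poly K}) (g : {poly S}) :
  w != 0 -> (size g <= k)%N ->
  (forall z, w.[z] != 0 -> gen A g.[z%:MP]) -> forall e, gen A g`_e.
Proof.
elim: k w g => [|k IHk] w g w0 sg Ag e.
  by rewrite nth_default ?(leq_trans sg) //; exact: gen0.
have /closed_nonrootP[z wz] := w0.
have : (g - (g.[z%:MP])%:P).[z%:MP] = 0 by rewrite !hornerE subrr.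
move/eqP/factor_theorem => [g1 gE].
have X0 : 'X - (z%:MP)%:P != 0 :> {poly S} by rewrite polyXsubC_eq0.
have sg1 : (size g1 <= k)%N.
  have [->|g10] := eqVneq g1 0; first by rewrite size_poly0.
  have : (size (g1 * ('X - (z%:MP)%:P))%R <= k.+1)%N.
    rewrite -gE (leq_trans (size_polyD _ _)) // geq_max sg size_polyN.
    by rewrite size_polyC (leq_trans (leq_b1 _)).
  by rewrite size_Mmonic ?monicXsubC // size_XsubC addn2.
have Ag1 : forall e, gen A g1`_e.
  apply: (IHk (w * ('X - z%:P))) => //; first by rewrite mulf_neq0 ?polyXsubC_eq0.
  move=> y; rewrite hornerM mulf_eq0 negb_or !hornerE => /andP[wy yz].
  have -> : g1.[y%:MP] = (y - z)^-1 *: (g.[y%:MP] + (-1) *: g.[z%:MP]).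
    rewrite scaleN1r; have := congr1 (fun h => h.[y%:MP]) gE; rewrite !hornerE => ->.
    rewrite -mpolyCB mulrC mul_mpolyC scalerA mulVf // scale1r; done.
  by apply: gen_scale; apply: gen_add; [exact: Ag | apply: gen_scale; exact: Ag].
have -> : g = g1 * 'X + (- z%:MP)%:P * g1 + (g.[z%:MP])%:P.
  move/eqP: gE; rewrite subr_eq => /eqP {1}->.
  by rewrite polyCN; ring.
rewrite !coefD coefMX coefCM coefC.
apply: gen_add; last by case: ifP => _; [exact: Ag | exact: gen0].
apply: gen_add; first by case: ifP => _; [exact: gen0 | exact: Ag1].
by rewrite -mpolyCN mul_mpolyC; apply: gen_scale.
Qed.

Lemma gen_rmodp (A : S -> Prop) (p : {poly K}) (g : {poly S}) :
  p \is monic -> (forall e, gen A g`_e) ->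
  forall e, gen A (Pdiv.Ring.rmodp g (hat p))`_e.
Proof.
by move=> mp Ag e; rewrite rmodp_coef //; apply: gen_sum => k _; apply: gen_scale.
Qed.

Lemma gen_coefM (A : S -> Prop) (a b : {poly S}) :
  (forall e, gen A a`_e) -> (forall e, gen A b`_e) -> forall e, gen A (a * b)`_e.
Proof. by move=> Aa Ab e; rewrite coefM; apply: gen_sum => i _; apply: gen_mul. Qed.

Lemma gen_hat (A : S -> Prop) (a : {poly K}) e : gen A (hat a)`_e.
Proof. by rewrite coef_map; apply: gen_const. Qed.

(** Congruent curves give congruent substitutions. *)
Lemma mmap_cong (R : comNzRingType) (f : {rmorphism K -> R}) d (h h' : 'I_d -> R) (P : R) :
  (forall j, exists c, h j = h' j + P * c) ->
  forall F : {mpoly K[d]}, exists c, mmap f h F = mmap f h' F + P * c.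
Proof.
move=> hh; apply: mpoly_ring_ind => [c|i|a b [u E1] [v E2]|a b [u E1] [v E2]].
- by exists 0; rewrite !mmapC mulr0 addr0.
- by have [c E] := hh i; exists c; rewrite !mmapXU.
- by exists (u + v); rewrite !rmorphD /= E1 E2; ring.
- exists (u * (mmap f h' b + P * v) + mmap f h' a * v).
  by rewrite !rmorphM /= E1 E2; ring.
Qed.

Lemma top_mmap (R : comNzRingType) (f : {rmorphism K -> R}) d D (h : 'I_d -> {poly R}) x e
    (F : {mpoly K[d]}) : (forall j, top D (h j) (x j)) -> F \is e.-homog ->
  top (D * e) (mmap (polyC \o f) h F) (mmap f x F).
Proof.
move=> hx /dhomogP hF; rewrite /mmap.
have {hF} : forall m, m \in msupp F -> mdeg m = e by exact: hF.
elim: (msupp F) => [|m r IHr] hr; first by rewrite !big_nil; exact: top0.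
rewrite !big_cons; apply: topD; last first.
  by apply: IHr => m' m'r; apply: hr; rewrite inE m'r orbT.
rewrite -(hr m (mem_head _ _)) -[(D * _)%N]add0n; apply: topM; first exact: topC.
rewrite mdegE big_distrr; apply: top_prod => i; exact: topX.
Qed.

(** The matrix of differentials at v has a right inverse over K, which makes a
    maximal determinant of the matrix over S nonzero. *)
Lemma free_at_point (T : finType) (G : T -> S) (v : 'I_N -> K) :
  (forall c : T -> K, (forall L, \sum_t c t * ((G t)^`M(L)).@[v] = 0) -> forall t, c t = 0) ->
  forall r : T -> S, (forall L, \sum_t r t * (G t)^`M(L) = 0) -> forall t, r t = 0.
Proof.
move=> free r Hr t0; pose A := (\matrix_(t < #|T|, L < N) ((G (enum_val t))^`M(L)).@[v]).
have Afree : row_free A.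
  apply/inj_row_free => u uA; apply/rowP => t; rewrite [RHS]mxE.
  have := free (fun t => u 0 (enum_rank t)); move/(_ _ (enum_val t)).
  rewrite enum_valK; apply => L; have /rowP/(_ L) := uA; rewrite mxE [RHS]mxE => E.
  rewrite -[RHS]E (reindex _ (onW_bij _ (@enum_val_bij T))) /=; apply: eq_bigr => s _.
  by rewrite enum_valK mxE.
have [B AB] := row_freeP Afree.
pose M (s t : 'I_#|T|) : S := \sum_L (G (enum_val s))^`M(L) * (B L t)%:MP.
have Mv s t : (M s t).@[v] = (s == t)%:R.
  rewrite rmorph_sum /=.
  have := congr1 (fun X : 'M_(_, _) => X s t) AB; rewrite /= mxE [RHS]mxE => E.
  by rewrite -E; apply: eq_bigr => L _; rewrite mevalM mevalC mxE.
have rM : (\row_s r (enum_val s)) *m (\matrix_(s, t) M s t) = 0.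
  apply/rowP => t; rewrite mxE [RHS]mxE.
  under eq_bigr do rewrite !mxE mulr_sumr.
  rewrite exchange_big big1 //= => L _.
  under eq_bigr do rewrite mulrA.
  rewrite -mulr_suml; have := Hr L.
  by rewrite (reindex _ (onW_bij _ (@enum_val_bij T))) /= => ->; rewrite mul0r.
have dM : \det (\matrix_(s, t) M s t) != 0.
  have : (\det (\matrix_(s, t) M s t)).@[v] = 1.
    rewrite -det_map_mx -[RHS](det1 _ #|T|); congr (\det _).
    apply/matrixP => s t; transitivity (M s t).@[v]; last by rewrite Mv [RHS]mxE.
    by rewrite mxE /= [in LHS]mxE.
  by move=> E; apply/eqP => D0; move: E; rewrite D0 meval0 => /eqP; rewrite eq_sym oner_eq0.
have := congr1 (fun X => X *m \adj (\matrix_(s, t) M s t)) rM.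
rewrite /= -mulmxA mul_mx_adj mul_mx_scalar mul0mx => /rowP/(_ (enum_rank t0)).
rewrite !mxE enum_rankK => /eqP; rewrite mulf_eq0 (negPf dM) /= => /eqP //.
Qed.

End Tools.

(** * Pencils of moduli *)

Lemma sum_pair (V : nmodType) (A B : finType) (f : A * B -> V) :
  \sum_x f x = \sum_a \sum_b f (a, b).
Proof. by rewrite pair_bigA; apply: eq_bigr => -[]. Qed.

Lemma sum_tagged (V : nmodType) (A : finType) (B : A -> finType) (f : {a : A & B a} -> V) :
  \sum_x f x = \sum_a \sum_b f (existT _ a b).
Proof.
rewrite (sig_big_dep _ (fun _ _ => true) (fun a b => f (existT _ a b))) /=.
by apply: eq_bigr => -[].
Qed.

Section DualBasis.
Variables (K : fieldType) (n : nat).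

(** The linear form on polynomials with values v on the first n powers of the
    variable and 0 on the others. *)
Definition functional (v : 'I_n -> K) (f : {poly K}) : K := \sum_(l < n) v l * f`_l.

Lemma functional_is_linear v : linear (functional v : {poly K} -> K^o).
Proof.
move=> a f g; rewrite /functional scaler_sumr -big_split; apply: eq_bigr => l _ /=.
by rewrite coefD coefZ mulrDr mulrCA.
Qed.

HB.instance Definition _ v := GRing.isLinear.Build K {poly K} K^o _ (functional v : {poly K} -> K^o)
  (functional_is_linear v).

Lemma functional0 v : functional v 0 = 0.
Proof. by rewrite /functional big1 // => l _; rewrite coef0 mulr0. Qed.

Lemma functionalZ v a f : functional v (a *: f) = a * functional v f.
Proof. by rewrite /functional mulr_sumr; apply: eq_bigr => l _; rewrite coefZ mulrCA. Qed.

Lemma functional_sum v (I : Type) (r : seq I) (f : I -> {poly K}) :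
  functional v (\sum_(i <- r) f i) = \sum_(i <- r) functional v (f i).
Proof.
rewrite /functional exchange_big; apply: eq_bigr => l _ /=.
by rewrite coef_sum mulr_sumr.
Qed.

Lemma coef_functional v (g : {poly {poly K}}) k :
  (map_poly (functional v) g)`_k = functional v g`_k.
Proof. exact: coef_map_id0 (functional0 v). Qed.

Lemma map_functional_mul v (a : {poly K}) (g : {poly {poly K}}) :
  map_poly (functional v) (map_poly polyC a * g) = a * map_poly (functional v) g.
Proof.
apply/polyP => k; rewrite coef_functional !coefM functional_sum; apply: eq_bigr => i _.
by rewrite coef_functional coef_map /= mul_polyC functionalZ.
Qed.

Lemma map_functionalD v (a b : {poly {poly K}}) :
  map_poly (functional v) (a + b) = map_poly (functional v) a + map_poly (functional v) b.
Proof.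
apply/polyP => k; rewrite coefD !coef_functional coefD /functional -big_split.
by apply: eq_bigr => l _; rewrite coefD mulrDr.
Qed.

Lemma dual_basis (f : nat -> {poly K}) :
  (forall v : 'I_n -> K, (forall k, (k < n)%N -> functional v (f k) = 0) -> forall l, v l = 0) ->
  exists P : nat -> 'I_n -> K,
    forall k k', (k < n)%N -> (k' < n)%N -> functional (P k) (f k') = (k == k')%:R.
Proof.
move=> nd; pose A := (\matrix_(l < n, k < n) (f k)`_l).
have Afree : row_free A.
  apply/inj_row_free => u uA; apply/rowP => l; rewrite [RHS]mxE.
  apply: (nd (fun l => u 0 l)) => k kn; have /rowP/(_ (Ordinal kn)) := uA.
  rewrite mxE [RHS]mxE => E; rewrite -[RHS]E; apply: eq_bigr => j _; by rewrite mxE.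
have [B AB] := row_freeP Afree.
exists (fun k l => if insub k is Some k0 then B k0 l else 0) => k k' kn k'n.
rewrite insubT /functional.
have := congr1 (fun M : 'M_n => M (Ordinal kn) (Ordinal k'n)) (mulmx1C AB).
rewrite /= mxE [RHS]mxE -val_eqE /= => <-; apply: eq_bigr => l _.
by rewrite mxE.
Qed.

(** Triangularity: a monic polynomial of degree s expresses v s through the v
    i with i < s. *)
Lemma monic_family_span (v : 'I_n -> K) :
  (forall s, (s < n)%N -> exists f : {poly K}, [/\ f \is monic, size f = s.+1 & functional v f = 0]) ->
  forall s, v s = 0.
Proof.
move=> vf l; move: {2}(l : nat) (erefl (l : nat)) => s; elim/ltn_ind: s l => s IHs l ls.
have [f [mf sf]] := vf l (ltn_ord l); rewrite /functional (bigD1 l) //=.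
move/monicP: mf; rewrite lead_coefE sf /= => ->; rewrite mulr1 big1 ?addr0 // => j jl.
have [lj|lj] := ltnP j l; first by rewrite (IHs j) ?mul0r // -ls.
rewrite nth_default ?mulr0 // sf ltn_neqAle lj andbT.
by apply: contra jl => /eqP E; apply/eqP/val_inj.
Qed.

Lemma drop_poly_monic (p : {poly K}) k0 k : p \is monic -> size p = k0.+1 -> (k < k0)%N ->
  drop_poly k.+1 p \is monic /\ size (drop_poly k.+1 p) = (k0 - k)%N.
Proof.
move=> mp sp kk; have sd : size (drop_poly k.+1 p) = (k0 - k)%N by rewrite size_drop_poly sp subSS.
split=> //; rewrite monicE lead_coefE sd coef_drop_poly.
have -> : ((k0 - k).-1 + k.+1 = k0)%N by move: kk; lia.
by move/monicP: mp; rewrite lead_coefE sp /= => ->.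
Qed.

End DualBasis.

Section Pencil.
Variables (K : closedFieldType) (charK0 : [pchar K] =i pred0).
Variables (q : vectType K) (br : q -> q -> q) (brL : lie_bracket br).
Variables (m : nat) (m_ind : is_index br m) (F : m.-tuple (Sym q)).
Local Notation d := (\dim {:q}).
Variables (deg : 'I_m -> nat) (F_homog : forall i, tnth F i \is (deg i).-homog).
Hypothesis (F_inv : forall i, sym_inv br (tnth F i)).
Hypothesis (Omega_big : big (wedge_neq0 F)) (codim2 : codim_property 2 br).
Variables (n : nat) (n_ge2 : (2 <= n)%N).
Variables (p : {poly K}) (p_monic : p \is monic) (p_size : size p = n.+1).
Variables (l : {poly K}) (l_size : (size l <= 2)%N).
Local Notation J := (jac F).
Local Notation Wn := (W q n).
Local Notation N := (\dim {:Wn}).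
Local Notation S := {mpoly K[N]}.
Local Notation hat := (map_poly (@mpolyC N K)).
Local Notation lamn := (@lam K q n).
Local Notation th := (@theta K q n).

Definition pencil (c : K) := p + c *: l.

Lemma size_cl c : (size (c *: l) < size p)%N.
Proof.
by rewrite p_size ltnS (leq_trans (size_scale_leq _ _)) // (leq_trans l_size).
Qed.

Lemma pencil_size c : size (pencil c) = n.+1.
Proof. by rewrite /pencil size_polyDl // size_cl. Qed.

Lemma pencil_monic c : pencil c \is monic.
Proof. by rewrite monicE /pencil lead_coefDl ?size_cl // (monicP p_monic). Qed.

Let n_gt0 : (0 < n)%N := ltnW n_ge2.

Local Notation centres := (fun H : S => exists c, Zcentre br (pencil c) H).

(** At a root of p_c a polynomial in s and its remainder modulo p_c have the
    same value. *)
Lemma root_value c z i : root (pencil c) z ->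
  gen centres (tnth F i \mPo [tuple lamn (bvec j) ((bezoutian (pencil c)).[z%:P]) | j < d]).
Proof.
move=> rz; rewrite -theta_horner; set g := theta _ _ _.
have mP : hat (pencil c) \is monic by rewrite map_monic pencil_monic.
rewrite (Pdiv.RingMonic.rdivp_eq mP g) hornerD hornerM.
have -> : (hat (pencil c)).[z%:MP] = 0 by rewrite horner_map (eqP rz) rmorph0.
rewrite mulr0 add0r horner_coef; apply: gen_sum => e _.
apply: gen_mul; last by rewrite -rmorphXn; apply: gen_const.
have [en|ne] := ltnP e n.
  apply: gen_base; exists c.
  exact: (centre_gen_central brL F_inv n_gt0 (pencil_monic c) (pencil_size c) (i, Ordinal en)).
rewrite nth_default; first exact: gen0.
by rewrite (leq_trans (size_red (pencil_monic c) (pencil_size c) g)).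
Qed.

(** The constant coefficients of m polynomials, and n - 1 families of deg i
    coefficients each. *)
Definition block_index := ('I_m + 'I_n.-1 * {i : 'I_m & 'I_(deg i)})%type.

Lemma card_block_index : #|{: block_index}| = b_lie_n q m n.
Proof.
rewrite card_sum card_prod !card_ord card_tagged sumnE big_map big_enum /=.
under eq_bigr do rewrite card_ord.
rewrite /b_lie_n /b_lie (sum_degrees charK0 brL m_ind F_homog F_inv Omega_big codim2).
by rewrite mul2n doubleK subn1 addnC.
Qed.

(** It remains to give, for each pencil, generators G that have independent
    differentials, express the generators of all the centres, and are
    themselves expressed through them. *)
Lemma pencil_polynomial (G : block_index -> S) :
  (forall r : block_index -> S, (forall L, \sum_t r t * (G t)^`M(L) = 0) -> forall t, r t = 0) ->
  (forall c i e, gen (fun x => exists t, x = G t)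
      (Pdiv.Ring.rmodp (th (bezoutian (pencil c)) (tnth F i)) (hat (pencil c)))`_e) ->
  (forall t, gen centres (G t)) ->
  polynomial_ring (Zpair br (n := n) p (p + l)) (b_lie_n q m n).
Proof.
move=> free sub sup; rewrite -card_block_index.
pose GT := [tuple G (enum_val i) | i < #|{: block_index}|].
exists GT; split.
  apply: (jacobian_indep charK0) => r Hr t.
  have := free (fun s => r (enum_rank s)); move/(_ _ (enum_val t)); rewrite enum_valK.
  apply=> L; rewrite -[RHS](Hr L) (reindex _ (onW_bij _ (@enum_val_bij block_index))) /=.
  by apply: eq_bigr => s _; rewrite enum_valK tnth_mktuple.
have pcE a : a *: p + (1 - a) *: (p + l) = pencil (1 - a).
  by rewrite scalerDr addrA -scalerDl [a + _]addrC subrK scale1r.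
move=> H; rewrite -gen_tuple /Zpair generatedE; split; apply: gen_trans.
  move=> x [a]; rewrite pcE => xZ.
  have := @Zcentre_generated K charK0 q br brL m m_ind F deg F_homog F_inv Omega_big codim2
    n n_gt0 (pencil (1 - a)) (pencil_monic _) (pencil_size _) x xZ.
  apply: gen_trans => _ [ie ->].
  apply: (gen_trans _ (sub (1 - a) ie.1 ie.2)) => _ [t ->]; apply: gen_base.
  by exists (enum_rank t); rewrite tnth_mktuple enum_rankK.
move=> _ [t ->]; rewrite tnth_mktuple; apply: gen_trans (sup _) => x [c xZ].
by apply: gen_base; exists (1 - c); rewrite pcE subKr.
Qed.

(** The directions D j b with b > 0 separate the n - 1 families, each of which
    is an argument shift family at the point, and do not see the other
    generators; these are separated by the directions D j 0, which give the
    differentials of the F_i at x. *)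
Lemma block_free (G : block_index -> S) x y (a : 'M[K]_(d, n)) (D : 'I_d -> nat -> 'M[K]_(d, n)) :
  generic_line F x y ->
  (forall j i e (b b' : 'I_n.-1), (dir (D j b'.+1) (G (inr (b, existT _ i e)))).@[pt a] =
      (b == b')%:R * (line idfun x y (J i j))`_e) ->
  (forall j i (b' : 'I_n.-1), (dir (D j b'.+1) (G (inl i))).@[pt a] = 0) ->
  (forall j i, (dir (D j 0%N) (G (inl i))).@[pt a] = (J i j).@[x]) ->
  forall r : block_index -> S, (forall L, \sum_t r t * (G t)^`M(L) = 0) -> forall t, r t = 0.
Proof.
move=> xy H1 H2 H3; apply: (free_at_point (v := pt a)) => c Hc.
have Hd j k : \sum_t c t * (dir (D j k) (G t)).@[pt a] = 0.
  transitivity (\sum_t \sum_L linform (D j k) (bvec L) * (c t * ((G t)^`M(L)).@[pt a])).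
    apply: eq_bigr => t _; rewrite rmorph_sum mulr_sumr; apply: eq_bigr => L _ /=.
    by rewrite mevalZ mulrCA.
  by rewrite exchange_big big1 //= => L _; rewrite -mulr_sumr Hc mulr0.
have c_inr b i e : c (inr (b, existT _ i e)) = 0.
  pose cc (i : 'I_m) (e : nat) :=
    if (insub e : option 'I_(deg i)) is Some e' then c (inr (b, existT _ i e')) else 0.
  suff : cc i e = 0 by rewrite /cc valK.
  apply: (argument_shift_free charK0 brL m_ind F_homog F_inv Omega_big codim2 xy) => // j.
  have := Hd j b.+1; rewrite big_sumType /= big1 ?add0r => [|i' _]; last by rewrite H2 mulr0.
  rewrite sum_pair (bigD1 b) //= [X in _ + X]big1 ?addr0 => [|b' b'b]; last first.
    by rewrite big1 // => -[i' e'] _; rewrite H1 (negPf b'b) mul0r mulr0.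
  rewrite sum_tagged => E; rewrite -[RHS]E.
  apply: eq_bigr => i' _; apply: eq_bigr => e' _.
  by rewrite H1 eqxx mul1r /cc valK.
have c_inl : \row_i c (inl i) = 0.
  have xb : ~ bad F x.
    case: xy => xs _ xb; apply: (xs 0) => cc; rewrite -[RHS](xb cc).
    by apply: meval_eq => i; rewrite mul0r addr0.
  apply: nbad_inj xb _; apply/rowP => j; rewrite mxE [RHS]mxE.
  have := Hd j 0%N; rewrite big_sumType /= [X in _ + X]big1 ?addr0 => [E|]; last first.
    by move=> [b [i e]] _; rewrite c_inr mul0r.
  by rewrite -[RHS]E; apply: eq_bigr => i _; rewrite H3 mxE [map_mx _ _ _ _]mxE.
case=> [i|[b [i e]]]; last exact: c_inr.
by have /rowP/(_ i) := c_inl; rewrite !mxE.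
Qed.

(** The point at which bvec j f takes the value Y k j when f is the k-th
    polynomial of the basis dual to the functionals P. *)
Definition dual_pt (P : nat -> 'I_n -> K) (Y : nat -> 'I_d -> K) : 'M[K]_(d, n) :=
  \matrix_(j, s) \sum_(k < n) Y k j * P k s.

(** The direction that differentiates with respect to bvec j f, for the same
    k-th polynomial f. *)
Definition dual_dir (P : nat -> 'I_n -> K) (j : 'I_d) (k : nat) : 'M[K]_(d, n) :=
  \matrix_(i, s) ((i == j)%:R * P k s).

Lemma lam_dual_pt (P : nat -> 'I_n -> K) (Y : nat -> 'I_d -> K) j f :
  (lamn (bvec j) f).@[pt (dual_pt P Y)] =
  \sum_(k < n) Y k j * functional (P k) f.
Proof.
rewrite /lam sym_lin_pt linform_tens.
under [RHS]eq_bigr do rewrite mulr_sumr.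
rewrite exchange_big; apply: eq_bigr => s _ /=; rewrite mxE mulr_suml.
by apply: eq_bigr => k _; rewrite mulrA.
Qed.

Lemma dir_dual (P : nat -> 'I_n -> K) i j k f : dir (dual_dir P j k) (lamn (bvec i) f) =
  ((i == j)%:R * functional (P k) f)%:MP.
Proof.
rewrite /lam dir_sym_lin linform_tens mulr_sumr; congr (_%:MP).
by apply: eq_bigr => s _; rewrite mxE mulrA.
Qed.

(** The chain rule at such a point: w is the rate of change of the curve g in
    the chosen direction, and cv is the curve itself. *)
Lemma dir_theta (P : nat -> 'I_n -> K) (Y : nat -> 'I_d -> K) (g : {poly {poly K}})
    i j (k e : nat) (cv : 'I_d -> {poly K}) w :
  (forall i' s, \sum_(k' < n) Y k' i' * functional (P k') g`_s = (cv i')`_s) ->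
  map_poly (functional (P k)) g = w ->
  (dir (dual_dir P j k) (th g (tnth F i))`_e).@[pt (dual_pt P Y)] =
  (mmap (polyC \o idfun) cv (J i j) * w)`_e.
Proof.
move=> cvE wE; set D := dual_dir P j k; set a := dual_pt P Y.
have dir0 : dir D (0 : S) = 0 by have := dirC D 0; rewrite mpolyC0.
have cD (h : {poly S}) s : (map_poly (dir D) h)`_s = dir D h`_s by exact: coef_map_id0.
have der := map_poly_derivation (dir_derivation D).
have D0 c : map_poly (dir D) ((polyC \o @mpolyC N K) c) = 0.
  apply/polyP => s; rewrite /= coef0 cD coefC.
  by case: ifP => _; rewrite ?dirC ?dir0.
have main : map_poly (dir D) (th g (tnth F i)) = th g (J i j) * hat w.
  rewrite /theta (mmap_chain _ der D0) (bigD1 j) //= big1 => [|i' ij]; last first.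
    have -> : map_poly (dir D) (map_poly (lamn (bvec i')) g) = 0; last by rewrite mulr0.
    apply/polyP => s; rewrite coef0 cD coef_map /=.
    by rewrite dir_dual (negPf ij) mul0r mpolyC0.
  rewrite addr0 mxE; congr (_ * _); apply/polyP => s.
  by rewrite cD !coef_map /= dir_dual eqxx mul1r -wE coef_functional.
rewrite -cD main; set M := map_poly (meval (pt a)).
have -> : mmap (polyC \o idfun) cv (J i j) = M (th g (J i j)).
  apply/esym; apply: (mmap_rmorph (g := M)) => [c|i'].
    by rewrite /M /= map_polyC /= mevalC.
  by apply/polyP => s; rewrite /M !coef_map /= lam_dual_pt cvE.
have wM : w = M (hat w) by apply/polyP => s; rewrite /M !coef_map /= mevalC.
by rewrite [in RHS]wM /M -rmorphM coef_map.
Qed.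

Lemma coef_block (L : {poly K}) D b b' e : (0 < D)%N -> (b < D)%N -> (b' < D)%N ->
  ((L \Po 'X^D) * 'X^(b'.+1))`_(b.+1 + D * e) = (b == b')%:R * L`_e.
Proof.
move=> D0 bD b'D; rewrite coefMXn addSn ltnS ltnNge.
have [le|gt] := leqP b' (b + D * e); last first.
  have [E|_] := eqVneq b b'; last by rewrite mul0r.
  by move: gt; rewrite E ltnNge leq_addr.
rewrite subSS coef_comp_poly_Xn //; have [E|nE] := eqVneq b b'.
  by rewrite E addKn dvdn_mulr // mulKn // mul1r.
rewrite mul0r; case: ifP => // /dvdnP[s E].
have {}E : (b + D * e = s * D + b')%N by rewrite -E subnK.
have := congr1 (fun z => z %% D)%N E.
rewrite addnC mulnC !modnMDl !modn_small // => bb'.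
by move: nE; rewrite bb' eqxx.
Qed.

Lemma mmap_line (x y : 'I_d -> K) D (G : {mpoly K[d]}) :
  mmap (polyC \o idfun) (fun j => (x j)%:P + (y j)%:P * 'X^D) G =
  (line idfun x y G : {poly K}) \Po 'X^D :> {poly K} .
Proof.
apply/esym; apply: (mmap_rmorph (g := comp_poly 'X^D)) => [c|j] /=.
  by rewrite comp_polyC.
by rewrite comp_polyD comp_polyM !comp_polyC comp_polyX.
Qed.

Lemma bezoutian_l : bezoutian l = ((l`_1)%:P)%:P.
Proof.
have l0 s : (2 <= s)%N -> l`_s = 0 by move=> s2; rewrite nth_default // (leq_trans l_size).
apply/polyP => k; rewrite coef_bezoutian coefC; apply/polyP => s; rewrite coef_drop_poly.
case: k => [|k] /=; last by rewrite coef0 l0 // !addnS.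
by case: s => [|s]; rewrite coefC //= l0 // addn1.
Qed.

Lemma bezoutian_pencil c : bezoutian (pencil c) = bezoutian p + map_poly polyC c%:P * ((l`_1)%:P)%:P.
Proof. by rewrite /pencil addrC bezoutian_is_linear bezoutian_l addrC. Qed.

Lemma cur_const (x : q) f : map_poly (lamn x) (f%:P) = (lamn x f)%:P.
Proof. by rewrite map_polyC. Qed.

(** * The pencil when its direction is coprime to the modulus *)

Section Coprime.
Hypothesis (l_neq0 : l != 0) (l_coprime : coprimep l p).

(** Up to sign, the Bezoutian of l and p, because B_l is the constant l_1. *)
Definition bezoutian_lp : {poly {poly K}} :=
  map_poly polyC l * bezoutian p - map_poly polyC p * ((l`_1)%:P)%:P.

Lemma bezoutian_lp_pencil c : bezoutian_lp =
  map_poly polyC l * bezoutian (pencil c) - map_poly polyC (pencil c) * ((l`_1)%:P)%:P.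
Proof.
rewrite /bezoutian_lp bezoutian_pencil /pencil rmorphD /= -mul_polyC rmorphM /=; ring.
Qed.

(** The terms of degree n in s cancel. *)
Lemma size_bezoutian_lp : (size bezoutian_lp <= n)%N.
Proof.
have lE : l = (l`_0)%:P + (l`_1)%:P * 'X.
  apply/polyP => -[|[|k]]; rewrite coefD coefC coefMX coefC /= ?addr0 ?add0r //.
  by rewrite nth_default // (leq_trans l_size).
have Bn k : (n <= k)%N -> (bezoutian p)`_k = 0.
  move=> nk; rewrite coef_bezoutian; apply/eqP; rewrite -size_poly_eq0 size_drop_poly p_size.
  by rewrite subn_eq0 ltnS.
apply/leq_sizeP => k nk; rewrite /bezoutian_lp coefB coefMC coef_map /=.
rewrite {1}lE rmorphD rmorphM /= !map_polyC map_polyX /= mulrDl -mulrA ['X * _]mulrC mulrA.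
rewrite coefD coefMX !coefCM (Bn k) // mulr0 add0r.
case: k nk => [|k] nk; first by move: nk; rewrite leqn0; move: n_ge2; case: (n).
rewrite /=; move: nk; rewrite leq_eqVlt => /orP[/eqP nk|nk].
  have -> : (bezoutian p)`_k = 1.
    rewrite coef_bezoutian -nk; apply/polyP => s; rewrite coef_drop_poly coef1.
    case: s => [|s] /=; last by rewrite nth_default // p_size addSn ltnS leq_addl.
    by move/monicP: p_monic; rewrite lead_coefE p_size.
  move/monicP: p_monic; rewrite lead_coefE p_size /= nk => ->.
  by rewrite mulr1 mul1r subrr.
rewrite (Bn k) // mulr0 [p`_ _]nth_default ?p_size // mul0r subr0 //.
Qed.

(** A functional that kills the Bezoutian of two coprime polynomials kills l
    B_p modulo p, hence B_p modulo p, hence B_p for reasons of degree, and the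
    Horner polynomials form a basis. *)
Lemma bezoutian_lp_nondeg (v : 'I_n -> K) :
  (forall k, (k < n)%N -> functional v bezoutian_lp`_k = 0) -> forall s, v s = 0.
Proof.
move=> vB.
have B0 : map_poly (functional v) bezoutian_lp = 0.
  apply/polyP => k; rewrite coef0 coef_functional.
  by case: (ltnP k n) => [/vB //|nk]; rewrite nth_default ?functional0 // (leq_trans size_bezoutian_lp).
have dv : p %| l * map_poly (functional v) (bezoutian p).
  have -> : l * map_poly (functional v) (bezoutian p) = p * map_poly (functional v) ((l`_1)%:P)%:P.
    rewrite -!map_functional_mul.
    have -> : map_poly polyC l * bezoutian p = bezoutian_lp + map_poly polyC p * ((l`_1)%:P)%:P.
      by rewrite /bezoutian_lp subrK.
    by rewrite map_functionalD B0 add0r.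
  exact: dvdp_mulr.
have Bv : map_poly (functional v) (bezoutian p) = 0.
  apply/eqP; apply: contraTT dv => nz.
  rewrite Gauss_dvdpr; last by rewrite coprimep_sym.
  apply/negP => /dvdp_leq => /(_ nz); rewrite p_size ltnNge => /negP[].
  apply: leq_trans (size_poly _ _) _; apply: leq_trans (size_poly _ _) _.
  by rewrite p_size.
apply: monic_family_span => s sn.
have kn : (n - s.+1 < n)%N by rewrite ltn_subrL.
have [dm ds] := drop_poly_monic p_monic p_size kn.
exists (drop_poly (n - s.+1).+1 p); split=> //; first by rewrite ds subKn.
by rewrite -coef_bezoutian -coef_functional Bv coef0.
Qed.

Definition coprime_gen (t : block_index) : S := match t with
  | inl i => (th bezoutian_lp (tnth F i))`_0
  | inr (b, existT i e) => (th bezoutian_lp (tnth F i))`_(b.+1 + n.-1 * e)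
  end.

(** All the other coefficients vanish for reasons of degree; the positions
    from 1 on are split as b + 1 + (n - 1) e. *)
Lemma coprime_gen_coef i k : gen (fun x => exists t, x = coprime_gen t) (th bezoutian_lp (tnth F i))`_k.
Proof.
have [sk|ks] := ltnP (n.-1 * deg i) k.
  have top_cur j : top n.-1 (map_poly (lamn (bvec j)) bezoutian_lp) (lamn (bvec j) bezoutian_lp`_n.-1).
    split; last by rewrite coef_map.
    by rewrite prednK // (leq_trans (size_poly _ _)) ?size_bezoutian_lp.
  have [st _] := top_mmap (@mpolyC N K) top_cur (F_homog i).
  by rewrite nth_default ?(leq_trans st) //; exact: gen0.
case: k ks => [|k] ks; first by apply: gen_base; exists (inl i).
have n1 : (0 < n.-1)%N by rewrite -subn1 subn_gt0.
have ke : (k %/ n.-1 < deg i)%N by rewrite ltn_divLR // mulnC.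
have kb : (k %% n.-1 < n.-1)%N by rewrite ltn_mod.
apply: gen_base; exists (inr (Ordinal kb, existT _ i (Ordinal ke))) => /=.
by rewrite addSn {1}(divn_eq k n.-1) addnC mulnC.
Qed.

(** Homogeneity of F_i turns the factor l(s) of the curve into a power. *)
Lemma theta_bezoutian_lp c i : exists k,
  th bezoutian_lp (tnth F i) = hat l ^+ deg i * th (bezoutian (pencil c)) (tnth F i) + hat (pencil c) * k.
Proof.
rewrite /theta -(mmap_homog _ _ _ (F_homog i)); apply: mmap_cong => j.
exists (- map_poly (lamn (bvec j)) ((l`_1)%:P)%:P).
by rewrite (bezoutian_lp_pencil c) raddfB /= !map_poly_mulK mulrN.
Qed.

Lemma expr_cong (R : comNzRingType) (P a : R) k : exists b, (1 + P * a) ^+ k = 1 + P * b.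
Proof.
elim: k => [|k [b E]]; first by exists 0; rewrite expr0 mulr0 addr0.
by exists (a + b + P * a * b); rewrite exprS E; ring.
Qed.

(** The functionals dual to the coefficients of T give a point where the curve
    is x + s^(n-1) y. Modulo p_c the power of l(s) is inverted with a Bezout
    relation. For l(z) != 0 the value at z is obtained from c = - p(z) / l(z),
    for which z is a root of p_c. *)
Lemma coprime_case : polynomial_ring (Zpair br (n := n) p (p + l)) (b_lie_n q m n).
Proof.
apply: (pencil_polynomial (G := coprime_gen)).
- have [P PE] := dual_basis bezoutian_lp_nondeg.
  have [x [y xy]] := generic_line_exists charK0 Omega_big.
  (* The coefficients of T are sent to those of x + s^(n-1) y. *)
  pose Y k : 'I_d -> K := if k == 0%N then x else if k == n.-1 then y else fun=> 0.
  have n1 : (0 < n.-1)%N by rewrite -subn1 subn_gt0.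
  pose cv j := (x j)%:P + (y j)%:P * 'X^(n.-1).
  have cvE i' s : \sum_(k' < n) Y k' i' * functional (P k') bezoutian_lp`_s = (cv i')`_s.
    rewrite /cv coefD coefC coefCM coefXn; have [sn|ns] := ltnP s n; last first.
      rewrite big1 => [|k _]; last first.
        by rewrite nth_default ?functional0 ?mulr0 // (leq_trans size_bezoutian_lp).
      case: eqP => [s0|_]; first by move: ns; rewrite s0 leqn0; move: n_ge2; case: (n).
      case: eqP => [s0|_]; last by rewrite mulr0 addr0.
      by move: ns; rewrite s0 leqNgt prednK // leqnn.
    rewrite (bigD1 (Ordinal sn)) //= PE // eqxx mulr1 big1 ?addr0 => [|k ks]; last first.
      by rewrite PE //; move: ks; rewrite -val_eqE /= => /negPf ->; rewrite mulr0.
    rewrite /Y; case: eqP => [->|_]; first by rewrite eq_sym gtn_eqF // mulr0 addr0.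
    by case: eqP => _; rewrite add0r ?mulr1 ?mulr0.
  have wE k : (k < n)%N -> map_poly (functional (P k)) bezoutian_lp = 'X^k.
    move=> kn; apply/polyP => s; rewrite coef_functional coefXn.
    have [sn|ns] := ltnP s n; first by rewrite PE // eq_sym.
    rewrite nth_default ?functional0 ?(leq_trans size_bezoutian_lp) //.
    by rewrite gtn_eqF // (leq_trans kn).
  have dirE i j k e : (k < n)%N ->
      (dir (dual_dir P j k) (th bezoutian_lp (tnth F i))`_e).@[pt (dual_pt P Y)] =
      ((line idfun x y (J i j) \Po 'X^(n.-1)) * 'X^k)`_e.
    by move=> kn; rewrite (dir_theta _ _ _ cvE (wE k kn)) mmap_line.
  have bn (b : 'I_n.-1) : (b.+1 < n)%N by have := ltn_ord b; lia.
  apply: (block_free xy (a := dual_pt P Y) (D := dual_dir P)).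
  + by move=> j i e b b'; rewrite dirE ?bn // coef_block // val_eqE.
  + by move=> j i b'; rewrite dirE ?bn // coefMXn.
  + move=> j i; rewrite dirE // expr0 mulr1 coef_comp_poly_Xn // dvdn0 div0n.
    rewrite -horner_coef0 line_horner; apply: meval_eq => k.
    by rewrite mul0r addr0.
- move=> c i e.
  have /Bezout_eq1_coprimepP[[u1 u2] /= uE] : coprimep l (pencil c).
    by rewrite /pencil -mul_polyC addrC coprimep_addl_mul.
  have [k kE] := theta_bezoutian_lp c i.
  have [b bE] := expr_cong (hat (pencil c)) (- hat u2) (deg i).
  have mP : hat (pencil c) \is monic by rewrite map_monic pencil_monic.
  rewrite (_ : Pdiv.Ring.rmodp _ _ =
      Pdiv.Ring.rmodp (hat (u1 ^+ deg i) * th bezoutian_lp (tnth F i)) (hat (pencil c))).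
    apply: gen_rmodp; first exact: pencil_monic.
    apply: gen_coefM; [exact: gen_hat | exact: coprime_gen_coef].
  apply/esym/(rmodp_eqP (b := th (bezoutian (pencil c)) (tnth F i)) mP).
  exists (b * th (bezoutian (pencil c)) (tnth F i) + hat (u1 ^+ deg i) * k).
  have {}bE : hat (u1 ^+ deg i) * hat l ^+ deg i = 1 + hat (pencil c) * b.
    rewrite -bE rmorphXn -exprMn -rmorphM; congr (_ ^+ _).
    have -> : u1 * l = 1 - u2 * pencil c by rewrite -uE addrK.
    by rewrite rmorphB rmorph1 rmorphM /=; ring.
  by rewrite kE mulrDr mulrA bE; ring.
- move=> t; have Bt i k : gen centres (th bezoutian_lp (tnth F i))`_k.
    apply: (gen_interpolation (w := l) l_neq0 (leqnn _)) => z lz.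
    pose c := - p.[z] / l.[z].
    have rz : root (pencil c) z by rewrite /root /pencil !hornerE /c divfK // addrN.
    rewrite theta_horner.
    have -> : bezoutian_lp.[z%:P] = l.[z] *: (bezoutian (pencil c)).[z%:P].
      rewrite (bezoutian_lp_pencil c) hornerD hornerN !hornerM !horner_map (eqP rz) /=.
      by rewrite mul0r subr0 mul_polyC.
    have -> : tnth F i \mPo [tuple lamn (bvec j) (l.[z] *: (bezoutian (pencil c)).[z%:P]) | j < d] =
        l.[z] ^+ deg i *: (tnth F i \mPo [tuple lamn (bvec j) (bezoutian (pencil c)).[z%:P] | j < d]).
      rewrite /comp_mpoly -mul_mpolyC rmorphXn /= -(mmap_homog _ _ _ (F_homog i)).
      by apply: eq_mmap => // j; rewrite !tnth_mktuple linearZ mul_mpolyC.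
    apply: gen_scale; exact: root_value.
  case: t => [i|[b [i e]]]; exact: Bt.
Qed.

End Coprime.
(** * The pencil when its direction divides the modulus *)

Section CommonRoot.
Variables (t0 nu : K) (nu0 : nu != 0) (p0 : {poly K}).
Hypothesis lE : l = nu *: ('X - t0%:P).
Hypothesis pE : p = ('X - t0%:P) * p0.

Local Notation lam0 := ('X - t0%:P : {poly K}).
Local Notation eps c := (p0 + (c * nu)%:P).

Lemma p0_monic : p0 \is monic.
Proof. by have := p_monic; rewrite pE monicMl // monicXsubC. Qed.

Lemma p0_size : size p0 = n.
Proof.
have := p_size; rewrite pE mulrC size_Mmonic ?monicXsubC ?monic_neq0 ?p0_monic //.
by rewrite size_XsubC addn2 => -[].
Qed.

Lemma pencil_prod c : pencil c = lam0 * eps c.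
Proof. by rewrite /pencil lE pE mulrDr [_ * _%:P]mulrC mul_polyC scalerA. Qed.

(** The part (t - tau) B_(p_0) of the Bezoutian of p_c that is the same for
    all c. *)
Definition base : {poly {poly K}} := lam0%:P * bezoutian p0.

(** Telescoping: f_1 f_2 (s) - f_1 f_2 (t) with f_1 of degree one. *)
Lemma bezoutian_prod f : bezoutian (lam0 * f) = lam0%:P * bezoutian f + map_poly polyC f.
Proof.
have X0 : 'X - ('X : {poly K})%:P != 0 :> {poly {poly K}} by rewrite polyXsubC_eq0.
apply: (mulfI X0); rewrite bezoutian_mul mulrDr mulrCA bezoutian_mul !rmorphM rmorphB /=.
by rewrite map_polyX map_polyC polyCB /=; ring.
Qed.

Lemma bezoutian_pencil_prod c : bezoutian (pencil c) = base + map_poly polyC (eps c).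
Proof.
rewrite pencil_prod bezoutian_prod /base; congr (_ * _ + _).
apply/polyP => k; rewrite !coef_bezoutian; apply/polyP => s.
by rewrite !coef_drop_poly coefD coefC addnS addr0.
Qed.

(** The shift by tau in s moves the common root to 0, where this curve meets
    the next one. *)
Definition base_shift : {poly {poly K}} := base \Po ('X + (t0%:P)%:P).
(** The values at s = tau of the Bezoutians of the pencil, parametrised by the
    value of the cofactor of the common root. *)
Definition pencil_at_root : {poly {poly K}} := (base.[t0%:P])%:P + 'X.

Lemma base_shift_horner (z : K) : base_shift.[z%:P] = base.[(z + t0)%:P].
Proof. by rewrite /base_shift horner_comp !hornerE -polyCD. Qed.

Lemma size_base : (size base <= n.-1)%N.
Proof.
rewrite /base mul_polyC (leq_trans (size_scale_leq _ _)) //.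
by rewrite (leq_trans (size_poly _ _)) // p0_size.
Qed.

Lemma size_base_shift : (size base_shift <= n.-1)%N.
Proof.
by rewrite /base_shift size_comp_poly2 ?size_base // size_XaddC.
Qed.

(** The two curves have the same value at the origin. *)
Lemma theta_base_shift0 i : (th base_shift (tnth F i))`_0 = (th pencil_at_root (tnth F i))`_0.
Proof.
rewrite -!horner_coef0 -(mpolyC0 N K) !theta_horner base_shift_horner add0r.
by rewrite /pencil_at_root hornerD hornerC hornerX polyC0 addr0.
Qed.

(** The coefficients of base_shift and the polynomial 1, which together form a
    basis of the polynomials of degree below n. *)
Definition common_dual k : {poly K} := if (k < n.-1)%N then base_shift`_k else 1.

Lemma map_functional_comp (v : 'I_n -> K) (g : {poly {poly K}}) :
  map_poly (functional v) (g \Po ('X + (t0%:P)%:P)) =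
  map_poly (functional v) g \Po ('X + t0%:P).
Proof.
have XE : 'X + (t0%:P)%:P = map_poly polyC ('X + t0%:P).
  by rewrite rmorphD /= map_polyX map_polyC.
have fC f : map_poly (functional v) f%:P = (functional v f)%:P.
  by apply/polyP => k; rewrite coef_functional !coefC; case: ifP; rewrite ?functional0.
elim/poly_ind: g => [|g f IHg].
  by rewrite comp_poly0 map_poly0 comp_poly0.
have E : map_poly (functional v) (g * 'X) = map_poly (functional v) g * 'X.
  by rewrite [RHS]mulrC -map_functional_mul map_polyX [in RHS]mulrC.
rewrite comp_poly_MXaddC !map_functionalD !fC E comp_polyD comp_polyM comp_polyX comp_polyC.
by rewrite -IHg [in RHS]mulrC -map_functional_mul -XE [in RHS]mulrC.
Qed.

(** The polynomials (t - tau) h, for h a Horner polynomial of p_0, are monic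
    of degrees 1, ..., n - 1, and 1 has degree 0. *)
Lemma common_dual_nondeg (v : 'I_n -> K) :
  (forall k, (k < n)%N -> functional v (common_dual k) = 0) -> forall s, v s = 0.
Proof.
move=> vf.
have vV : map_poly (functional v) base_shift = 0.
  apply/polyP => k; rewrite coef0 coef_functional.
  case: (ltnP k n.-1) => [kn|nk]; last first.
    by rewrite nth_default ?functional0 // (leq_trans size_base_shift).
  by have := vf k; rewrite /common_dual kn; apply; rewrite (leq_trans kn) ?leq_pred.
have vB : map_poly (functional v) base = 0.
  have := vV; rewrite /base_shift map_functional_comp => /eqP.
  by rewrite comp_poly2_eq0 ?size_XaddC // => /eqP.
apply: monic_family_span => -[_|s sn].
  exists 1; split; [exact: monic1 | exact: size_poly1 |].
  by have := vf n.-1; rewrite /common_dual ltnn; apply; rewrite prednK.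
have kn : (n.-1 - s.+1 < n.-1)%N by move: sn n_ge2; lia.
have p0s : size p0 = n.-1.+1 by rewrite p0_size prednK.
have [dm ds] := drop_poly_monic p0_monic p0s kn.
exists (lam0 * drop_poly (n.-1 - s.+1).+1 p0); split.
- by rewrite monicMl ?monicXsubC.
- rewrite mulrC size_Mmonic ?monicXsubC ?monic_neq0 // size_XsubC addn2 /= ds.
  by move: sn n_ge2; lia.
- have := congr1 (fun g : {poly K} => g`_(n.-1 - s.+1)) vB.
  by rewrite coef_functional /base coefCM coef_bezoutian coef0.
Qed.

(** The constant coefficients of the U_i; the n - 2 families of higher
    coefficients of the V_i; and, as the last family, those of the U_i. *)
Definition common_gen (t : block_index) : S := match t with
  | inl i => (th pencil_at_root (tnth F i))`_0
  | inr (b, existT i e) => if (b < n.-2)%N then (th base_shift (tnth F i))`_(b.+1 + n.-2 * e)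
                           else (th pencil_at_root (tnth F i))`_e.+1
  end.

Local Notation genBs := (fun x => exists t, x = common_gen t).

Lemma common_gen_U i k : gen genBs (th pencil_at_root (tnth F i))`_k.
Proof.
have [sk|ks] := ltnP (deg i) k.
  have top_cur j : top 1 (map_poly (lamn (bvec j)) pencil_at_root) (lamn (bvec j) pencil_at_root`_1).
    split; last by rewrite coef_map.
    rewrite (leq_trans (size_poly _ _)) // (leq_trans (size_polyD _ _)) // geq_max size_polyX.
    by rewrite (leq_trans (size_polyC_leq1 _)).
  have [st _] := top_mmap (@mpolyC N K) top_cur (F_homog i).
  by rewrite nth_default ?(leq_trans st) ?mul1n //; exact: gen0.
case: k ks => [|k] ks; first by apply: gen_base; exists (inl i).
have kb : (n.-2 < n.-1)%N by move: n_ge2; lia.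
apply: gen_base; exists (inr (Ordinal kb, existT _ i (Ordinal ks))) => /=.
by rewrite ltnn.
Qed.

Lemma common_gen_V i k : gen genBs (th base_shift (tnth F i))`_k.
Proof.
case: k => [|k]; first by rewrite theta_base_shift0; exact: common_gen_U.
have n1 : n.-1 = n.-2.+1 by move: n_ge2; lia.
have [sk|ks] := ltnP (n.-2 * deg i) k.+1.
  have top_cur j : top n.-2 (map_poly (lamn (bvec j)) base_shift) (lamn (bvec j) base_shift`_n.-2).
    split; last by rewrite coef_map.
    by rewrite -n1 (leq_trans (size_poly _ _)) ?size_base_shift.
  have [st _] := top_mmap (@mpolyC N K) top_cur (F_homog i).
  by rewrite nth_default ?(leq_trans st) //; exact: gen0.
have n2 : (0 < n.-2)%N by case: (n.-2) ks.
have ke : (k %/ n.-2 < deg i)%N by rewrite ltn_divLR // mulnC.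
have kb : (k %% n.-2 < n.-2)%N by rewrite ltn_mod.
have kb1 : (k %% n.-2 < n.-1)%N by rewrite n1 ltnW.
apply: gen_base; exists (inr (Ordinal kb1, existT _ i (Ordinal ke))) => /=.
by rewrite kb addSn {1}(divn_eq k n.-2) addnC mulnC.
Qed.

(** The polynomials F_i on the curve base with a free parameter added: it
    specialises to theta of the Bezoutian of p_c and to U_i. *)
Definition Phi i : {poly {poly S}} :=
  line (polyC \o @mpolyC N K) (fun j => map_poly (lamn (bvec j)) base)
    (fun j => (lamn (bvec j) 1)%:P) (tnth F i).

Lemma Phi_horner i (g : {poly K}) :
  (Phi i).[hat g] = th (base + map_poly polyC g) (tnth F i).
Proof.
rewrite -horner_evalE; apply: mmap_rmorph => [c|j] /=.
  by rewrite horner_evalE hornerC.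
rewrite horner_evalE !hornerE raddfD /= -[map_poly polyC g]mulr1 map_poly_mulK.
by rewrite -polyC1 cur_const mulrC.
Qed.

Lemma Phi_root i : map_poly (horner_eval t0%:MP) (Phi i) = th pencil_at_root (tnth F i).
Proof.
apply: mmap_rmorph => [c|j] /=.
  by rewrite map_polyC /= horner_evalE hornerC.
rewrite rmorphD rmorphM /= map_polyX !map_polyC /= !horner_evalE hornerC cur_horner.
rewrite /pencil_at_root raddfD /= cur_const; congr (_ + _).
apply/polyP => k; rewrite coefCM coef_map !coefX /=.
by case: eqP => _; rewrite ?mulr1 ?mulr0 ?linear0.
Qed.

(** Write Phi = Phi(0) + e Psi(e), where e becomes the cofactor of s - tau in
    p_c(s). Modulo p_c only the value of Psi at s = tau matters, and this is a
    combination of coefficients of U_i. *)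
Lemma theta_common c i : exists psi X, gen genBs psi /\
  th (bezoutian (pencil c)) (tnth F i) = th base (tnth F i) + psi%:P * hat (eps c) + hat (pencil c) * X.
Proof.
have /factor_theorem[Psi PsiE] : root (Phi i - ((Phi i).[0])%:P) 0.
  by rewrite /root !hornerE subrr.
rewrite subr0 in PsiE; set e := hat (eps c); set psi := (Psi.[e]).[t0%:MP].
have /factor_theorem[X XE] : root (Psi.[e] - psi%:P) t0%:MP.
  by rewrite /root !hornerE subrr.
exists psi, X; split.
  have -> : psi = (map_poly (horner_eval t0%:MP) Psi).[(eps c).[t0]%:MP].
    have -> : (eps c).[t0]%:MP = horner_eval t0%:MP e.
      by rewrite horner_evalE horner_map.
    by rewrite horner_map /= horner_evalE.
  rewrite horner_coef; apply: gen_sum => s _; apply: gen_mul; last first.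
    by rewrite -rmorphXn; exact: gen_const.
  suff -> : (map_poly (horner_eval t0%:MP) Psi)`_s =
      (th pencil_at_root (tnth F i))`_s.+1 by exact: common_gen_U.
  rewrite -Phi_root -[Phi i](subrK ((Phi i).[0])%:P) PsiE rmorphD rmorphM /= map_polyX.
  by rewrite map_polyC /= coefD coefMX coefC /= addr0.
have pcE : hat (pencil c) = ('X - (t0%:MP)%:P) * e.
  by rewrite pencil_prod rmorphM /= rmorphB /= map_polyX map_polyC.
have th0 : (Phi i).[0] = th base (tnth F i).
  by have := Phi_horner i 0; rewrite !rmorph0 addr0.
rewrite bezoutian_pencil_prod -Phi_horner -/e -[Phi i](subrK ((Phi i).[0])%:P) PsiE th0.
rewrite hornerD hornerM hornerX hornerC -[Psi.[e]](subrK psi%:P) XE.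
by rewrite pcE; ring.
Qed.

(** The functionals dual to common_dual give a point where the curves are x +
    s^(n-2) y and x + s y. Each value of V_i is taken at a root of a cofactor
    of the pencil, each value of U_i at the common root. *)
Lemma common_root_case : polynomial_ring (Zpair br (n := n) p (p + l)) (b_lie_n q m n).
Proof.
apply: (pencil_polynomial (G := common_gen)).
- have [P PE] := dual_basis common_dual_nondeg.
  have [x [y xy]] := generic_line_exists charK0 Omega_big.
  (* The index n - 2 is the top coefficient of the first curve, and n - 1 is
     the polynomial 1, which is the top coefficient of the second one. For
     n = 2 the first curve is constant and x takes precedence. *)
  pose Y k : 'I_d -> K := if k == 0%N then x else
    if (k == n.-2) || (k == n.-1) then y else fun=> 0.
  have n1 : n.-1 = n.-2.+1 by move: n_ge2; lia.
  have n1n : (n.-1 < n)%N by rewrite prednK.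
  have ltn1 k : (k < n.-1)%N -> (k < n)%N by move=> kn; exact: ltn_trans kn n1n.
  have f0 : common_dual 0 = base.[t0%:P].
    by rewrite /common_dual n1 /= -horner_coef0 -polyC0 base_shift_horner add0r.
  have fn : common_dual n.-1 = 1 by rewrite /common_dual ltnn.
  have Yf i' k : (k < n)%N -> \sum_(k' < n) Y k' i' * functional (P k') (common_dual k) = Y k i'.
    move=> kn; rewrite (bigD1 (Ordinal kn)) //= PE // eqxx mulr1 big1 ?addr0 // => k' kk.
    by rewrite PE //; move: kk; rewrite -val_eqE /= => /negPf ->; rewrite mulr0.
  have Y0 i' (f : {poly K}) : f = 0 -> \sum_(k' < n) Y k' i' * functional (P k') f = 0.
    by move=> ->; rewrite big1 // => k' _; rewrite functional0 mulr0.
  have cU i' s : \sum_(k' < n) Y k' i' * functional (P k') pencil_at_root`_s =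
      ((x i')%:P + (y i')%:P * 'X^1)`_s.
    rewrite coefD coefC coefCM coefXn /pencil_at_root coefD coefC coefX.
    case: s => [|[|s]] /=; rewrite ?mulr0 ?mulr1 ?add0r ?addr0; last by rewrite Y0.
      by rewrite -f0 Yf // /Y eqxx.
    by rewrite -[1]fn Yf // /Y {1}n1 /= eqxx orbT.
  have cV i' s : (0 < n.-2)%N -> \sum_(k' < n) Y k' i' * functional (P k') base_shift`_s =
      ((x i')%:P + (y i')%:P * 'X^(n.-2))`_s.
    move=> n2; rewrite coefD coefC coefCM coefXn.
    have [sn|ns] := ltnP s n.-1; last first.
      rewrite Y0; last by rewrite nth_default // (leq_trans size_base_shift).
      rewrite !gtn_eqF ?mulr0 ?addr0 //; first by rewrite (leq_trans _ ns) // n1.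
      by rewrite (leq_trans _ ns) // n1.
    have -> : base_shift`_s = common_dual s by rewrite /common_dual sn.
    rewrite Yf ?ltn1 // /Y [s == n.-1]ltn_eqF // orbF.
    case: eqP => [->|_]; first by rewrite eq_sym gtn_eqF // mulr0 addr0.
    by case: eqP => _; rewrite add0r ?mulr1 ?mulr0.
  have wV k : (k < n)%N -> map_poly (functional (P k)) base_shift = if (k < n.-1)%N then 'X^k else 0.
    move=> kn; apply/polyP => s; rewrite coef_functional.
    have -> : (if (k < n.-1)%N then 'X^k else 0 : {poly K})`_s = ((k < n.-1)%N && (s == k))%:R.
      by case: ifP => _; rewrite ?coefXn ?coef0.
    have [sn|ns] := ltnP s n.-1; last first.
      rewrite nth_default ?functional0 ?(leq_trans size_base_shift) //.
      by case: ltnP => //= kn1; rewrite gtn_eqF // (leq_trans kn1).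
    have -> : base_shift`_s = common_dual s by rewrite /common_dual sn.
    rewrite PE ?(ltn1 s) // [X in _ && X]eq_sym; case: eqP => [->|_]; last by rewrite andbF.
    by rewrite sn.
  have wU k : (k < n)%N ->
      map_poly (functional (P k)) pencil_at_root = (k == 0%N)%:R%:P + (k == n.-1)%:R%:P * 'X.
    move=> kn; apply/polyP => s; rewrite coef_functional /pencil_at_root -f0 !coefD !coefC coefCM !coefX.
    case: s => [|[|s]] /=; rewrite ?mulr0 ?mulr1 ?add0r ?addr0 ?functional0 //.
      by rewrite PE.
    by rewrite -fn PE.
  have bn (b : 'I_n.-1) : (b.+1 < n)%N by have := ltn_ord b; lia.
  apply: (block_free xy (a := dual_pt P Y) (D := dual_dir P)).
  + move=> j i e b b' /=; case: ifP => bn2.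
      have n2 : (0 < n.-2)%N by case: (n.-2) bn2.
      rewrite (dir_theta _ _ _ (fun i' s => cV i' s n2) (wV _ (bn b'))) mmap_line -ltn_predRL.
      case: ltnP => b'n; first by rewrite coef_block // val_eqE.
      rewrite mulr0 coef0; case: eqP => [E|_]; last by rewrite mul0r.
      by move: b'n; rewrite -E leqNgt bn2.
    rewrite (dir_theta _ _ _ cU (wU _ (bn b'))) mmap_line /= polyC0 add0r expr1 comp_polyXr.
    rewrite mulrCA coefCM coefMX /=; congr (_%:R * _).
    rewrite -val_eqE /=; congr (nat_of_bool _).
    by apply/eqP/eqP; move: (ltn_ord b) (ltn_ord b') bn2; lia.
  + move=> j i b' /=; rewrite (dir_theta _ _ _ cU (wU _ (bn b'))) /=.
    by rewrite polyC0 add0r mulrCA coefCM coefMX mulr0.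
  + move=> j i /=; rewrite (dir_theta _ _ _ cU (wU _ n_gt0)) {1}n1 /= polyC0 mul0r addr0.
    rewrite polyC1 mulr1 mmap_line expr1 comp_polyXr -horner_coef0 line_horner.
    by apply: meval_eq => k; rewrite mul0r addr0.
- move=> c i e; have [psi [X [Apsi E]]] := theta_common c i.
  have mP : hat (pencil c) \is monic by rewrite map_monic pencil_monic.
  rewrite (rmodp_eqP (b := th base (tnth F i) + psi%:P * hat (eps c)) mP); last by exists X.
  apply: gen_rmodp; first exact: pencil_monic.
  move=> s; rewrite coefD; apply: gen_add; last first.
    by rewrite coefCM; apply: gen_mul => //; exact: gen_hat.
  apply: (gen_interpolation (w := 1) (oner_neq0 _) (leqnn _)) => z _.
  have -> : (th base (tnth F i)).[z%:MP] = (th base_shift (tnth F i)).[(z - t0)%:MP].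
    by rewrite !theta_horner base_shift_horner subrK.
  rewrite horner_coef; apply: gen_sum => k _; apply: gen_mul; first exact: common_gen_V.
  by rewrite -rmorphXn; exact: gen_const.
- have UE i k : gen centres (th pencil_at_root (tnth F i))`_k.
    apply: (gen_interpolation (w := 1) (oner_neq0 _) (leqnn _)) => z _.
    pose c := (z - p0.[t0]) / nu.
    have ez : (eps c).[t0] = z by rewrite !hornerE /c divfK // addrC subrK.
    have rt : root (pencil c) t0 by rewrite pencil_prod rootM root_XsubC eqxx.
    have := root_value i rt; rewrite theta_horner bezoutian_pencil_prod hornerD horner_map /= ez.
    by rewrite /pencil_at_root !hornerE.
  have VE i k : gen centres (th base_shift (tnth F i))`_k.
    apply: (gen_interpolation (w := 1) (oner_neq0 _) (leqnn _)) => z _.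
    pose c := - p0.[z + t0] / nu.
    have ez : (eps c).[z + t0] = 0 by rewrite !hornerE /c divfK // addrN.
    have rt : root (pencil c) (z + t0) by rewrite pencil_prod rootM /root ez eqxx orbT.
    have := root_value i rt; rewrite theta_horner bezoutian_pencil_prod hornerD horner_map /= ez.
    by rewrite polyC0 addr0 base_shift_horner.
  by case=> [i|[b [i e]]] /=; [exact: UE | case: ifP => _; [exact: VE | exact: UE]].
Qed.

End CommonRoot.

End Pencil.

Theorem theorem6p2 (K : closedFieldType) (charK0 : [pchar K] =i pred0)
  (q : vectType K) (br : q -> q -> q) (br_lie : lie_bracket br)
  (br_nonab : exists x y : q, br x y != 0)
  (n : nat) (n_ge2 : (2 <= n)%N)
  (m : nat) (m_ind : is_index br m)
  (F : m.-tuple (Sym q))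
  (F_homog : forall i : 'I_m, exists d : nat, tnth F i \is d.-homog)
  (F_indep : alg_indep F)
  (F_gen : generated_by (sym_inv br) F)
  (Omega_big : big (wedge_neq0 F))
  (codim2 : codim_property 2 br)
  (p : {poly K}) (p_monic : p \is monic) (p_deg : size p = n.+1)
  (l : {poly K}) (l_neq0 : l != 0) (l_deg : (size l <= 2)%N) :
  polynomial_ring (Zpair br (n := n) p (p + l)) (b_lie_n q m n).
Proof.
have [deg {}F_homog] := fin_all_exists F_homog.
have F_inv i : sym_inv br (tnth F i).
  by apply/F_gen; exists 'X_i; rewrite comp_mpolyXU -tnth_nth.
have [cop|ncop] := boolP (coprimep l p).
  exact: (coprime_case charK0 br_lie m_ind F_homog).
have /closed_rootP[t0] : size (gcdp l p) != 1%N by rewrite -coprimep_def.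
rewrite root_gcd => /andP[/factor_theorem[l1 lE] /factor_theorem[p0 pE]].
have l1_neq0 : l1 != 0 by apply: contraNneq l_neq0 => l10; rewrite lE l10 mul0r.
have l1_size : (size l1 <= 1)%N.
  by move: l_deg; rewrite lE size_Mmonic ?monicXsubC // size_XsubC addn2.
have l1E := size1_polyC l1_size.
have l1'0 : l1`_0 != 0 by rewrite -polyC_eq0 -l1E.
apply: (common_root_case charK0 br_lie m_ind F_homog F_inv Omega_big codim2 n_ge2
  p_monic p_deg l_deg l1'0 (t0 := t0) (p0 := p0)).
- by rewrite -mul_polyC -l1E.
- by rewrite pE mulrC.
Qed.
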